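(* There is an algorithm which, on input of a degree bound $d\in\mathbb{N}$ with $d\geq 2$, a relational signature $\sigma$, and a first-order formula $\phi(\overline{x})$ over $\sigma$, computes a formula $\phi^B(\overline{x})$ in Barthelmann-Schwentick normal form (BSNF) that is $d$-equivalent to $\phi(\overline{x})$. The algorithm runs in time \[ 2^{(\|\phi\|\cdot\nu_d((n+1)(2\cdot 4^q+1)))^{O(\|\sigma\|)}}, \] where $n\geq 0$ is the number of free variables of $\phi$ and $q\geq 0$ is the quantifier rank of $\phi$.
   Context: All structures are finite with non-empty universe. A relational signature $\sigma$ is a finite set of relation symbols with arities $\geq 1$; $\|\sigma\|$ denotes its size and $\|\phi\|$ denotes the length of a formula $\phi$ viewed as a word over the alphabet consisting of symbols of $\sigma$, variables, comma, $=,\exists,\neg,\lor$ and parentheses. The Gaifman graph of a structure $\mathcal{A}$ has vertex set $A$ and an edge between distinct $a,b$ iff they occur together in some tuple of some relation of $\mathcal{A}$; $\mathrm{dist}^{\mathcal{A}}$ is the distance in it, and $N_r^{\mathcal{A}}(b_1,\dots,b_m)$ is the set of elements at distance $\leq r$ from some $b_i$. A structure is $d$-bounded if every vertex of its Gaifman graph has at most $d$ neighbours. Two formulae are $d$-equivalent if they are satisfied by exactly the same interpretations of their free variables in all $d$-bounded $\sigma$-structures. $\nu_d(r) := 1 + d\cdot\sum_{0\leq i<r}(d-1)^i$. A formula $\phi(x_1,\dots,x_m,y_1,\dots,y_n)$ is $r$-local around $y_1,\dots,y_n$ if for every structure $\mathcal{A}$ and all $a_1,\dots,a_m,b_1,\dots,b_n\in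 A$: $\mathcal{A}\models\phi[\overline{a},\overline{b}]$ iff $\mathcal{A}[\{a_1,\dots,a_m\}\cup N_r^{\mathcal{A}}(b_1,\dots,b_n)]\models\phi[\overline{a},\overline{b}]$ (where $\mathcal{A}[X]$ is the induced substructure). A formula is in BSNF if it has the form $\exists y_1\cdots\exists y_n\forall z\,\psi(\overline{x},y_1,\dots,y_n,z)$ with $n\geq 0$ and $\psi$ $r$-local around $z$ for some $r\geq 0$ (its locality radius). *)

(* Defs.v *)
From mathcomp Require Import all_boot.
Set Implicit Arguments.
Unset Strict Implicit.
Unset Printing Implicit Defensive.

(** * Signatures and formulas *)

(** The relation symbols of a signature are numbered [0, ..., k - 1];
    a signature is the sequence of their arities. *)
Record signature := Signature {
  arities : seq nat;
  arities_gt0 : all (leq 1) arities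
}.

Definition symbol (sg : signature) := 'I_(size (arities sg)).

Definition arity (sg : signature) (R : symbol sg) : nat := nth 0 (arities sg) R.

Definition sig_size (sg : signature) : nat := sumn (arities sg).

(** Variables are natural numbers. *)
Inductive formula (sg : signature) : Type :=
| Eq (x y : nat)
| Rel (R : symbol sg) (v : (arity R).-tuple nat)
| Neg (p : formula sg)
| Or (p q : formula sg)
| Ex (x : nat) (p : formula sg).

Arguments Eq {sg} x y.
Arguments Rel {sg} R v.

Definition All (sg : signature) (x : nat) (p : formula sg) : formula sg :=
  Neg (Ex x (Neg p)).

Fixpoint fv (sg : signature) (p : formula sg) : seq nat :=
  match p with
  | Eq x y => [:: x; y]
  | Rel _ v => v
  | Neg p1 => fv p1
  | Or p1 p2 => fv p1 ++ fv p2
  | Ex x p1 => [seq y <- fv p1 | y != x]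
  end.

Definition nb_fv (sg : signature) (p : formula sg) : nat := size (undup (fv p)).

Fixpoint qrank (sg : signature) (p : formula sg) : nat :=
  match p with
  | Eq _ _ | Rel _ _ => 0
  | Neg p1 => qrank p1
  | Or p1 p2 => maxn (qrank p1) (qrank p2)
  | Ex _ p1 => (qrank p1).+1
  end.

(** * Formulas as words *)

Inductive letter :=
| RelL (i : nat) | VarL (x : nat)
| CommaL | EqL | ExL | NegL | OrL | LparL | RparL.

Fixpoint comma_sep (s : seq nat) : seq letter :=
  match s with
  | [::] => [::]
  | [:: x] => [:: VarL x]
  | x :: s' => VarL x :: CommaL :: comma_sep s'
  end.

Fixpoint word (sg : signature) (p : formula sg) : seq letter :=
  match p with
  | Eq x y => [:: VarL x; EqL; VarL y]
  | Rel R v => RelL R :: LparL :: comma_sep v ++ [:: RparL]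
  | Neg p1 => NegL :: word p1
  | Or p1 p2 => LparL :: word p1 ++ OrL :: word p2 ++ [:: RparL]
  | Ex x p1 => ExL :: VarL x :: word p1
  end.

Definition formula_size (sg : signature) (p : formula sg) : nat := size (word p).

(** * Structures and satisfaction *)

Record structure (sg : signature) := Structure {
  dom :> finType;
  dom_gt0 : 0 < #|dom|;
  interp : forall R : symbol sg, {set (arity R).-tuple dom}
}.

Definition upd (T : Type) (s : nat -> T) (x : nat) (a : T) : nat -> T :=
  fun y => if y == x then a else s y.

Fixpoint sat (sg : signature) (A : structure sg) (s : nat -> A)
    (p : formula sg) : bool :=
  match p with
  | Eq x y => s x == s y
  | Rel R v => map_tuple s v \in interp A R
  | Neg p1 => ~~ sat s p1
  | Or p1 p2 => sat s p1 || sat s p2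
  | Ex x p1 => [exists a : A, sat (upd s x a) p1]
  end.

Lemma induced_gt0 (sg : signature) (A : structure sg) (X : {set A}) :
  0 < #|X| -> 0 < #|{: {a : A | a \in X}}|.
Proof. by rewrite card_sig. Qed.

Definition induced (sg : signature) (A : structure sg) (X : {set A})
    (hX : 0 < #|X|) : structure sg :=
  Structure (induced_gt0 hX)
    (fun R => [set t : (arity R).-tuple {a : A | a \in X}
                | map_tuple val t \in interp A R]).

(** * Gaifman graph, bounded degree, locality *)

Definition gaifman (sg : signature) (A : structure sg) : rel A :=
  fun a b => (a != b) &&
    [exists R : symbol sg, exists t in interp A R, (a \in t) && (b \in t)].
Arguments gaifman {sg} A.

Definition dist_le (sg : signature) (A : structure sg) (r : nat) (a b : A) : bool :=
  [exists l : 'I_r.+1, exists w : l.-tuple A,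
     path (gaifman A) a w && (last a w == b)].

Definition nbh (sg : signature) (A : structure sg) (r : nat) (B : {set A}) : {set A} :=
  [set a | [exists b in B, dist_le r b a]].

Definition bounded (sg : signature) (d : nat) (A : structure sg) : Prop :=
  forall a : A, #|[set b | gaifman A a b]| <= d.

Definition d_equiv (sg : signature) (d : nat) (p q : formula sg) : Prop :=
  forall A : structure sg, bounded d A ->
  forall s : nat -> A, sat s p = sat s q.

Definition nu (d r : nat) : nat := 1 + d * \sum_(0 <= i < r) (d - 1) ^ i.

(** The elements interpreting the free variables, together with the
    [r]-neighbourhood of the elements interpreting [ys]. *)
Definition local_part (sg : signature) (A : structure sg) (r : nat)
    (ys : seq nat) (p : formula sg) (s : nat -> A) : {set A} :=
  [set a in map s (fv p)] :|: nbh r [set a in map s ys].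

(** An assignment into the induced substructure is only required to agree with
    [s] on the free variables.  The premise [hX] is automatic if [ys] is
    nonempty. *)
Definition local_around (sg : signature) (r : nat) (ys : seq nat)
    (p : formula sg) : Prop :=
  forall (A : structure sg) (s : nat -> A)
         (hX : 0 < #|local_part r ys p s|) (s' : nat -> induced hX),
    {in fv p, forall x, val (s' x) = s x} ->
    sat s p = sat s' p.

Definition BSNF (sg : signature) (p : formula sg) : Prop :=
  exists (ys : seq nat) (z : nat) (psi : formula sg) (r : nat),
    [/\ uniq (z :: ys),
        p = foldr (@Ex sg) (All z psi) ys &
        local_around r [:: z] psi].

(** * Random access machines

    Cook-Reckhow instruction set, over natural numbers (subtraction is
    truncated) and with the uniform cost measure: each executed instruction
    costs one.  There is no multiplication, so this model is polynomially
    equivalent to Turing machines. *)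

Inductive instr :=
| Const (i c : nat)    (* X_i <- c *)
| Add (i j k : nat)    (* X_i <- X_j + X_k *)
| Sub (i j k : nat)    (* X_i <- X_j - X_k *)
| LoadAt (i j : nat)     (* X_i <- X_(X_j) *)
| StoreAt (i j : nat)    (* X_(X_i) <- X_j *)
| Jump (j l : nat)     (* if X_j > 0, go to instruction l *)
| Read (i : nat)       (* X_i <- next input number, or 0 at the end of input *)
| Print (i : nat).     (* append X_i to the output *)

Definition program := seq instr.

Record config := Config {
  pc : nat;
  mem : nat -> nat;
  inp : seq nat;
  out : seq nat
}.

Definition exec (ins : instr) (c : config) : config :=
  let: Config l m u o := c in
  match ins with
  | Const i v => Config l.+1 (upd m i v) u o
  | Add i j k => Config l.+1 (upd m i (m j + m k)) u o
  | Sub i j k => Config l.+1 (upd m i (m j - m k)) u o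
  | LoadAt i j => Config l.+1 (upd m i (m (m j))) u o
  | StoreAt i j => Config l.+1 (upd m (m i) (m j)) u o
  | Jump j l' => Config (if 0 < m j then l' else l.+1) m u o
  | Read i => Config l.+1 (upd m i (head 0 u)) (behead u) o
  | Print i => Config l.+1 m u (rcons o (m i))
  end.

Definition halted (P : program) (c : config) : bool := size P <= pc c.

Definition step (P : program) (c : config) : config :=
  if onth P (pc c) is Some ins then exec ins c else c.

Definition init (w : seq nat) : config := Config 0 (fun=> 0) w [::].

Definition computes_within (P : program) (w v : seq nat) (T : nat) : Prop :=
  exists2 t, t <= T &
    let c := iter t (step P) (init w) in halted P c /\ out c = v.

(** * Encoding of inputs and outputs

    As in the definition of the length of a formula, every letter, including
    every variable, is one unit: it is represented by a single number, which is
    never [0], the value read at the end of the input.  Codes of variables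
    start above the codes of the [k] relation symbols, so that the kind of a
    letter can be told by comparisons. *)
Definition code (k : nat) (a : letter) : nat :=
  match a with
  | CommaL => 1
  | EqL => 2
  | ExL => 3
  | NegL => 4
  | OrL => 5
  | LparL => 6
  | RparL => 7
  | RelL i => 8 + i
  | VarL x => 8 + k + x
  end.

Definition enc_formula (sg : signature) (p : formula sg) : seq nat :=
  map (code (size (arities sg))) (word p).

Definition enc_input (d : nat) (sg : signature) (p : formula sg) : seq nat :=
  d :: size (arities sg) :: arities sg ++ enc_formula p.

(** * Asymptotics *)

Definition bigO (f g : nat -> nat) : Prop :=
  exists c k0 : nat, forall k, k0 <= k -> f k <= c * g k.

(* Main.v *)
(* Let [rad 0 = 0] and [rad m.+1 = 3 * rad m + 1].  In a [d]-bounded structure a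
   ball of radius [rad q] has at most [nu d (rad q)] elements, so it is listed by
   a cell, a bounded tuple of variables.  The normal form guesses [nC] cells and
   says of every element [z] that the free variables are centers of cells, that
   [z] does not witness an error in the listing of the balls, that [z] is a
   center or else the centers whose ball has the type of the ball of [z] cannot
   be covered by [nT] elements, and that the formula holds with each quantifier
   relativized to balls around the centers, of radius [rad q - rad m] if [m] is
   the quantifier rank that remains.  Such cells exist: take as centers the free
   variables and, for each type, all its elements or more than [nT] of them.
   Given such cells, the relativized formula is equivalent to the original one by
   an Ehrenfeucht game in which balls of radius [rad m] stay isomorphic: an
   element far from the earlier ones is answered by a center of the same type,
   chosen far from the earlier answers.

   The normal form is printed by a loop program, which copies the formula with
   the guards inserted at its quantifiers, and which is compiled to a random
   access machine.  Its running time is bounded by a power, fixed by the program,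
   of the number of iterations of its longest loop. *)
Require Import Defs.
From mathcomp Require Import all_boot zify.
From mathcomp Require Import boolp.
From Stdlib Require Import FunctionalExtensionality.
Set Implicit Arguments.
Unset Strict Implicit.
Unset Printing Implicit Defensive.

(** * Loop programs and their compilation *)

(** The matrix has one universal element and may depend only on its neighbourhood and on the
    variables. So every error in the guess must be witnessed by a single element nearby, and no
    other quantifier may reach further: those of [rel_] range over entries of cells, a listing of
    the ball of [z] stays in that ball, and a covering element matters only if it equals a center.

    In [rad], an element within [2 * r + 1] of the earlier ones brings a ball of radius [r] that
    lies within [3 * r + 1] of them; beyond [2 * r + 1], balls of radius [r] are disjoint and no
    tuple joins them. A new answer only has to avoid the ball of radius [2 * r + 1] around the
    earlier answers, and [nT] bounds its size; hence [nT] elements must not cover the centers of a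
    type.

    The number of cells is exponential in a power of the ball size whose exponent is linear in the
    signature. This has the shape of the required bound, so any fixed power of the number of cell
    variables is affordable as running time, and crude loops suffice. *)

Inductive expr :=
| EC (n : nat) | EV (x : nat) | EAdd (a b : expr) | ESub (a b : expr) | ELd (a : expr).

(** [For x a d n c] evaluates [a], [d], [n] once, on entry, runs [c] for [n] values of [x] in
    arithmetic progression and restores [x]. Termination is built in, and the centers of the cells
    are reached without multiplication, which the machine lacks. *)
Inductive cmd :=
| Pr (e : expr)
| Sq (c1 c2 : cmd)
| For (x : nat) (a d n : expr) (c : cmd)
| St (a e : expr)
| If (e : expr) (c : cmd).

Fixpoint eval (m : nat -> nat) (e : expr) : nat :=
  match e with
  | EC n => n
  | EV x => m x
  | EAdd a b => eval m a + eval m b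
  | ESub a b => eval m a - eval m b
  | ELd a => m (eval m a)
  end.

Definition state : Type := ((nat -> nat) * seq nat)%type.

Fixpoint sem (c : cmd) (s : state) : state :=
  match c with
  | Pr e => (s.1, rcons s.2 (eval s.1 e))
  | Sq c1 c2 => sem c2 (sem c1 s)
  | For x a d n c =>
    let s' := foldl (fun s' i => sem c (upd s'.1 x (eval s.1 a + i * eval s.1 d), s'.2))
                    s (iota 0 (eval s.1 n)) in
    (upd s'.1 x (s.1 x), s'.2)
  | St a e => (upd s.1 (eval s.1 a) (eval s.1 e), s.2)
  | If e c => if 0 < eval s.1 e then sem c s else s
  end.

(* The compiled code keeps 0 and 1 in the registers 0 and 1, uses the registers
   from [t] on for intermediate results, and stores the memory of the loop program
   from register [off] on; [l] is the address of the first instruction. *)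
Fixpoint ce (off t : nat) (e : expr) : seq instr :=
  match e with
  | EC n => [:: Const t n]
  | EV x => [:: Add t (off + x) 0]
  | EAdd a b => ce off t a ++ ce off t.+1 b ++ [:: Add t t t.+1]
  | ESub a b => ce off t a ++ ce off t.+1 b ++ [:: Defs.Sub t t t.+1]
  | ELd a => ce off t a ++ [:: Const t.+1 off; Add t t t.+1; LoadAt t t]
  end.

(** In a loop, [t] counts the rounds left, [t.+1] holds the next value of [x], [t.+2] the increment
    and [t.+3] the value to restore. The entry jumps to the test at the end, so zero rounds are
    possible. [If] jumps on [1 - e], since only positive registers cause a jump. *)
Fixpoint cc (off l t : nat) (c : cmd) : seq instr :=
  match c with
  | Pr e => ce off t e ++ [:: Print t]
  | Sq c1 c2 => let k := cc off l t c1 in k ++ cc off (l + size k) t c2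
  | St a e => ce off t a ++ ce off t.+1 e ++
      [:: Const t.+2 off; Add t t t.+2; StoreAt t t.+1]
  | If e c => let l' := l + size (ce off t e) + 2 in let k := cc off l' t c in
      ce off t e ++ [:: Defs.Sub t 1 t; Jump t (l' + size k)] ++ k
  | For x a d n c =>
      let pre := ce off t n ++ ce off t.+1 a ++ ce off t.+2 d ++
                 [:: Add t.+3 (off + x) 0] in
      let l' := l + size pre + 1 in
      let k := cc off l'.+1 t.+4 c in
      pre ++ [:: Jump 1 (l' + size k + 3)] ++ [:: Add (off + x) t.+1 0] ++ k ++
      [:: Add t.+1 t.+1 t.+2; Defs.Sub t t 1; Jump t l'; Add (off + x) t.+3 0]
  end.

Fixpoint esize (e : expr) : nat :=
  match e with
  | EC _ | EV _ => 1
  | EAdd a b | ESub a b => esize a + esize b + 1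
  | ELd a => esize a + 3
  end.

Fixpoint csize (c : cmd) : nat :=
  match c with
  | Pr e => esize e + 1
  | Sq c1 c2 => csize c1 + csize c2
  | St a e => esize a + esize e + 3
  | If e c => esize e + csize c + 2
  | For x a d n c => esize a + esize d + esize n + csize c + 7
  end.

Fixpoint time (c : cmd) (s : state) : nat :=
  match c with
  | Pr e => esize e + 1
  | Sq c1 c2 => time c1 s + time c2 (sem c1 s)
  | St a e => esize a + esize e + 3
  | If e c => esize e + 2 + (if 0 < eval s.1 e then time c s else 0)
  | For x a d n c =>
    esize a + esize d + esize n + 4 +
    (foldl (fun st i =>
       let s' := (upd st.1.1 x (eval s.1 a + i * eval s.1 d), st.1.2) in
       (sem c s', st.2 + (time c s' + 4))) (s, 0) (iota 0 (eval s.1 n))).2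
  end.

Lemma size_ce off t e : size (ce off t e) = esize e.
Proof.
by elim: e t => [n|x|a IHa b IHb|a IHa b IHb|a IHa] t //=; rewrite !size_cat ?IHa ?IHb /=; lia.
Qed.

Definition code_at (P : program) (l : nat) (k : seq instr) :=
  forall i, i < size k -> onth P (l + i) = onth k i.

Lemma code_at_cat P l k1 k2 :
  code_at P l (k1 ++ k2) <-> code_at P l k1 /\ code_at P (l + size k1) k2.
Proof.
split=> [H|[H1 H2] i].
  split=> i Hi.
    rewrite H ?size_cat; last lia.
    by rewrite onth_cat Hi.
  rewrite -addnA H ?size_cat; last lia.
  by rewrite onth_cat ltnNge leq_addr /= addKn.
rewrite size_cat => Hi; rewrite onth_cat; case: ltnP => Hi1; first exact: H1.
by rewrite -{1}(subnKC Hi1) addnA H2 // ltn_subLR.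
Qed.

Lemma code_at_cons P l i k :
  code_at P l (i :: k) <-> onth P l = Some i /\ code_at P l.+1 k.
Proof.
rewrite (code_at_cat P l [:: i] k) addn1; split=> -[H1 H2]; split=> //.
  by have := H1 0 isT; rewrite addn0.
by case=> //= _; rewrite addn0.
Qed.

Definition represents (off : nat) (m um : nat -> nat) :=
  [/\ m 0 = 0, m 1 = 1 & forall a, m (off + a) = um a].

Lemma stepE P l m u o ins :
  onth P l = Some ins -> step P (Config l m u o) = exec ins (Config l m u o).
Proof. by rewrite /step /= => ->. Qed.

Lemma updE (T : Type) (m : nat -> T) x a y : upd m x a y = if y == x then a else m y.
Proof. by []. Qed.

(** The induction needs that registers below [t] survive: the left operand waits in [t] while the
    right one is evaluated from [t.+1] on. The bound [t + esize e < off] keeps temporaries out of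
    the simulated memory. *)
Lemma ce_correct P off e t l m u o um :
  code_at P l (ce off t e) -> 1 < t -> t + esize e < off -> represents off m um ->
  exists m', [/\ iter (esize e) (step P) (Config l m u o) = Config (l + esize e) m' u o,
    represents off m' um, m' t = eval um e & forall r, r < t -> m' r = m r].
Proof.
elim: e t l m => [n|x|a IHa b IHb|a IHa b IHb|a IHa] t l m /=.
- move=> /code_at_cons[H _] Ht Hoff [m0 m1 mu].
  exists (upd m t n); split; first by rewrite /step /= H /= addn1.
  + by split=> [||a]; rewrite updE; case: eqP => //; lia.
  + by rewrite updE eqxx.
  + by move=> r Hr; rewrite updE; case: eqP => //; lia.
- move=> /code_at_cons[H _] Ht Hoff [m0 m1 mu].
  exists (upd m t (um x)); split; first by rewrite /step /= H /= addn1 m0 mu addn0.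
  + by split=> [||a]; rewrite updE; case: eqP => //; lia.
  + by rewrite updE eqxx.
  + by move=> r Hr; rewrite updE; case: eqP => //; lia.
- move=> /code_at_cat[Ha] /code_at_cat[Hb] /code_at_cons[H _] Ht Hoff Hr.
  move: Hb H; rewrite !size_ce => Hb H.
  have [||m1 [E1 R1 V1 F1]] := IHa _ _ _ Ha _ _ Hr; try lia.
  have [||m2 [E2 R2 V2 F2]] := IHb _ _ _ Hb _ _ R1; try lia.
  exists (upd m2 t (eval um a + eval um b)); split.
  + have -> : esize a + esize b + 1 = 1 + (esize b + esize a) by lia.
    rewrite !iterD E1 E2 /= (stepE _ _ _ H) /= V2 F2 // V1.
    by congr Config; lia.
  + by case: R2 => ? ? ?; split=> [||c]; rewrite updE; case: eqP => //; lia.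
  + by rewrite updE eqxx.
  + by move=> r Hr'; rewrite updE; case: eqP => [|_]; rewrite ?F2 ?F1 //; lia.
- move=> /code_at_cat[Ha] /code_at_cat[Hb] /code_at_cons[H _] Ht Hoff Hr.
  move: Hb H; rewrite !size_ce => Hb H.
  have [||m1 [E1 R1 V1 F1]] := IHa _ _ _ Ha _ _ Hr; try lia.
  have [||m2 [E2 R2 V2 F2]] := IHb _ _ _ Hb _ _ R1; try lia.
  exists (upd m2 t (eval um a - eval um b)); split.
  + have -> : esize a + esize b + 1 = 1 + (esize b + esize a) by lia.
    rewrite !iterD E1 E2 /= (stepE _ _ _ H) /= V2 F2 // V1.
    by congr Config; lia.
  + by case: R2 => ? ? ?; split=> [||c]; rewrite updE; case: eqP => //; lia.
  + by rewrite updE eqxx.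
  + by move=> r Hr'; rewrite updE; case: eqP => [|_]; rewrite ?F2 ?F1 //; lia.
- move=> /code_at_cat[Ha] /code_at_cons[H1] /code_at_cons[H2] /code_at_cons[H3 _] Ht Hoff Hr.
  move: H1 H2 H3; rewrite !size_ce => H1 H2 H3.
  have [||m1 [E1 R1 V1 F1]] := IHa _ _ _ Ha _ _ Hr; try lia.
  eexists; split.
  + rewrite addnC iterD E1 /= (stepE _ _ _ H1) /= (stepE _ _ _ H2) /= (stepE _ _ _ H3) /=.
    have -> : (l + esize a).+3 = l + (3 + esize a) by lia.
    reflexivity.
  + case: R1 => ? ? ?; split=> [||c];
      by do 3 (rewrite updE; case: eqP => [|_]; first lia).
  + have tn : (t == t.+1) = false by apply/eqP; lia.
    have H4 : upd m1 t.+1 off t + upd m1 t.+1 off t.+1 = off + eval um a.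
      by rewrite !updE eqxx tn V1 addnC.
    rewrite H4 /upd !eqxx.
    case: eqP => [|_]; first lia; case: eqP => [|_]; first lia.
    by case: R1.
  + by move=> r Hr'; do 3 (rewrite updE; case: eqP => [|_]; first lia); rewrite F1.
Qed.

Lemma size_cc off l t c : size (cc off l t c) = csize c.
Proof.
elim: c l t => [e|c1 IH1 c2 IH2|x a d n c IH|a e|e c IH] l t /=;
  by rewrite ?size_cat /= ?size_cat /= ?size_ce ?IH1 ?IH2 ?IH /= ?size_cat /= ?size_ce ?IH; lia.
Qed.

Lemma cc_correct P off c t l m u o um :
  code_at P l (cc off l t c) -> 1 < t -> t + csize c < off -> represents off m um ->
  exists m', [/\ iter (time c (um, o)) (step P) (Config l m u o) =
      Config (l + csize c) m' u (sem c (um, o)).2,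
    represents off m' (sem c (um, o)).1 & forall r, r < t -> m' r = m r].
Proof.
elim: c t l m o um => [e|c1 IH1 c2 IH2|x a d n c IH|a e|e c IH] t l m o um /=.
- move=> /code_at_cat[He] /code_at_cons[H _] Ht Hoff Hr.
  rewrite size_ce in H.
  have [||m1 [E1 R1 V1 F1]] := ce_correct u o He _ _ Hr; try lia.
  exists m1; split=> //.
  by rewrite addnC iterD E1 /= (stepE _ _ _ H) /= V1 addnCA addnA.
- move=> /code_at_cat[H1 H2] Ht Hoff Hr; rewrite size_cc in H2.
  have [||m1 [E1 R1 F1]] := IH1 _ _ _ o _ H1 _ _ Hr; try lia.
  case: (sem c1 (um, o)) E1 R1 H2 => um1 o1 /= E1 R1 H2.
  have [||m2 [E2 R2 F2]] := IH2 _ _ _ o1 _ H2 _ _ R1; try lia.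
  exists m2; split=> //; last by move=> r Hr2; rewrite F2 ?F1.
  by rewrite addnC iterD E1 E2 addnA.
- set k := cc _ _ _ c; set pre := ce off t n ++ _.
  have sk : size k = csize c by rewrite size_cc.
  have sp : size pre = esize n + esize a + esize d + 1.
    by rewrite !size_cat !size_ce /=; lia.
  move=> /code_at_cat[Hpre] /code_at_cons[HJ] /code_at_cons[HX] /code_at_cat[Hk].
  move=> /code_at_cons[HA] /code_at_cons[HS] /code_at_cons[HT] /code_at_cons[HR _] Ht Hoff Hr.
  move: Hpre => /code_at_cat[Hn] /code_at_cat[Ha] /code_at_cat[Hd] /code_at_cons[Hsv _].
  rewrite !size_ce in Ha Hd Hsv.
  have [||m1 [E1 R1 V1 F1]] := ce_correct u o Hn _ _ Hr; try lia.
  have [||m2 [E2 R2 V2 F2]] := ce_correct u o Ha _ _ R1; try lia.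
  have [||m3 [E3 R3 V3 F3]] := ce_correct u o Hd _ _ R2; try lia.
  rewrite sp in HJ HX Hk HA HS HT HR.
  rewrite sk in HJ HA HS HT HR.
  set b := l + (esize n + esize a + esize d + 1) in HJ HX Hk HA HS HT HR.
  have {}HJ : onth P b = Some (Jump 1 (b + csize c + 4)) by rewrite HJ; congr (Some (Jump _ _)); lia.
  have {}Hk : code_at P b.+2 (cc off b.+2 t.+4 c) by move: Hk; rewrite /k -/pre sp addn1.
  have eb : (b.+2 + csize c).+2 = b + csize c + 4 by lia.
  have {}HT : onth P (b + csize c + 4) = Some (Jump t b.+1) by rewrite -eb HT addn1.
  have {}HR : onth P (b + csize c + 5) = Some (Defs.Add (off + x) t.+3 0).
    by rewrite -HR; congr onth; lia.
  (* The invariant is stated at the address of the loop test, for any list of remaining rounds and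
     any accumulated time [tt], because [time] folds with an accumulator. The [1] in [T + 1] is the
     last test, which fails. *)
  have loop : forall (ii : seq nat) (mm : nat -> nat) (i0 : nat) (s : state) (tt : nat),
      ii = iota i0 (size ii) ->
      represents off mm s.1 -> mm t = size ii -> mm t.+1 = eval um a + i0 * eval um d ->
      mm t.+2 = eval um d ->
      let f := fun st i => let s' := (upd st.1.1 x (eval um a + i * eval um d), st.1.2) in
       (sem c s', st.2 + (time c s' + 4)) in
      let fs := fun s' i => sem c (upd s'.1 x (eval um a + i * eval um d), s'.2) in
      exists m' T, [/\ (foldl f (s, tt) ii).2 = tt + T,
        iter (T + 1) (step P) (Config (b + csize c + 4) mm u s.2) =
        Config (b + csize c + 5) m' u (foldl fs s ii).2,
        represents off m' (foldl fs s ii).1, m' t.+3 = mm t.+3 &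
        forall r, r < t -> m' r = mm r].
    elim=> [|i ii IHl] mm i0 s tt Hi Hmm Ht0 Ht1 Ht2 f fs.
      exists mm, 0; split=> //=; first by rewrite addn0.
      rewrite (@stepE P _ _ _ _ (Jump t b.+1)) /=; last exact: HT.
      by rewrite Ht0 /=; congr Config; lia.
    have [ei {}Hi] : i = i0 /\ ii = iota i0.+1 (size ii) by case: Hi.
    subst i.
    have [m0 m1' Hmu] := Hmm.
    pose ma := upd mm (off + x) (eval um a + i0 * eval um d).
    pose s' := (upd s.1 x (eval um a + i0 * eval um d), s.2) : state.
    have Rma : represents off ma s'.1.
      split=> [||y]; rewrite /ma updE; try (case: eqP; first lia); try by rewrite ?m0 ?m1'.
      by rewrite eqn_add2l Hmu.
    have [||mb [Eb Rb Fb]] := IH t.+4 b.+2 ma s.2 s'.1 Hk _ _ Rma; try lia.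
    pose md := upd (upd mb t.+1 (eval um a + i0.+1 * eval um d)) t (size ii).
    have Rmd : represents off md (sem c s').1.
      case: Rb => b0 b1 Hb; split=> [||y]; rewrite /md !updE;
      try (case: eqP => [|_]; first lia); try (case: eqP => [|_]; first lia); done.
    have [|||m' [T [ET E' R' F3' F']]] := IHl md i0.+1 (sem c s') (tt + (time c s' + 4)) Hi Rmd;
      try by rewrite /md /= !updE ?eqxx //.
    + by rewrite /md !updE eqxx; case: eqP => //; lia.
    + rewrite /md !updE; case: eqP => [|_]; first lia; case: eqP => [|_]; first lia.
      rewrite Fb; last lia.
      by rewrite /ma updE; case: eqP => [|_] //; lia.
    exists m', (T + (time c s' + 4)); split=> //=.
    + by rewrite ET; lia.
    + have -> : T + (time c s' + 4) + 1 = (T + 1) + (2 + (time c s' + (1 + 1))) by lia.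
      rewrite iterD iterD iterD iterD /= (@stepE P _ _ _ _ (Jump t b.+1)) /= ?Ht0 /=; last exact: HT.
      rewrite (stepE _ _ _ HX) /= Ht1 m0 addn0 -/ma Eb.
      rewrite (@stepE P _ _ _ _ (Add t.+1 t.+1 t.+2)) /=; last exact: HA.
      rewrite (@stepE P _ _ _ _ (Defs.Sub t t 1)) /=; last exact: HS.
      have -> : upd (upd mb t.+1 (mb t.+1 + mb t.+2)) t
          (upd mb t.+1 (mb t.+1 + mb t.+2) t - upd mb t.+1 (mb t.+1 + mb t.+2) 1) = md.
        have -> : mb t.+1 + mb t.+2 = eval um a + i0.+1 * eval um d.
          rewrite !Fb; try lia.
          by rewrite /ma !updE; do 2 (case: eqP => [|_]; first lia); rewrite Ht1 Ht2; lia.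
        rewrite /md; congr upd; rewrite !updE; do 2 (case: eqP => [|_]; first lia).
        case: Rb => _ -> _; rewrite Fb; last lia.
        by rewrite /ma updE; case: eqP => [|_]; first lia; rewrite Ht0 /=; lia.
      by rewrite eb -E' addn1 iterSr.
    + rewrite F3' /md !updE; do 2 (case: eqP => [|_]; first lia).
      rewrite Fb; last lia.
      by rewrite /ma updE; case: eqP => [|_] //; lia.
    + move=> r Hr'; rewrite F' // /md !updE; do 2 (case: eqP => [|_]; first lia).
      rewrite Fb; last lia.
      by rewrite /ma updE; case: eqP => [|_] //; lia.
  pose m4 := upd m3 t.+3 (um x).
  have R4 : represents off m4 um.
    case: R3 => b0 b1 Hb; split=> [||y]; rewrite /m4 updE;
      by case: eqP => [|_] //; lia.
  have [||||m' [T [ET E' R' F3' F']]] :=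
    loop (iota 0 (eval um n)) m4 0 (um, o) 0 _ R4; rewrite ?size_iota //.
  + by rewrite /m4 updE; case: eqP => [|_]; [lia|]; rewrite F3 ?F2.
  + by rewrite /m4 updE; case: eqP => [|_]; [lia|]; rewrite F3 ?V2 ?addn0.
  + by rewrite /m4 updE; case: eqP => [|_]; [lia|]; rewrite V3.
  rewrite /= in ET; rewrite ET.
  move: E' R' => /=; set fin := foldl _ _ _ => E' R'.
  exists (upd m' (off + x) (um x)); split.
  + have -> : esize a + esize d + esize n + 4 + (0 + T) =
      1 + ((T + 1) + (1 + (1 + (esize d + (esize a + esize n))))) by lia.
    rewrite !iterD E1 E2 E3 /= (stepE _ _ _ Hsv) /=.
    case: R3 => b0 b1 Hb; rewrite b0 addn0 Hb -/m4.
    have -> : (l + esize n + esize a + esize d).+1 = b by lia.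
    rewrite (stepE _ _ _ HJ) /=.
    have -> : m4 1 = 1 by case: R4.
    rewrite -iterSr -addn1 E' /= (stepE _ _ _ HR) /= F3' /m4 /upd eqxx.
    case: R' => [r0 _ _]; rewrite r0 addn0; congr Config; lia.
  + case: R' => r0 r1 Hr'; split=> [||y]; rewrite updE; try (case: eqP => [|_] //; lia).
    by rewrite eqn_add2l updE Hr'.
  + move=> r Hr'; rewrite updE; case: eqP => [|_]; first lia.
    rewrite F' // /m4 updE; case: eqP => [|_]; first lia.
    by rewrite F3 ?F2 ?F1 //; lia.
- move=> /code_at_cat[Ha] /code_at_cat[He] /code_at_cons[H1] /code_at_cons[H2] /code_at_cons[H3 _].
  rewrite !size_ce in He H1 H2 H3 => Ht Hoff Hr.
  have [||m1 [E1 R1 V1 F1]] := ce_correct u o Ha _ _ Hr; try lia.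
  have [||m2 [E2 R2 V2 F2]] := ce_correct u o He _ _ R1; try lia.
  exists (upd (upd (upd m2 t.+2 off) t (eval um a + off)) (off + eval um a) (eval um e)).
  split.
  + have -> : esize a + esize e + 3 = 3 + (esize e + esize a) by lia.
    rewrite !iterD E1 E2 /= (stepE _ _ _ H1) /= (stepE _ _ _ H2) /= (stepE _ _ _ H3) /=.
    have -> : upd m2 t.+2 off t + upd m2 t.+2 off t.+2 = eval um a + off.
      by rewrite /upd eqxx; case: eqP => [|_]; [lia|]; rewrite F2 ?V1.
    congr Config; first lia.
    rewrite [X in upd _ X]updE eqxx addnC; congr upd.
    by do 2 (rewrite updE; case: eqP => [|_]; first lia).
  + case: R2 => r0 r1 Hr2; split=> [||y].
    * by do 3 (rewrite updE; case: eqP => [|_]; first lia).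
    * by do 3 (rewrite updE; case: eqP => [|_]; first lia).
    * rewrite updE eqn_add2l [RHS]updE; case: eqP => // _.
      by do 2 (rewrite updE; case: eqP => [|_]; first lia).
  + move=> r Hr2; do 3 (rewrite updE; case: eqP => [|_]; first lia).
    by rewrite F2 ?F1 //; lia.
- move=> /code_at_cat[He] /code_at_cons[H1] /code_at_cons[H2] Hc Ht Hoff Hr.
  rewrite size_cc !size_ce in H1 H2 Hc.
  have [||m1 [E1 R1 V1 F1]] := ce_correct u o He _ _ Hr; try lia.
  have [r0 r1 Hr1] := R1.
  have E : iter 2 (step P) (Config (l + esize e) m1 u o) =
     Config (if 0 < eval um e then (l + esize e).+2 else l + (esize e + csize c + 2))
       (upd m1 t (1 - eval um e)) u o.
    rewrite /= (stepE _ _ _ H1) /= (stepE _ _ _ H2) /= r1 V1.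
    congr Config; rewrite updE eqxx; case: (posnP (eval um e)) => [->|H] /=; first lia.
    by have -> : 1 - eval um e = 0 by lia.
  have R2 : represents off (upd m1 t (1 - eval um e)) um.
    by split=> [||y]; rewrite updE; case: eqP => [|_] //; lia.
  case: ifP => Hev; rewrite Hev in E.
    rewrite addn2 in Hc.
    have [||m2 [E2 R3 F2]] := IH _ _ _ o _ Hc _ _ R2; try lia.
    exists m2; split=> //.
    * have -> : esize e + 2 + time c (um, o) = time c (um, o) + (2 + esize e) by lia.
      rewrite !iterD E1 E E2; congr Config; lia.
    * by move=> r Hr'; rewrite F2 // updE; case: eqP => [|_]; [lia|]; rewrite F1.
  exists (upd m1 t (1 - eval um e)); split=> //.
  * by rewrite addn0 addnC iterD E1 E.
  * by move=> r Hr'; rewrite updE; case: eqP => [|_]; [lia|]; rewrite F1.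
Qed.

(** * Commands without stores, and a bound on the running time *)

Fixpoint pure (c : cmd) : bool :=
  match c with
  | Pr _ => true
  | Sq c1 c2 => pure c1 && pure c2
  | For _ _ _ _ c => pure c
  | St _ _ => false
  | If _ c => pure c
  end.

Fixpoint pr (c : cmd) (m : nat -> nat) : seq nat :=
  match c with
  | Pr e => [:: eval m e]
  | Sq c1 c2 => pr c1 m ++ pr c2 m
  | For x a d n c =>
      flatten [seq pr c (upd m x (eval m a + i * eval m d)) | i <- iota 0 (eval m n)]
  | St _ _ => [::]
  | If e c => if 0 < eval m e then pr c m else [::]
  end.

Lemma upd_upd (T : Type) (m : nat -> T) x a b : upd (upd m x a) x b = upd m x b.
Proof. by apply: functional_extensionality => y; rewrite !updE; case: eqP. Qed.

Lemma upd_id (T : Type) (m : nat -> T) x : upd m x (m x) = m.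
Proof. by apply: functional_extensionality => y; rewrite !updE; case: eqP => // ->. Qed.

(** Only loops touch the memory here. During a loop it differs from [m] at most in the loop
    variable, which the next round overwrites and the end of the loop restores. *)
Lemma sem_pure c m o : pure c -> sem c (m, o) = (m, o ++ pr c m).
Proof.
elim: c m o => [e|c1 IH1 c2 IH2|x a d n c IH|a e|e c IH] m o //=.
- by rewrite cats1.
- by case/andP=> p1 p2; rewrite IH1 // IH2 // catA.
- move=> pc; set js := iota _ _; set F := (fun s' i => sem c _).
  have H : forall m1 o1, (forall b, upd m1 x b = upd m x b) ->
      upd (foldl F (m1, o1) js).1 x (m x) = m /\
      (foldl F (m1, o1) js).2 = o1 ++ flatten [seq pr c (upd m x (eval m a + i * eval m d)) | i <- js].
    elim: js => [|i js' IHi] m1 o1 Hm /=; first by rewrite Hm upd_id cats0.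
    rewrite {2 4}/F /= Hm IH // catA; apply: IHi => b; exact: upd_upd.
  by have [-> ->] := H m o (fun=> erefl).
- by case: ifP => _ pc; rewrite ?IH ?cats0.
Qed.

Fixpoint small (X : nat) (c : cmd) (s : state) : Prop :=
  match c with
  | Pr _ | St _ _ => True
  | Sq c1 c2 => small X c1 s /\ small X c2 (sem c1 s)
  | If e c => 0 < eval s.1 e -> small X c s
  | For x a d n c =>
      eval s.1 n <= X /\
      forall i, i < eval s.1 n ->
        let s' := foldl (fun s' i => sem c (upd s'.1 x (eval s.1 a + i * eval s.1 d), s'.2))
                    s (iota 0 i) in
        small X c (upd s'.1 x (eval s.1 a + i * eval s.1 d), s'.2)
  end.

Fixpoint psmall (X : nat) (c : cmd) (m : nat -> nat) : Prop :=
  match c with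
  | Pr _ | St _ _ => True
  | Sq c1 c2 => psmall X c1 m /\ psmall X c2 m
  | If e c => 0 < eval m e -> psmall X c m
  | For x a d n c =>
      eval m n <= X /\
      forall i, i < eval m n -> psmall X c (upd m x (eval m a + i * eval m d))
  end.

Lemma small_pure X c m o : pure c -> psmall X c m -> small X c (m, o).
Proof.
elim: c m o => [e|c1 IH1 c2 IH2|x a d n c IH|a e|e c IH] m o //=.
- by case/andP=> p1 p2 [s1 s2]; rewrite sem_pure //; split; auto.
- move=> pc [sn si]; split=> // i Hi.
  set js := iota 0 i; set F := (fun s' i => sem c _).
  have H : forall m1 o1, (forall b, upd m1 x b = upd m x b) ->
      (forall b, upd (foldl F (m1, o1) js).1 x b = upd m x b).
    elim: js => [|j js' IHi] m1 o1 Hm b //=.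
    by rewrite {2}/F /= sem_pure // Hm; apply: IHi => b'; exact: upd_upd.
  by rewrite H //; apply: IH => //; apply: si.
- by move=> pc H Hp; apply: IH => //; apply: H.
Qed.

Lemma leq_add_mul a b : 1 < a -> 1 < b -> a + b <= a * b.
Proof. by case: a b => [|[|a]] [|[|b]] // _ _; nia. Qed.

Lemma ltn_expnl10 X n : (9 * n).+1 <= (X + 10) ^ n.
Proof.
elim: n => // n IH; rewrite expnS; apply: leq_trans (leq_mul (leqnn _) IH).
set k := (9 * n).+1; have : 0 < k by []; rewrite mulnDl; nia.
Qed.

Lemma csize_gt0 c : 0 < csize c.
Proof. by elim: c => *; rewrite /=; lia. Qed.

(** Each syntactic unit contributes a factor [X + 10]: a loop multiplies the time by at most [X],
    and the [10] pays for constant overheads. The exponent depends on the program alone. *)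
Lemma time_small X c s : small X c s -> time c s <= (X + 10) ^ csize c.
Proof.
elim: c s => [e|c1 IH1 c2 IH2|x a d n c IH|a e|e c IH] s /=.
- by move=> _; have := ltn_expnl10 X (esize e + 1); lia.
- move=> [/IH1 H1 /IH2 H2]; rewrite expnD.
  apply: leq_trans (leq_add H1 H2) (leq_add_mul _ _).
    by rewrite -(prednK (csize_gt0 c1)) (leq_trans _ (ltn_expnl10 _ _)).
  by rewrite -(prednK (csize_gt0 c2)) (leq_trans _ (ltn_expnl10 _ _)).
- move=> [sn si].
  set fs := (fun (s' : state) (i : nat) => sem c _) in si.
  set f := (fun st i => _).
  have H k : k <= eval s.1 n ->
      (foldl f (s, 0) (iota 0 k)).1 = foldl fs s (iota 0 k) /\
      (foldl f (s, 0) (iota 0 k)).2 <= k * ((X + 10) ^ csize c + 4).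
    elim: k => [|k IHk] // Hk; have [] := IHk (ltnW Hk).
    rewrite -(addn1 k) iotaD !foldl_cat /= add0n; case: (foldl f _ _) => s1 t1 /= -> Ht.
    split=> //; rewrite mulnDl mul1n; apply: leq_add => //.
    by rewrite leq_add2r; apply: IH; exact: si.
  have [_ {}H] := H _ (leqnn _).
  apply: leq_trans (leq_add (leqnn _) (leq_trans H (leq_mul sn (leqnn _)))) _.
  rewrite (_ : esize a + esize d + esize n + csize c + 7 = csize c + 1 + (esize a + esize d + esize n + 6)); last lia.
  rewrite 2!expnD expn1; have := ltn_expnl10 X (esize a + esize d + esize n + 6).
  have : 0 < (X + 10) ^ csize c by rewrite expn_gt0; lia.
  move: (_ ^ _) ((X + 10) ^ (_ + 6)) => u v u0 Hv.
  have H1 : X * (u + 4) <= 5 * (X * u) by nia.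
  have H2 : u * (X + 10) * (9 * (esize a + esize d + esize n + 6)).+1
     <= u * (X + 10) * v by apply: leq_mul => //; lia.
  by apply: leq_trans H2; nia.
- by move=> _; have := ltn_expnl10 X (esize a + esize e + 3); lia.
- move=> H; have Hs : time c s * (0 < eval s.1 e) <= (X + 10) ^ csize c.
    by case: ltnP H => [_ /(_ isT) /IH|]; rewrite ?muln1 ?muln0.
  have -> : (if 0 < eval s.1 e then time c s else 0) = time c s * (0 < eval s.1 e).
    by case: ltnP; rewrite ?muln1 ?muln0.
  have Hv := ltn_expnl10 X (esize e + 2).
  have u0 : 0 < (X + 10) ^ csize c by rewrite expn_gt0; lia.
  rewrite -[_ + csize c + 2]addnAC expnD; move: (time c s * _) Hs Hv u0 => w.
  move: ((X + 10) ^ (esize e + 2)) ((X + 10) ^ csize c) => v u Hs Hv u0.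
  by nia.
Qed.

(** * The normal form *)

Module Import Layout.
Section Macros.
Variable sg : signature.
Implicit Types p q : formula sg.

Definition And p q := Neg (Or (Neg p) (Neg q)).
Definition Iff p q := Or (Neg (Or p q)) (Neg (Or (Neg p) (Neg q))).
(** Falsity must mention some variable; [z] will be [vb], which is bound in the end. Nesting to the
    right gives a word made of opening pieces, falsity and then closing parentheses only, so two
    consecutive loops print it. *)
Definition bigor (z : nat) (T : Type) (l : seq T) (F : T -> formula sg) : formula sg :=
  foldr (fun i acc => Or (F i) acc) (Neg (Eq z z)) l.
Definition exs (v n : nat) p := foldr (@Ex sg) p (iota v n).
Definition RelI (R : symbol sg) (v : nat) : formula sg := Rel R [tuple of iota v (arity R)].
Definition symbols : seq (symbol sg) := enum 'I_(size (arities sg)).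

(* A cell is a list of [cellsize] variables divided into [nR.+1] levels of [nB]
   variables; level [j] is meant to enumerate the ball of radius [j] around the
   center, the first variable of the cell.  The variables from [vb] on are used
   for the universally quantified element, for bound variables, and from [yv]
   on for the [nC] cells that are quantified existentially. *)
Variables (vb np nB nR nT nC : nat).
Definition cellsize := (nR + 1) * nB.
Definition uv := vb + 1.
(** [pv] starts a tuple witnessing adjacency, [lv] and [rv] two tuples to be compared, [ev] the
    covering elements, [wv] a listing of the ball of [vb]. The blocks are disjoint, so nested
    formulas do not capture their arguments. *)
Definition pv := vb + 2.
Definition lv := pv + np.
Definition rv := lv + np.
Definition ev := rv + np.
Definition wv := ev + nT.
Definition yv := wv + cellsize.
Definition center k := yv + k * cellsize.

Definition among (u st n : nat) := bigor vb (iota 0 n) (fun i => Eq u (st + i)).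

Definition adjF (u v : nat) :=
  Or (Eq u v) (bigor vb symbols (fun R => exs pv (arity R)
    (And (RelI R pv) (And (among u pv (arity R)) (among v pv (arity R)))))).

Definition stepF (u st : nat) :=
  Iff (among u (st + nB) nB) (bigor vb (iota 0 nB) (fun b => adjF u (st + b))).

Definition badcell (u st : nat) :=
  bigor vb (iota 0 nR) (fun j => Neg (stepF u (st + j * nB))).

Definition matchF (u v w y : nat) :=
  bigor vb (iota 0 cellsize) (fun a => And (Eq u (w + a)) (Eq v (y + a))).

(** Positions in a cell cannot be quantified. Two tuples of elements are quantified instead, and
    [matchF] makes corresponding entries occupy a common position of the two cells; [F] then has to
    tell the tuples apart. *)
Definition diffF (w y n : nat) (F : nat -> formula sg) :=
  exs lv n (exs rv n (Neg (Or
    (bigor vb (iota 0 n) (fun i => Neg (matchF (lv + i) (rv + i) w y)))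
    (Iff (F lv) (F rv))))).

Definition difftype (w y : nat) :=
  Or (diffF w y 2 (fun v => Eq v (v + 1)))
     (bigor vb symbols (fun R => diffF w y (arity R) (RelI R))).

(** The element at [vb] need not be a center, so a listing of its ball is quantified here. Unlike in
    the guessed cells, all of level 0 is required to equal [vb]. *)
Definition simF (y : nat) :=
  exs wv cellsize (Neg (Or (bigor vb (iota 0 nB) (fun b => Neg (Eq vb (wv + b))))
    (Or (Ex uv (badcell uv wv)) (difftype wv y)))).

Definition isC (x : nat) := bigor vb (iota 0 nC) (fun k => Eq x (center k)).

Definition V1 (xs : seq nat) := bigor vb xs (fun x => Neg (isC x)).

Definition V2 := bigor vb (iota 0 nC) (fun k => badcell vb (center k)).

Definition V3 := exs ev nT (Neg (bigor vb (iota 0 nC) (fun k =>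
  Or (Eq vb (center k)) (And (simF (center k)) (Neg (among (center k) ev nT)))))).

Definition guard (x l : nat) :=
  bigor vb (iota 0 nC) (fun k => among x (center k) ((l + 1) * nB)).

Fixpoint rel_ (lev : nat -> nat) (D : nat) p : formula sg :=
  match p with
  | Eq x y => Eq x y
  | Rel R v => Rel R v
  | Neg p1 => Neg (rel_ lev D p1)
  | Or p1 p2 => Or (rel_ lev D p1) (rel_ lev D p2)
  | Ex x p1 => Ex x (Neg (Or (Neg (guard x (lev D))) (Neg (rel_ lev D.+1 p1))))
  end.

Definition matrix lev p := Neg (Or (V1 (fv p)) (Or V2 (Or V3 (Neg (rel_ lev 0 p))))).

Definition normal_form lev p := exs yv (nC * cellsize) (All vb (matrix lev p)).
End Macros.
End Layout.

(** * Meaning of the formulas in a structure *)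

Section Semantics.
Variables (sg : signature) (A : structure sg).
Implicit Types (s : nat -> A) (p q : formula sg).

Definition updr (T : Type) (s : nat -> T) (v n : nat) (W : nat -> T) : nat -> T :=
  fun x => if v <= x < v + n then W (x - v) else s x.

Lemma sat_Neg s p : sat s (Neg p) = ~~ sat s p. Proof. by []. Qed.

Lemma sat_Or s p q : sat s (Or p q) = sat s p || sat s q. Proof. by []. Qed.

Lemma sat_Ex s x p : sat s (Ex x p) <-> exists a, sat (upd s x a) p.
Proof. by split=> [/existsP|H] //; apply/existsP. Qed.

Lemma sat_And s p q : sat s (And p q) = sat s p && sat s q.
Proof. by rewrite /= negb_or !negbK. Qed.

Lemma sat_Iff s p q : sat s (Iff p q) = (sat s p == sat s q).
Proof. by rewrite /=; case: (sat s p); case: (sat s q). Qed.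

Lemma sat_bigor s z (T : Type) (l : seq T) F :
  sat s (bigor z l F) = has (fun i => sat s (F i)) l.
Proof. by elim: l => /= [|i l ->] //; rewrite eqxx. Qed.

Lemma sat_bigor_iota s z n (F : nat -> formula sg) :
  sat s (bigor z (iota 0 n) F) <-> exists2 i, i < n & sat s (F i).
Proof.
rewrite sat_bigor; split=> [/hasP[i]|[i Hi Hs]]; first by rewrite mem_iota => Hi; exists i.
by apply/hasP; exists i => //; rewrite mem_iota.
Qed.

Lemma sat_bigor_sym s z (F : symbol sg -> formula sg) :
  sat s (bigor z (symbols sg) F) <-> exists R, sat s (F R).
Proof.
rewrite sat_bigor; split=> [/hasP[R _ HR]|[R HR]]; first by exists R.
by apply/hasP; exists R => //; rewrite mem_enum.
Qed.

Lemma sat_exs s v n p :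
  sat s (exs v n p) <-> exists W : nat -> A, sat (updr s v n W) p.
Proof.
rewrite /exs; elim: n v s => [|n IH] v s /=.
  have E W : updr s v 0 W = s.
    by apply: functional_extensionality => x; rewrite /updr; case: ifP => //; lia.
  by split=> [H|[W]]; [exists s|]; rewrite E.
have E W : updr (upd s v (W 0)) v.+1 n (fun i => W i.+1) = updr s v n.+1 W.
  apply: functional_extensionality => x; rewrite /updr updE.
  case: ifP => H1; first by case: ifP => H2; [congr W|]; lia.
  by case: eqP => [->|]; case: ifP => H2; rewrite ?subnn //; lia.
split=> [/existsP[a /IH[W HW]]|[W HW]].
  exists (fun i => if i is i'.+1 then W i' else a); by rewrite -E.
by apply/existsP; exists (W 0); apply/IH; exists (fun i => W i.+1); rewrite E.
Qed.

(** Reflexive, unlike [gaifman], so that iterating it yields increasing balls and not endpoints of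
    walks of an exact length. *)
Definition adjb (a b : A) : bool :=
  (a == b) || [exists R : symbol sg, exists t in interp A R, (a \in t) && (b \in t)].

Lemma adjb_sym a b : adjb a b = adjb b a.
Proof.
rewrite /adjb eq_sym; congr orb; apply: eq_existsb => R; apply: eq_existsb => t.
by rewrite [(a \in t) && _]andbC.
Qed.

Lemma adjb_refl a : adjb a a. Proof. by rewrite /adjb eqxx. Qed.

Lemma adjbE a b : adjb a b = (a == b) || gaifman A a b.
Proof. by rewrite /adjb /gaifman; case: eqP. Qed.

Variables (vb np nB nR nT nC : nat).
Hypothesis ar_np : forall R : symbol sg, arity R <= np.
Hypothesis np2 : 2 <= np.
Local Notation pv := (pv vb).
Local Notation lv := (lv vb np).
Local Notation rv := (rv vb np).
Local Notation ev := (ev vb np).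
Local Notation wv := (wv vb np nT).
Local Notation yv := (yv vb np nB nR nT).
Local Notation S := (cellsize nB nR).
Local Notation center := (center vb np nB nR nT).

Lemma sat_among s u st n :
  sat s (among sg vb u st n) <-> exists2 i, i < n & s u = s (st + i).
Proof.
split=> [/sat_bigor_iota[i Hi /eqP E]|[i Hi E]]; first by exists i.
by apply/sat_bigor_iota; exists i => //=; rewrite E.
Qed.

Lemma sat_RelI s R v : sat s (RelI R v) = ([tuple s (v + i) | i < arity R] \in interp A R).
Proof.
rewrite /= (_ : map_tuple s _ = [tuple s (v + i) | i < arity R]) //.
by apply: eq_from_tnth => i; rewrite tnth_map tnth_mktuple (tnth_nth 0) /= nth_iota.
Qed.

Lemma sat_adjF s u v :
  ~~ (pv <= u < pv + np) -> ~~ (pv <= v < pv + np) ->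
  sat s (adjF sg vb u v) = adjb (s u) (s v).
Proof.
move=> Hu Hv; rewrite /adjF /adjb [LHS]/=; congr orb.
have fresh (R : symbol sg) W x : ~~ (pv <= x < pv + np) -> updr s pv (arity R) W x = s x.
  by move=> Hx; rewrite /updr; case: ifP => // H; have := ar_np R; lia.
have inR (R : symbol sg) (W : nat -> A) i : i < arity R -> updr s pv (arity R) W (pv + i) = W i.
  by move=> Hi; rewrite /updr; case: ifP => [_|]; [congr W|]; lia.
have inT (R : symbol sg) (W : nat -> A) a x : ~~ (pv <= x < pv + np) -> s x = a ->
    sat (updr s pv (arity R) W) (among sg vb x pv (arity R)) <->
    a \in [tuple updr s pv (arity R) W (pv + i) | i < arity R].
  move=> Hx <-; rewrite sat_among; split=> [[i Hi]|/mapP[i _]].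
    rewrite fresh // => ->; apply/mapP; exists (Ordinal Hi) => //; by rewrite mem_enum.
  by move=> E; exists i => //; rewrite fresh.
apply/idP/idP => [/sat_bigor_sym[R /sat_exs[W]]|/existsP[R /exists_inP[t Ht /andP[ut vt]]]].
  rewrite !sat_And sat_RelI => /and3P[H1 /inT H2 /inT H3].
  apply/existsP; exists R; apply/exists_inP; exists [tuple updr s pv (arity R) W (pv + i) | i < arity R] => //.
  by rewrite H2 ?H3.
apply/sat_bigor_sym; exists R; apply/sat_exs; exists (nth (s 0) t).
have E : [tuple updr s pv (arity R) (nth (s 0) t) (pv + i) | i < arity R] = t.
  by apply: eq_from_tnth => i; rewrite tnth_mktuple inR // (tnth_nth (s 0)).
rewrite !sat_And sat_RelI E Ht /=; apply/andP; split.
  by apply/(inT _ _ (s u)) => //; rewrite E.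
by apply/(inT _ _ (s v)) => //; rewrite E.
Qed.

Definition stepok (W : nat -> A) (j : nat) (u : A) : Prop :=
  (exists2 b, b < nB & u = W (j.+1 * nB + b)) <-> (exists2 b, b < nB & adjb u (W (j * nB + b))).

Lemma sat_badcell s u st :
  u < pv -> pv + np <= st ->
  ~~ sat s (badcell sg vb nB nR u st) <->
  (forall j, j < nR -> stepok (fun i => s (st + i)) j (s u)).
Proof.
move=> Hu Hst.
have H j : sat s (stepF sg vb nB u (st + j * nB)) <-> stepok (fun i => s (st + i)) j (s u).
  rewrite sat_Iff /stepok.
  have Ha : (exists2 b, b < nB & s u = s (st + (j.+1 * nB + b))) <->
     sat s (among sg vb u (st + j * nB + nB) nB).
    by split=> [[b Hb Hs]|/sat_among[b Hb Hs]]; [apply/sat_among|]; exists b => //; rewrite Hs; congr s; nia.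
  have Hb : (exists2 b, b < nB & adjb (s u) (s (st + (j * nB + b)))) <->
     sat s (bigor vb (iota 0 nB) (fun b => adjF sg vb u (st + j * nB + b))).
    by split=> [[b Hb Hs]|/sat_bigor_iota[b Hb Hs]]; [apply/sat_bigor_iota|];
      exists b => //; move: Hs; rewrite sat_adjF ?addnA //; lia.
  by rewrite -(rwP eqP) Ha Hb; case: (sat _ _); case: (sat _ _); split=> //; tauto || (case=> H1 H2; by [have := H1 isT|have := H2 isT]).
split=> [/negP Hn j Hj|Hall].
  apply/H; apply/negPn/negP => Hs; apply: Hn; apply/sat_bigor_iota; by exists j.
by apply/negP => /sat_bigor_iota[j Hj] /negP; apply; apply/H; exact: Hall.
Qed.

Definition sametype (W Y : nat -> A) : Prop :=
  (forall a b, a < S -> b < S -> (W a = W b <-> Y a = Y b)) /\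
  (forall (R : symbol sg) (f : nat -> nat), (forall i, i < arity R -> f i < S) ->
    ([tuple W (f i) | i < arity R] \in interp A R) =
    ([tuple Y (f i) | i < arity R] \in interp A R)).

Definition lists (W : nat -> A) (z : A) : Prop :=
  (forall b, b < nB -> W b = z) /\ (forall j u, j < nR -> stepok W j u).

Lemma sat_matchF s u v w y :
  sat s (matchF sg vb nB nR u v w y) <->
  exists2 a, a < S & s u = s (w + a) /\ s v = s (y + a).
Proof.
split=> [/sat_bigor_iota[a Ha]|[a Ha [H1 H2]]].
  by rewrite sat_And => /andP[/eqP H1 /eqP H2]; exists a.
by apply/sat_bigor_iota; exists a; rewrite // sat_And /= H1 H2 !eqxx.
Qed.

Lemma sat_diffF s w y n F (Phi : (nat -> A) -> bool) :
  n <= np -> ev <= w -> ev <= y ->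
  (forall s' v, sat s' (F v) = Phi (fun i => s' (v + i))) ->
  (forall g h, (forall i, i < n -> g i = h i) -> Phi g = Phi h) ->
  sat s (diffF vb np nB nR w y n F) <->
  exists2 f, (forall i, i < n -> f i < S) & Phi (fun i => s (w + f i)) != Phi (fun i => s (y + f i)).
Proof.
move=> Hn Hw Hy HF Hext; rewrite /ev in Hw Hy.
have val s0 W W' : let s' := updr (updr s0 lv n W) rv n W' in
    [/\ forall i, i < n -> s' (lv + i) = W i, forall i, i < n -> s' (rv + i) = W' i &
     forall x, rv + np <= x -> s' x = s0 x].
  rewrite /updr /rv; split=> i Hi.
  - by case: ifP => H; [lia|]; case: ifP => H'; [congr W|]; lia.
  - by case: ifP => H; [congr W'|]; lia.
  - by case: ifP => H; [lia|]; case: ifP => H'; [lia|].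
split=> [/sat_exs[W /sat_exs[W']]|[f Hf HPhi]].
  have [v1 v2 v3] := val s W W'; move: v1 v2 v3; set s' := updr (updr _ _ _ _) _ _ _ => v1 v2 v3.
  move=> Hs; have {Hs} : ~~ (sat s' (bigor vb (iota 0 n)
     (fun i => Neg (matchF sg vb nB nR (lv + i) (rv + i) w y))) || sat s' (Iff (F lv) (F rv))) by [].
  rewrite negb_or => /andP[Hm]; rewrite sat_Iff !HF.
  rewrite (Hext _ W v1) (Hext _ W' v2) => HW.
  (* The first position that the i-th entries of the two tuples share. *)
  pose f i := find (fun a => (W i == s (w + a)) && (W' i == s (y + a))) (iota 0 S).
  have Hf i : i < n -> [/\ f i < S, W i = s (w + f i) & W' i = s (y + f i)].
    move=> Hi; have : has (fun a => (W i == s (w + a)) && (W' i == s (y + a))) (iota 0 S).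
      have : sat s' (matchF sg vb nB nR (lv + i) (rv + i) w y).
        rewrite -[sat _ _]negbK; apply: contra Hm => Hm; apply/sat_bigor_iota; by exists i.
      move=> /sat_matchF[a Ha]; rewrite v1 // v2 // !v3; try lia.
      move=> [H1 H2]; apply/hasP; exists a; first by rewrite mem_iota.
      by rewrite H1 H2 !eqxx.
    move=> Hh; have := nth_find 0 Hh; rewrite has_find size_iota in Hh.
    by rewrite nth_iota // -/(f i) => /andP[/eqP ? /eqP ?].
  exists f => [i /Hf[]//|].
  have <- : Phi W = Phi (fun i => s (w + f i)) by apply: Hext => i /Hf[].
  by have <- : Phi W' = Phi (fun i => s (y + f i)) by apply: Hext => i /Hf[].
apply/sat_exs; exists (fun i => s (w + f i)); apply/sat_exs; exists (fun i => s (y + f i)).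
have [v1 v2 v3] := val s (fun i => s (w + f i)) (fun i => s (y + f i)).
move: v1 v2 v3; set s' := updr (updr _ _ _ _) _ _ _ => v1 v2 v3.
change (~~ (sat s' (bigor vb (iota 0 n)
     (fun i => Neg (matchF sg vb nB nR (lv + i) (rv + i) w y))) || sat s' (Iff (F lv) (F rv)))).
rewrite negb_or sat_Iff !HF (Hext _ _ v1) (Hext _ _ v2) HPhi andbT.
apply/negP => /sat_bigor_iota[i Hi] /negP[]; apply/sat_matchF; exists (f i); first exact: Hf.
by rewrite v1 // v2 // !v3 //; lia.
Qed.

Lemma sat_difftype s w y :
  ev <= w -> ev <= y ->
  ~~ sat s (difftype sg vb np nB nR w y) <->
  sametype (fun a => s (w + a)) (fun a => s (y + a)).
Proof.
move=> Hw Hy.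
pose P2 (g : nat -> A) := g 0 == g 1.
pose PR R (g : nat -> A) := [tuple g i | i < arity R] \in interp A R.
have H2 : sat s (diffF vb np nB nR w y 2 (fun v => Eq v (v + 1))) <->
    exists2 f, (forall i, i < 2 -> f i < S) & P2 (fun i => s (w + f i)) != P2 (fun i => s (y + f i)).
  by apply: (@sat_diffF s w y 2 (fun v => Eq v (v + 1)) P2) => [|||s' v|g h H] //;
    rewrite /P2 ?H //= addn0.
have HR R : sat s (diffF vb np nB nR w y (arity R) (RelI R)) <->
    exists2 f, (forall i, i < arity R -> f i < S) &
      PR R (fun i => s (w + f i)) != PR R (fun i => s (y + f i)).
  apply: (@sat_diffF s w y (arity R) (RelI R) (PR R)) => // [s' v|g h H].
    exact: sat_RelI.
  rewrite /PR (_ : [tuple g i | i < arity R] = [tuple h i | i < arity R]) //.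
  by apply: eq_from_tnth => i; rewrite !tnth_mktuple H.
split=> [|[T1 T2]].
  rewrite /difftype /= negb_or => /andP[/negP D1 /negP D2]; split=> [a b Ha Hb|R f Hf].
    case E : (P2 (fun i => s (w + nth 0 [:: a; b] i)) == P2 (fun i => s (y + nth 0 [:: a; b] i))).
      by move/eqP: E => E; move: E; rewrite /P2 /= => E; split=> /eqP; [rewrite E|rewrite -E] => /eqP.
    case: D1; apply/H2; exists (nth 0 [:: a; b]); last by rewrite E.
    by case=> [|[|]].
  case E : (PR R (fun i => s (w + f i)) == PR R (fun i => s (y + f i))); first exact/eqP.
  by case: D2; apply/sat_bigor_sym; exists R; apply/HR; exists f => //; rewrite E.
rewrite /difftype /= negb_or; apply/andP; split; apply/negP.
  move/H2 => [f Hf]; rewrite /P2; have := T1 (f 0) (f 1) (Hf 0 isT) (Hf 1 isT).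
  by move=> E /negP[]; apply/eqP; apply/idP/idP => /eqP; [move/E|move/E] => ->.
move/sat_bigor_sym => [R /HR[f Hf]]; by rewrite /PR T2 ?eqxx.
Qed.

Lemma stepok_ext W W' j u : (forall i, i < S -> W i = W' i) -> j < nR ->
  stepok W j u <-> stepok W' j u.
Proof.
move=> H Hj; rewrite /stepok; clear np2.
have E1 b : b < nB -> W (j.+1 * nB + b) = W' (j.+1 * nB + b) by move=> Hb; apply: H; rewrite /cellsize; nia.
have E2 b : b < nB -> W (j * nB + b) = W' (j * nB + b) by move=> Hb; apply: H; rewrite /cellsize; nia.
split=> -[S1 S2]; split=> -[b Hb].
- by rewrite -E1 // => Hu; have [] := S1; [exists b | move=> b' Hb'; rewrite E2 //; exists b'].
- by rewrite -E2 // => Hu; have [] := S2; [exists b | move=> b' Hb'; rewrite E1 //; exists b'].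
- by rewrite E1 // => Hu; have [] := S1; [exists b | move=> b' Hb'; rewrite -E2 //; exists b'].
- by rewrite E2 // => Hu; have [] := S2; [exists b | move=> b' Hb'; rewrite -E1 //; exists b'].
Qed.

Lemma sametype_ext W W' Y Y' : (forall i, i < S -> W i = W' i) -> (forall i, i < S -> Y i = Y' i) ->
  sametype W Y -> sametype W' Y'.
Proof.
move=> HW HY [T1 T2]; split=> [a b Ha Hb|R f Hf]; first by rewrite -!HW -?HY //; exact: T1.
have := T2 R f Hf.
have -> : [tuple W (f i) | i < arity R] = [tuple W' (f i) | i < arity R].
  by apply: eq_from_tnth => i; rewrite !tnth_mktuple HW // Hf.
have -> // : [tuple Y (f i) | i < arity R] = [tuple Y' (f i) | i < arity R].
by apply: eq_from_tnth => i; rewrite !tnth_mktuple HY // Hf.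
Qed.

Lemma sat_simF s y : yv <= y ->
  sat s (simF sg vb np nB nR nT y) <->
  exists2 W, lists W (s vb) & sametype W (fun a => s (y + a)).
Proof.
move=> Hy.
have val W : let s' := updr s wv S W in [/\ forall i, i < S -> s' (wv + i) = W i, s' vb = s vb,
   forall u i, i < S -> upd s' (uv vb) u (wv + i) = W i &
   forall x, yv <= x -> s' x = s x].
  rewrite /updr /yv /wv /ev /rv /lv /uv /Layout.pv /=; split=> [i Hi||u i Hi|x Hx]; rewrite ?updE;
    try (case: eqP => [|_]; first lia); case: ifP => H //; try lia; congr W; lia.
have upv : uv vb < pv by rewrite /uv /Layout.pv; lia.
have pvw : pv + np <= wv by rewrite /wv /ev /rv /lv; lia.
have ew : ev <= wv by rewrite /wv; lia.
have ey : ev <= y by move: Hy; rewrite /yv; lia.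
have BS : nB <= S by rewrite /cellsize; nia.
split=> [/sat_exs[W]|[W [L1 L2] T]].
  have [v1 v2 v3 v4] := val W; move: v1 v2 v3 v4; set s' := updr _ _ _ _ => v1 v2 v3 v4.
  rewrite sat_Neg sat_Or negb_or sat_Or negb_or => /and3P[/negP H1 H2 /(sat_difftype _ ew ey) H3].
  exists W; last by apply: sametype_ext H3 => // i Hi; rewrite v4 //; lia.
  split=> [b Hb|j u Hj].
    apply/eqP/negPn/negP => Hn; apply: H1; apply/sat_bigor_iota; exists b => //=.
    by rewrite v2 v1 ?(leq_trans Hb) // eq_sym.
  apply/(stepok_ext _ (v3 u)) => //.
  have : ~~ sat (upd s' (uv vb) u) (badcell sg vb nB nR (uv vb) wv).
    by apply: contra H2 => H2; apply/sat_Ex; exists u.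
  by move=> /(sat_badcell _ upv pvw) /(_ j Hj); rewrite updE eqxx.
apply/sat_exs; exists W.
have [v1 v2 v3 v4] := val W; move: v1 v2 v3 v4; set s' := updr _ _ _ _ => v1 v2 v3 v4.
rewrite sat_Neg sat_Or negb_or sat_Or negb_or; apply/and3P; split.
- apply/negP => /sat_bigor_iota[b Hb] /negP; apply; apply/eqP.
  by rewrite v2 v1 ?L1 // (leq_trans Hb).
- apply/negP => /sat_Ex[u]; apply/negP/(sat_badcell _ upv pvw) => j Hj.
  by rewrite updE eqxx; apply/(stepok_ext _ (v3 u)) => //; exact: L2.
- apply/(sat_difftype _ ew ey); apply: sametype_ext T => i Hi; first by rewrite v1.
  by rewrite v4 //; lia.
Qed.

Lemma sat_isC s x : sat s (isC sg vb np nB nR nT nC x) <-> exists2 k, k < nC & s x = s (center k).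
Proof.
by split=> [/sat_bigor_iota[k Hk /eqP E]|[k Hk E]]; [|apply/sat_bigor_iota]; exists k => //=; apply/eqP.
Qed.

Lemma sat_V1 s xs : ~~ sat s (V1 sg vb np nB nR nT nC xs) <->
  forall x, x \in xs -> exists2 k, k < nC & s x = s (center k).
Proof.
rewrite /V1 sat_bigor; split=> [/hasPn H x /H|H]; first by rewrite sat_Neg negbK => /sat_isC.
by apply/hasPn => x Hx; rewrite sat_Neg negbK; apply/sat_isC; exact: H.
Qed.

Lemma center_ge k : yv <= center k. Proof. exact: leq_addr. Qed.

Lemma sat_V2 s : ~~ sat s (V2 sg vb np nB nR nT nC) <->
  forall k, k < nC -> forall j, j < nR -> stepok (fun i => s (center k + i)) j (s vb).
Proof.
have zv : vb < pv by rewrite /Layout.pv; lia.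
have pvc k : pv + np <= center k by have := center_ge k; rewrite /yv /wv /ev /rv /lv; lia.
split=> [/negP H k Hk|H].
  apply/(sat_badcell _ zv (pvc k))/negP => Hs; apply: H; apply/sat_bigor_iota; by exists k.
by apply/negP=> /sat_bigor_iota[k Hk]; apply/negP/(sat_badcell _ zv (pvc k)); exact: H.
Qed.

Definition simb s k := exists2 W, lists W (s vb) & sametype W (fun a => s (center k + a)).

Lemma sat_V3 s : sat s (V3 sg vb np nB nR nT nC) <->
  exists E : nat -> A, forall k, k < nC ->
    s vb <> s (center k) /\ (simb s k -> exists2 l, l < nT & s (center k) = E l).
Proof.
have val E : [/\ forall i, i < nT -> updr s ev nT E (ev + i) = E i, updr s ev nT E vb = s vb &
   forall x, yv <= x -> updr s ev nT E x = s x].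
  rewrite /updr /yv /wv /ev /rv /lv /uv /Layout.pv /=; split=> [i Hi||x Hx];
    case: ifP => H //; try lia; congr E; lia.
have eqsim E k : simb (updr s ev nT E) k <-> simb s k.
  have [_ v2 v3] := val E; have Hk := center_ge k.
  rewrite /simb v2; split=> -[W HW T]; exists W => //;
    apply: (sametype_ext _ _ T) => // i Hi; rewrite v3 //; lia.
split=> [/sat_exs[E H]|[E HE]]; last (apply/sat_exs); exists E; have [v1 v2 v3] := val E.
  move: H; rewrite sat_Neg => /negP H k Hk; split=> [Ez|Hsim].
    apply: H; apply/sat_bigor_iota; exists k => //; rewrite sat_Or; apply/orP; left=> /=.
    by rewrite v2 v3 ?Ez // center_ge.
  case: (boolP (sat (updr s ev nT E) (among sg vb (center k) ev nT))) => [/sat_among[l Hl]|Ha].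
    by rewrite v1 // v3 ?center_ge //; exists l.
  case: H; apply/sat_bigor_iota; exists k => //; rewrite sat_Or sat_And sat_Neg Ha andbT.
  by apply/orP; right; apply/sat_simF; [exact: center_ge|apply/eqsim].
rewrite sat_Neg; apply/negP => /sat_bigor_iota[k Hk]; have [Ez Hs] := HE k Hk.
rewrite sat_Or sat_And sat_Neg => /orP[/eqP|/andP[/(sat_simF _ (center_ge k)) /eqsim /Hs [l Hl El]]].
  by rewrite v2 v3 ?center_ge.
by move=> /negP; apply; apply/sat_among; exists l; rewrite // v1 // v3 ?center_ge.
Qed.

Lemma sat_guard s x l : sat s (guard sg vb np nB nR nT nC x l) <->
  exists2 k, k < nC & exists2 i, i < (l + 1) * nB & s x = s (center k + i).
Proof.
split=> [/sat_bigor_iota[k Hk /sat_among Hi]|[k Hk Hi]]; first by exists k.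
by apply/sat_bigor_iota; exists k => //; apply/sat_among.
Qed.
End Semantics.

(** * Balls and partial isomorphisms *)

Section Balls.
Variables (sg : signature) (A : structure sg).
Implicit Types (a b u x y : A) (B : {set A}).

(** Grows one step at a time, in the same way as the levels of a cell; [ball_nbh] makes the link
    with distances. *)
Definition ball (r : nat) B : {set A} :=
  iter r (fun X : {set A} => [set u | [exists b in X, adjb u b]]) B.

Lemma ballS r B u : u \in ball r.+1 B <-> exists2 b, b \in ball r B & adjb u b.
Proof. by rewrite /ball iterS inE; split=> [/exists_inP|H] //; apply/exists_inP. Qed.

Lemma ball_add r s B : ball (r + s) B = ball r (ball s B).
Proof. exact: iterD. Qed.

Lemma ball_sub r B B' : B \subset B' -> ball r B \subset ball r B'.
Proof.
move=> H; elim: r => // r IH; apply/subsetP => u /ballS[b Hb Hu].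
by apply/ballS; exists b => //; apply: (subsetP IH).
Qed.

Lemma ball_incr r s B : ball r B \subset ball (s + r) B.
Proof.
elim: s => // s IH; apply: subset_trans IH _; apply/subsetP => u Hu.
by apply/ballS; exists u => //; exact: adjb_refl.
Qed.

Lemma ball_mono r s B B' : r <= s -> B \subset B' -> ball r B \subset ball s B'.
Proof.
move=> H1 H2; apply: subset_trans (ball_sub _ H2) _.
by rewrite -(subnK H1); exact: ball_incr.
Qed.

Lemma ball_bigcup r B u : u \in ball r B <-> exists2 b, b \in B & u \in ball r [set b].
Proof.
split=> [|[b Hb]]; last by apply: subsetP; apply: ball_sub; rewrite sub1set.
elim: r u => [|r IH] u; first by exists u => //; rewrite inE.
by move=> /ballS[v /IH[b Hb Hv] Hu]; exists b => //; apply/ballS; exists v.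
Qed.

Lemma ball_sym r a b : (a \in ball r [set b]) = (b \in ball r [set a]).
Proof.
suff H a' b' : a' \in ball r [set b'] -> b' \in ball r [set a'] by apply/idP/idP; exact: H.
elim: r a' b' => [|r IH] a' b'; first by rewrite !inE eq_sym.
move=> /ballS[v /IH Hv Ha]; rewrite -addn1 ball_add.
apply: subsetP Hv; apply: ball_sub; rewrite sub1set.
by apply/(ballS 0); exists a'; [rewrite inE|rewrite adjb_sym].
Qed.

(** This inclusion is the direction that locality needs: the local part of the matrix contains the
    ball of the universal element. *)
Lemma ball_nbh r B : ball r B \subset nbh r B.
Proof.
have dist_S k b v u : dist_le k b v -> adjb u v -> dist_le k.+1 b u.
  move=> /existsP[l /existsP[w /andP[pw lw]]].
  rewrite adjb_sym adjbE => /orP[/eqP <-|g].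
    have Hl : l < k.+2 by apply: ltn_trans (ltn_ord l) _.
    by apply/existsP; exists (Ordinal Hl); apply/existsP; exists w; rewrite pw.
  have Hl : l.+1 < k.+2 by exact: (ltn_ord l).
  apply/existsP; exists (Ordinal Hl); apply/existsP; exists [tuple of rcons w u].
  by rewrite /= rcons_path pw last_rcons eqxx (eqP lw) g.
elim: r => [|r IH]; apply/subsetP => u.
  move=> Hu; rewrite inE; apply/exists_inP; exists u => //.
  by apply/existsP; exists ord0; apply/existsP; exists [tuple]; rewrite /= eqxx.
move=> /ballS[v /(subsetP IH)]; rewrite inE => /exists_inP[b Hb Hv] Hu.
by rewrite inE; apply/exists_inP; exists b => //; exact: dist_S Hv Hu.
Qed.

Variables (d : nat) (bA : bounded d A).

Definition sphere (r : nat) a : {set A} := ball r.+1 [set a] :\: ball r [set a].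

Lemma card_bigcup_leq (X : {set A}) (F : A -> {set A}) k :
  (forall v, v \in X -> #|F v| <= k) -> #|\bigcup_(v in X) F v| <= #|X| * k.
Proof.
move=> H; rewrite -sum_nat_const.
apply: (big_ind2 (fun (Y : {set A}) n => #|Y| <= n)); rewrite ?cards0 //.
by move=> Y n Z m HY HZ; apply: leq_trans (leq_card_setU _ _) (leq_add HY HZ).
Qed.

(** An element [v] of one sphere has a neighbour [w] in the ball inside it, so at most [d - 1] of
    its neighbours lie in the next sphere. Only the center can have [d] outward neighbours, whence
    the shape of [nu]. *)
Lemma card_sphere r a : #|sphere r a| <= d * (d - 1) ^ r.
Proof.
elim: r => [|r IH].
  rewrite muln1; apply: leq_trans (bA a); apply: subset_leq_card; apply/subsetP => u.
  rewrite !inE => /andP[ne /exists_inP[b]]; rewrite inE => /eqP -> {b}.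
  by rewrite adjb_sym adjbE eq_sym (negbTE ne).
rewrite expnSr mulnA; apply: leq_trans (leq_mul IH (leqnn _)).
pose F v := [set u | gaifman A v u] :\: ball r.+1 [set a].
apply: leq_trans (card_bigcup_leq (F := F) _); last first.
  move=> v; rewrite in_setD => /andP[nv /ballS[w Hw Hvw]].
  have Hg : gaifman A v w.
    by move: Hvw; rewrite adjbE => /orP[/eqP E|//]; rewrite E Hw in nv.
  have E := cardsD1 w [set u | gaifman A v u]; rewrite inE Hg in E.
  have Hs : F v \subset [set u | gaifman A v u] :\ w.
    apply/subsetP => u; rewrite /F in_setD => /andP[nu Hu].
    rewrite in_setD1 Hu andbT; apply: contraNneq nu => ->.
    by apply: (subsetP (ball_incr r 1 _)).
  by apply: leq_trans (subset_leq_card Hs) _; rewrite leq_subRL ?(leq_trans _ (bA v)) // E.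
apply: subset_leq_card; apply/subsetP => u; rewrite in_setD => /andP[nu /ballS[v Hv Huv]].
apply/bigcupP; exists v.
  by rewrite in_setD Hv andbT; apply: contra nu => Hv'; apply/ballS; exists v.
rewrite in_setD nu inE /=; move: Huv; rewrite adjb_sym adjbE => /orP[/eqP E|//].
by rewrite -E Hv in nu.
Qed.

Lemma card_ball1 r a : #|ball r [set a]| <= nu d r.
Proof.
elim: r => [|r IH]; first by rewrite cards1.
have -> : nu d r.+1 = nu d r + d * (d - 1) ^ r by rewrite /nu big_nat_recr //= mulnDr addnA.
apply: leq_trans (leq_add IH (card_sphere r a)).
rewrite -(cardsID (ball r [set a]) (ball r.+1 [set a])) leq_add2r.
by apply: subset_leq_card; exact: subsetIr.
Qed.

Lemma card_ball r B : #|ball r B| <= #|B| * nu d r.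
Proof.
apply: leq_trans (card_bigcup_leq (fun v _ => card_ball1 r v)).
apply: subset_leq_card; apply/subsetP=> u /ball_bigcup[b Hb Hu].
by apply/bigcupP; exists b.
Qed.
End Balls.

(** * Partial isomorphisms between balls around tuples *)

Section PartialIso.
Variables (sg : signature) (A : structure sg).
Implicit Types (a b u x y : A) (B : {set A}) (P : seq (A * A)) (f : A -> A -> Prop).

(** A relation instead of a function makes inverses, compositions and unions immediate. The
    equivalence of equalities says both single-valued and injective. *)
Definition piso f :=
  (forall x y x' y', f x y -> f x' y' -> (x = x' <-> y = y')) /\
  (forall (R : symbol sg) (t t' : (arity R).-tuple A),
    (forall i, f (tnth t i) (tnth t' i)) -> (t \in interp A R) = (t' \in interp A R)).

Definition lefts P : {set A} := [set x in map fst P].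
Definition rights P : {set A} := [set x in map snd P].
Definition flip P := [seq (p.2, p.1) | p <- P].

(* The balls of radius [r] around the two tuples listed in [P] are isomorphic;
   the isomorphism is the restriction of a relation [f]. *)
Definition iso r P := exists f, [/\ piso f, forall p, p \in P -> f p.1 p.2,
  forall x, x \in ball r (lefts P) -> exists y, f x y &
  forall y, y \in ball r (rights P) -> exists x, f x y].

Lemma piso_flip f : piso f -> piso (fun x y => f y x).
Proof.
move=> [H1 H2]; split=> [x y x' y' Hx Hy|R t t' H]; first by rewrite (H1 _ _ _ _ Hx Hy).
by rewrite (H2 R t' t).
Qed.

Lemma lefts_flip P : lefts (flip P) = rights P.
Proof. by rewrite /lefts /rights /flip -map_comp. Qed.

Lemma rights_flip P : rights (flip P) = lefts P.
Proof. by rewrite /lefts /rights /flip -map_comp. Qed.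

Lemma iso_flip r P : iso r P -> iso r (flip P).
Proof.
move=> [f [H1 H2 H3 H4]]; exists (fun x y => f y x); rewrite lefts_flip rights_flip.
by split=> //; [exact: piso_flip | move=> _ /mapP[p Hp ->]; exact: H2].
Qed.

Lemma lefts_sub P P' : {subset P' <= P} -> lefts P' \subset lefts P.
Proof.
by move=> H; apply/subsetP=> x; rewrite !inE => /mapP[p /H Hp ->]; rewrite map_f.
Qed.

Lemma rights_sub P P' : {subset P' <= P} -> rights P' \subset rights P.
Proof.
by move=> H; apply/subsetP=> x; rewrite !inE => /mapP[p /H Hp ->]; rewrite map_f.
Qed.

Lemma iso_sub r r' P P' : r' <= r -> {subset P' <= P} -> iso r P -> iso r' P'.
Proof.
move=> Hr HP [f [H1 H2 H3 H4]]; exists f; split=> // [p /HP|x Hx|y Hy]; first exact: H2.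
- by apply: H3; apply: subsetP Hx; apply: ball_mono => //; exact: lefts_sub.
- by apply: H4; apply: subsetP Hy; apply: ball_mono => //; exact: rights_sub.
Qed.

Lemma piso_ball f r P k x y : piso f -> (forall p, p \in P -> f p.1 p.2) ->
  (forall x, x \in ball r (lefts P) -> exists y, f x y) ->
  k <= r -> x \in ball k (lefts P) -> f x y -> y \in ball k (rights P).
Proof.
move=> [F1 F2] HP Hdom; elim: k x y => [|k IH] x y Hk.
  rewrite /= !inE => /mapP[p Hp ->] Hf; apply/mapP; exists p => //.
  by apply/(F1 _ _ _ _ Hf (HP _ Hp)).
move=> Hx Hf; move: (Hx) => /ballS[x' Hx'] /orP[/eqP E|].
  by apply: (subsetP (ball_incr k 1 _)); apply: (IH x y) => //; [lia|rewrite E].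
move=> /existsP[R /exists_inP[t tR /andP[xt x't]]].
have Ht i : exists z, f (tnth t i) z.
  apply: Hdom; apply: (subsetP (ball_mono Hk (subxx _))); apply/ballS; exists x' => //.
  apply/orP; right; apply/existsP; exists R; apply/exists_inP; exists t => //.
  by rewrite mem_tnth.
have [g Hg] := fin_all_exists Ht.
have tR' : [tuple g i | i < arity R] \in interp A R.
  by rewrite -(F2 R t) // => i; rewrite tnth_mktuple.
have img z w : z \in t -> f z w -> w \in [tuple g i | i < arity R].
  move=> /tnthP[i Ei] Hzw; apply/tnthP; exists i; rewrite tnth_mktuple.
  by apply/(F1 _ _ _ _ Hzw (Hg i)).
have [y' Hy'] : exists y', f x' y'.
  by apply: Hdom; apply: (subsetP (ball_mono _ (subxx _))) Hx'; lia.
apply/ballS; exists y'; first by apply: (IH x') => //; lia.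
apply/orP; right; apply/existsP; exists R; apply/exists_inP; exists [tuple g i | i < arity R] => //.
by rewrite (img x) ?(img x').
Qed.

Lemma piso_ball_flip f r P k x y : piso f -> (forall p, p \in P -> f p.1 p.2) ->
  (forall y, y \in ball r (rights P) -> exists x, f x y) ->
  k <= r -> y \in ball k (rights P) -> f x y -> x \in ball k (lefts P).
Proof.
move=> F HP Hran Hk; rewrite -(lefts_flip P) -(rights_flip P) => Hy Hf.
apply: (piso_ball (piso_flip F) (P := flip P) (r := r) _ _ Hk Hy Hf) => [p|z].
  by move=> /mapP[q Hq ->]; exact: HP.
by rewrite lefts_flip; exact: Hran.
Qed.

(** The same relation [f] serves, because the ball of radius [r] around [u] lies within
    [r + (2 * r + 1) = 3 * r + 1] of the old elements. This is the origin of the recursion for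
    [rad]. *)
Lemma iso_near r P u : iso (3 * r + 1) P -> u \in ball (2 * r + 1) (lefts P) ->
  exists u', u' \in ball (2 * r + 1) (rights P) /\ iso r ((u, u') :: P).
Proof.
move=> [f [F1 F2 F3 F4]] Hu.
have [|u' Hf] := F3 u; first by apply: subsetP Hu; apply: ball_mono => //; lia.
have Hu' : u' \in ball (2 * r + 1) (rights P) by apply: (piso_ball F1 F2 F3 _ Hu Hf); lia.
have incl B v : v \in ball (2 * r + 1) B -> v |: B \subset ball (2 * r + 1) B.
  move=> Hv; rewrite subUset sub1set Hv; exact: (@ball_mono _ _ 0).
have e : 3 * r + 1 = r + (2 * r + 1) by lia.
exists u'; split=> //; exists f; split=> // [p|x Hx|y Hy].
- by rewrite inE => /orP[/eqP ->|] //; exact: F2.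
- apply: F3; rewrite e ball_add; apply: subsetP Hx; apply: ball_sub.
  by apply: subset_trans (incl _ _ Hu); apply/subsetP => z; rewrite !inE.
- apply: F4; rewrite e ball_add; apply: subsetP Hy; apply: ball_sub.
  by apply: subset_trans (incl _ _ Hu'); apply/subsetP => z; rewrite !inE.
Qed.

Lemma iso_refl r (s : seq A) : iso r [seq (x, x) | x <- s].
Proof.
exists eq; split=> [||x _|x _]; try by exists x.
  split=> [x y x' y' -> ->|R t t' H] //; by rewrite (eq_from_tnth H).
by move=> _ /mapP[x _ ->].
Qed.

Lemma iso1_sym r x y : iso r [:: (x, y)] -> iso r [:: (y, x)].
Proof. exact: iso_flip. Qed.

Lemma iso1_trans r x y z : iso r [:: (x, y)] -> iso r [:: (y, z)] -> iso r [:: (x, z)].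
Proof.
move=> [f [F1 F2 F3 F4]] [g [G1 G2 G3 G4]].
have Pxy : f x y by apply: (F2 (x, y)); rewrite inE.
have Pyz : g y z by apply: (G2 (y, z)); rewrite inE.
exists (fun a c => exists2 b, f a b & g b c); split=> [|p|a Ha|c Hc].
- split=> [a c a' c' [b fab gbc] [b' fab' gbc']|R t t' Ht].
    by rewrite (F1.1 _ _ _ _ fab fab') (G1.1 _ _ _ _ gbc gbc').
  have {}Ht i : exists b, f (tnth t i) b /\ g b (tnth t' i) by have [b ? ?] := Ht i; exists b.
  have [h Hh] := fin_all_exists Ht.
  rewrite (F1.2 R t [tuple h i | i < arity R]) => [|i]; last by rewrite tnth_mktuple; case: (Hh i).
  by apply: G1.2 => i; rewrite tnth_mktuple; case: (Hh i).
- by rewrite inE => /eqP -> /=; exists y.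
- have [b Hb] := F3 a Ha; have [|c Hc] := G3 b; last by exists c, b.
  exact: (piso_ball F1 F2 F3 (leqnn r) Ha Hb).
- have [b Hb] := G4 c Hc; have [|a Ha] := F4 b; last by exists a, b.
  exact: (piso_ball_flip G1 G2 G4 (leqnn r) Hc Hb).
Qed.

Lemma ball_cons r x B : ball r (x |: B) = ball r [set x] :|: ball r B.
Proof.
apply/eqP; rewrite eqEsubset subUset !ball_sub ?subsetUl ?subsetUr // !andbT.
apply/subsetP => u /ball_bigcup[b]; rewrite !inE => /orP[/eqP ->|Hb] Hu; rewrite ?Hu //.
by apply/orP; right; apply/ball_bigcup; exists b.
Qed.

Lemma lefts_cons p P : lefts (p :: P) = p.1 |: lefts P.
Proof. by apply/setP=> x; rewrite !inE. Qed.

Lemma rights_cons p P : rights (p :: P) = p.2 |: rights P.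
Proof. by apply/setP=> x; rewrite !inE. Qed.

(** Otherwise [u] would be within [r + 1 + r] of [B]. *)
Lemma far_adjb r u B x y : u \notin ball (2 * r + 1) B ->
  x \in ball r B -> y \in ball r [set u] -> ~~ adjb x y.
Proof.
move=> Hu Hx Hy; apply: contra Hu => Hxy; rewrite (_ : 2 * r + 1 = r + r.+1); last lia.
have Hy' : y \in ball r.+1 B by apply/ballS; exists x; rewrite // adjb_sym.
rewrite ball_sym in Hy; rewrite ball_add; apply: subsetP Hy; apply: ball_sub; by rewrite sub1set.
Qed.

(** The union of the two isomorphisms works because elements of the two balls are never equal or
    adjacent: a tuple with entries in both belongs to no relation, on either side. *)
Lemma iso_far r P u u' : iso r P -> iso r [:: (u, u')] ->
  u \notin ball (2 * r + 1) (lefts P) -> u' \notin ball (2 * r + 1) (rights P) ->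
  iso r ((u, u') :: P).
Proof.
move=> [f [F1 F2 F3 F4]] [g [G1 G2 G3 G4]] Hu Hu'.
have l1 : lefts [:: (u, u')] = [set u] by apply/setP=> x; rewrite !inE.
have r1 : rights [:: (u, u')] = [set u'] by apply/setP=> x; rewrite !inE.
(* The given relations may be defined outside the balls and interfere there, so both are first cut
   down to the balls. *)
pose f' x y := [/\ f x y, x \in ball r (lefts P) & y \in ball r (rights P)].
pose g' x y := [/\ g x y, x \in ball r [set u] & y \in ball r [set u']].
have fg x y x' y' : f' x y -> g' x' y' -> ~~ adjb x x' /\ ~~ adjb y y'.
  by move=> [_ fx fy] [_ gx gy]; rewrite (far_adjb Hu) ?(far_adjb Hu').
have ball0 r0 (B : {set A}) : B \subset ball r0 B by exact: (@ball_mono _ _ 0).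
exists (fun x y => f' x y \/ g' x y); rewrite lefts_cons rights_cons !ball_cons.
split=> [|p|x|y].
- split=> [x y x' y' []H []H'|R t t' Ht].
  + by case: H H' => H _ _ [H' _ _]; exact: F1.1 H H'.
  + by have [nx ny] := fg _ _ _ _ H H'; split=> E; move: nx ny; rewrite E adjb_refl.
  + by have [nx ny] := fg _ _ _ _ H' H; split=> E; move: nx ny; rewrite E adjb_refl.
  + by case: H H' => H _ _ [H' _ _]; exact: G1.1 H H'.
  case: (pselect (forall i, f' (tnth t i) (tnth t' i))) => [Hf|/existsNP[i Hi]].
    by apply: F1.2 => i; case: (Hf i).
  case: (pselect (forall i, g' (tnth t i) (tnth t' i))) => [Hg|/existsNP[j Hj]].
    by apply: G1.2 => k; case: (Hg k).
  have {}Hi : g' (tnth t i) (tnth t' i) by case: (Ht i).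
  have {}Hj : f' (tnth t j) (tnth t' j) by case: (Ht j).
  have adj_t (t0 : (arity R).-tuple A) : t0 \in interp A R -> adjb (tnth t0 j) (tnth t0 i).
    move=> H; apply/orP; right; apply/existsP; exists R; apply/exists_inP; exists t0 => //.
    by rewrite !mem_tnth.
  have [nx ny] := fg _ _ _ _ Hj Hi.
  by rewrite (negbTE (contra (adj_t t) nx)) (negbTE (contra (adj_t t') ny)).
- rewrite inE => /orP[/eqP ->|Hp] /=.
    right; split; [by apply: (G2 (u, u')); rewrite inE| |]; apply: (subsetP (ball0 _ _)); exact: set11.
  left; split; [exact: F2| |]; apply: (subsetP (ball0 _ _)); by rewrite inE map_f.
- rewrite inE => /orP[Hx|Hx].
    rewrite -l1 in Hx; have [y Hy] := G3 x Hx; exists y; right; split=> //; first by rewrite -l1.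
    by rewrite -r1; exact: (piso_ball G1 G2 G3 (leqnn r) Hx Hy).
  have [y Hy] := F3 x Hx; exists y; left; split=> //.
  exact: (piso_ball F1 F2 F3 (leqnn r) Hx Hy).
- rewrite inE => /orP[Hy|Hy].
    rewrite -r1 in Hy; have [x Hx] := G4 y Hy; exists x; right; split=> //; last by rewrite -r1.
    by rewrite -l1; exact: (piso_ball_flip G1 G2 G4 (leqnn r) Hy Hx).
  have [x Hx] := F4 y Hy; exists x; left; split=> //.
  exact: (piso_ball_flip F1 F2 F4 (leqnn r) Hy Hx).
Qed.

(* The two balls contain equally many elements of the type of [u]. *)
Lemma iso_outside r P u : iso (3 * r + 1) P ->
  u \in ball (2 * r + 1) (rights P) -> u \notin ball (2 * r + 1) (lefts P) ->
  exists u', [/\ u' \in ball (2 * r + 1) (lefts P), u' \notin ball (2 * r + 1) (rights P) &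
    iso r [:: (u', u)]].
Proof.
move=> [f [F1 F2 F3 F4]] Hu Hnu.
pose T := [set x | `[< iso r [:: (x, u)] >]].
have HT x : x \in T <-> iso r [:: (x, u)] by rewrite inE; split=> /asboolP.
pose L := T :&: ball (2 * r + 1) (lefts P); pose Q := T :&: ball (2 * r + 1) (rights P).
(* A preimage of [y] under [f] has the type of [y]: [f] is defined on its whole ball of radius [r],
   since [3 * r + 1 = r + (2 * r + 1)]. *)
have step y : exists x, y \in Q -> x \in L /\ f x y.
  case: (boolP (y \in Q)) => [|_]; last by exists y.
  rewrite inE => /andP[/HT Ty Hy].
  have [|x Hx] := F4 y; first by apply: subsetP Hy; apply: ball_mono => //; lia.
  have Hx' : x \in ball (2 * r + 1) (lefts P) by apply: (piso_ball_flip F1 F2 F4 _ Hy Hx); lia.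
  exists x => _; split=> //; rewrite inE Hx' andbT; apply/HT; apply: iso1_trans Ty.
  exists f; split=> // [p|z|z].
  - by rewrite inE => /eqP ->.
  - rewrite (_ : lefts _ = [set x]) => [Hz|]; last by apply/setP=> v; rewrite !inE.
    apply: F3; rewrite (_ : 3 * r + 1 = r + (2 * r + 1)); last lia.
    by rewrite ball_add; apply: subsetP Hz; apply: ball_sub; rewrite sub1set.
  - rewrite (_ : rights _ = [set y]) => [Hz|]; last by apply/setP=> v; rewrite !inE.
    apply: F4; rewrite (_ : 3 * r + 1 = r + (2 * r + 1)); last lia.
    by rewrite ball_add; apply: subsetP Hz; apply: ball_sub; rewrite sub1set.
have [g Hg] := fin_all_exists step.
have QL : #|Q| <= #|L|.
  rewrite -(card_in_imset (f := g)) => [|y y' Hy Hy' E].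
    by apply: subset_leq_card; apply/subsetP => _ /imsetP[y /Hg[HL _] ->].
  have [_ H1] := Hg y Hy; have [_ H2] := Hg y' Hy'; rewrite E in H1.
  by apply/(F1.1 _ _ _ _ H1 H2).
(* [u] is in [Q] but not in [L]. Were [L] a subset of [Q], it would be a proper one, against
   [QL]. *)
case: (boolP (L \subset Q)) => [sub|/subsetPn[u' Lu' nQ]].
  have uQ : u \in Q by rewrite inE Hu andbT; apply/HT; exact: (@iso_refl r [:: u]).
  have : L \proper Q.
    apply/properP; split=> //; exists u => //; by rewrite inE (negbTE Hnu) andbF.
  by move=> /proper_card; rewrite ltnNge QL.
move: Lu' nQ; rewrite !in_setI => /andP[Tu' Hu']; rewrite Tu' /= => nQ.
by exists u'; split=> //; apply/HT.
Qed.
End PartialIso.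

Definition rad (m : nat) : nat := iter m (fun r => 3 * r + 1) 0.
(** Under [D] open quantifiers, [q - D.+1] rounds remain after the next answer; its guard leaves
    that much of the radius [rad q] unspent. *)
Definition lev (q D : nat) : nat := rad q - rad (q - D.+1).

Lemma radS m : rad m.+1 = 3 * rad m + 1. Proof. by []. Qed.

Lemma rad_mono m n : m <= n -> rad m <= rad n.
Proof. by move=> /subnK <-; elim: (n - m) => // k IH; rewrite addSn radS; lia. Qed.

Fixpoint vars (sg : signature) (p : formula sg) : seq nat :=
  match p with
  | Eq x y => [:: x; y]
  | Rel _ v => v
  | Neg p1 => vars p1
  | Or p1 p2 => vars p1 ++ vars p2
  | Ex x p1 => x :: vars p1
  end.

Lemma fv_vars (sg : signature) (p : formula sg) : {subset fv p <= vars p}.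
Proof.
elim: p => [x y|R v|p IH|p IHp r IHr|x p IH] //= y.
  by rewrite !mem_cat => /orP[/IHp|/IHr] ->; rewrite ?orbT.
by rewrite mem_filter inE => /andP[_ /IH ->]; rewrite orbT.
Qed.

(** * The Ehrenfeucht game *)

Section Relativization.
Variables (sg : signature) (A : structure sg) (d : nat).
Hypothesis bA : bounded d A.
Variables (vb np nB nT nC q nv : nat) (s0 : nat -> A) (C Y : {set A}).
Local Notation guard := (guard sg vb np nB (rad q) nT nC).
Local Notation rel := (rel_ vb np nB (rad q) nT nC (lev q)).
Hypothesis nBE : nu d (rad q) <= nB.
Hypothesis nTE : nv * nB <= nT.
Hypothesis CY : C \subset Y.
Hypothesis guardE : forall (s : nat -> A) x l, x < vb -> (forall y, vb <= y -> s y = s0 y) ->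
  l <= rad q -> sat s (guard x l) = (s x \in ball l Y).
Hypothesis HC : forall z (E : {set A}), z \notin C -> #|E| <= nT ->
  exists c, [/\ c \in C, c \notin E & iso (rad q) [:: (z, c)]].

Lemma nu_mono r r' : r <= r' -> nu d r <= nu d r'.
Proof.
move=> H; rewrite /nu leq_add2l leq_mul2l (big_cat_nat _ H) //=.
by rewrite leq_addr orbT.
Qed.

Definition pairs (s s' : nat -> A) (vs : seq nat) := [seq (s x, s' x) | x <- vs].

Lemma card_rights (P : seq (A * A)) r : r <= rad q -> size P <= nv -> #|ball r (rights P)| <= nT.
Proof.
move=> Hr Hs; apply: leq_trans (card_ball bA _ _) (leq_trans (leq_mul _ _) nTE).
  by rewrite /rights cardsE (leq_trans (card_size _)) ?size_map.
by apply: leq_trans (nu_mono Hr) nBE.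
Qed.

(* One round of the Ehrenfeucht game, the answer being restricted to a ball
   around the centers. *)
Lemma answer_right m (P : seq (A * A)) u : m < q -> size P <= nv ->
  iso (rad m.+1) P -> (forall p, p \in P -> p.2 \in ball (rad q - rad m.+1) Y) ->
  exists u', u' \in ball (rad q - rad m) Y /\ iso (rad m) ((u, u') :: P).
Proof.
move=> Hm Hs HP HY; have Hmq := rad_mono Hm; have Hmm := rad_mono (leqnSn m).
have sub : ball (2 * rad m + 1) (rights P) \subset ball (rad q - rad m) Y.
  (* An answer near earlier ones is at most [2 * rad m + 1] further out, exactly the amount by which
     the guard widens in this round. *)
  have -> : rad q - rad m = (2 * rad m + 1) + (rad q - rad m.+1) by rewrite radS in Hmq *; lia.
  rewrite (ball_add (2 * rad m + 1)); apply: ball_sub; apply/subsetP => y; rewrite inE => /mapP[p Hp ->]; exact: HY.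
have subC c : c \in C -> c \in ball (rad q - rad m) Y.
  by move=> Hc; apply: (subsetP (@ball_mono _ _ 0 _ _ _ (leq0n _) CY)).
case: (boolP (u \in ball (2 * rad m + 1) (lefts P))) => [Hu|Hu].
  by have [u' [Hu' Hi]] := iso_near HP Hu; exists u'; split=> //; exact: (subsetP sub).
have HP0 : iso (rad m) P by apply: iso_sub HP => //; rewrite radS; lia.
have card_far : #|ball (2 * rad m + 1) (rights P)| <= nT.
  by apply: card_rights => //; rewrite radS in Hmq; lia.
suff [u' [C' F' I']] : exists u', [/\ u' \in C, u' \notin ball (2 * rad m + 1) (rights P) &
    iso (rad m) [:: (u, u')]] by exists u'; split; [exact: subC|exact: iso_far].
have weak x y : iso (rad q) [:: (x, y)] -> iso (rad m) [:: (x, y)].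
  by apply: iso_sub => //; apply: rad_mono; exact: ltnW.
(* If [u] is not a center, [HC] gives a center of its type far from the answers. If it is one and
   far from the answers, it answers itself. If it is close to them, [iso_outside] gives [u1] of the
   same type that is far from them, and the first two cases apply to [u1]. *)
case: (boolP (u \in C)) => [uC|nC']; last first.
  by have [c [Cc Ec Ic]] := HC nC' card_far; exists c; split=> //; exact: weak.
case: (boolP (u \in ball (2 * rad m + 1) (rights P))) => [Ub|]; last first.
  by exists u; split=> //; exact: (iso_refl _ [:: u]).
have [u1 [_ H1 I1]] := iso_outside HP Ub Hu.
case: (boolP (u1 \in C)) => [uC1|/HC /(_ card_far)[c [Cc Ec /weak Ic]]].
  by exists u1; split=> //; exact: iso1_sym.
by exists c; split=> //; apply: iso1_trans Ic; exact: iso1_sym.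
Qed.

(** Answers in the original formula are unrestricted, so [u'] answers itself if it is far on both
    sides; the other cases are [iso_near] and [iso_outside] with the sides exchanged. *)
Lemma answer_left m (P : seq (A * A)) u' : iso (rad m.+1) P -> exists u, iso (rad m) ((u, u') :: P).
Proof.
move=> HP; have HP0 : iso (rad m) P by apply: iso_sub HP => //; rewrite radS; lia.
have flipK (P' : seq (A * A)) : flip (flip P') = P'.
  by rewrite /flip -map_comp map_id_in // => -[].
have back u : iso (rad m) ((u', u) :: flip P) -> iso (rad m) ((u, u') :: P).
  by move=> /iso_flip /=; rewrite flipK.
have HP' : iso (3 * rad m + 1) (flip P) by exact: iso_flip.
case: (boolP (u' \in ball (2 * rad m + 1) (rights P))) => [Hu|Hu].
  rewrite -lefts_flip in Hu.
  by have [u [_ /back Hi]] := iso_near HP' Hu; exists u.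
case: (boolP (u' \in ball (2 * rad m + 1) (lefts P))) => [Hu2|Hu2]; last first.
  by exists u'; apply: iso_far => //; exact: (iso_refl _ [:: u']).
rewrite -rights_flip in Hu2; rewrite -lefts_flip in Hu.
have [u [_ H1 I1]] := iso_outside HP' Hu2 Hu.
by exists u; apply: iso_far; rewrite // ?lefts_flip // -?rights_flip //; rewrite -lefts_flip.
Qed.

(** [m] counts the rounds left: balls of radius [rad m] are still isomorphic, and answers lie within
    [rad q - rad m] of [Y]. [size vs + m] bounds the number of pairs ever in play, hence the size of
    the set to avoid. *)
Lemma rel_correct p m (s s' : nat -> A) vs :
  m <= q -> qrank p <= m -> {subset fv p <= vs} -> size vs + m <= nv ->
  (forall x, x \in vars p -> x < vb) -> (forall y, vb <= y -> s' y = s0 y) ->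
  (forall x, x \in vs -> s' x \in ball (rad q - rad m) Y) ->
  iso (rad m) (pairs s s' vs) -> sat s p = sat s' (rel (q - m) p).
Proof.
elim: p m s s' vs => [x y|R v|p IH|p IHp r IHr|x p IH] m s s' vs Hmq Hqr Hfv Hsz Hvars Hs0 HY Hiso.
- have [f [[F1 _] F2 _ _]] := Hiso.
  have Hf z : z \in [:: x; y] -> f (s z) (s' z).
    by move=> /Hfv Hz; apply: (F2 (s z, s' z)); apply/mapP; exists z.
  have E := F1 _ _ _ _ (Hf x (mem_head _ _)) (Hf y _).
  by apply/eqP/eqP => /E; rewrite !inE eqxx orbT; exact.
- have [f [[_ F1] F2 _ _]] := Hiso.
  apply: F1 => i; rewrite !tnth_map; apply: (F2 (s (tnth v i), s' (tnth v i))).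
  by apply/mapP; exists (tnth v i) => //; apply: Hfv; exact: mem_tnth.
- by rewrite /= (IH m s s' vs).
- rewrite /= geq_max in Hqr *; case/andP: Hqr => q1 q2.
  rewrite (IHp m s s' vs) ?(IHr m s s' vs) // => z Hz; try apply: Hfv; try apply: Hvars;
    by rewrite /= mem_cat Hz ?orbT.
- case: m Hmq Hqr Hsz HY Hiso => [|m] Hmq // Hqr Hsz HY Hiso.
  have xvb : x < vb by apply: Hvars; rewrite inE eqxx.
  have levE : lev q (q - m.+1) = rad q - rad m by rewrite /lev; congr (_ - rad _); lia.
  have Sm : (q - m.+1).+1 = q - m by lia.
  have up u u' : u' \in ball (rad q - rad m) Y -> iso (rad m) ((u, u') :: pairs s s' vs) ->
      sat (upd s x u) p = sat (upd s' x u') (rel (q - m) p).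
    move=> Hu' Hi; apply: (IH m _ _ (x :: vs)) => //; first exact: ltnW.
    + move=> z Hz; rewrite inE; case: eqP => //= /eqP nz; apply: Hfv.
      by rewrite /= mem_filter nz.
    + by rewrite /= addSnnS.
    + by move=> z Hz; apply: Hvars; rewrite inE Hz orbT.
    + by move=> y Hy; rewrite updE; case: eqP => [E|_]; [lia|exact: Hs0].
    + move=> z; rewrite updE inE; case: eqP => //= _ /HY.
      apply: subsetP; apply: ball_mono => //; have := rad_mono (leqnSn m); lia.
    + apply: iso_sub Hi => // _ /mapP[z Hz ->]; rewrite !updE; case: eqP => [_|/eqP nz].
        by rewrite inE eqxx.
      rewrite inE (negbTE nz) /= in Hz; rewrite inE; apply/orP; right.
      by apply/mapP; exists z.
  have guardx u : sat (upd s' x u) (guard x (rad q - rad m)) = (u \in ball (rad q - rad m) Y).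
    rewrite guardE ?updE ?eqxx ?leq_subr // => y Hy.
    by rewrite updE; case: eqP => [E|_]; [lia|exact: Hs0].
  have relE u : sat (upd s' x u) (Neg (Or (Neg (guard x (lev q (q - m.+1))))
      (Neg (rel (q - m.+1).+1 p)))) =
      (u \in ball (rad q - rad m) Y) && sat (upd s' x u) (rel (q - m) p).
    by rewrite levE Sm [LHS](sat_And _ (guard _ _)) guardx.
  apply/idP/idP => [/sat_Ex[u Hu]|/sat_Ex[u']]; last rewrite relE => /andP[Hu' Hs'].
    have [||u' [Hu' Hi]] := @answer_right m (pairs s s' vs) u Hmq _ Hiso.
    + by rewrite size_map (leq_trans _ Hsz) ?leq_addr.
    + by move=> _ /mapP[z Hz ->]; exact: HY.
    by apply/sat_Ex; exists u'; rewrite relE Hu' -(up u).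
  have [u Hi] := answer_left u' Hiso.
  by apply/sat_Ex; exists u; rewrite (up u u').
Qed.
End Relativization.

Lemma sat_ext (sg : signature) (A : structure sg) (s s' : nat -> A) (p : formula sg) :
  {in fv p, s =1 s'} -> sat s p = sat s' p.
Proof.
elim: p s s' => [x y|R v|p IH|p IHp r IHr|x p IH] s s' H /=.
- by rewrite !H // !inE eqxx ?orbT.
- suff -> : map_tuple s v = map_tuple s' v by [].
  by apply: eq_from_tnth => i; rewrite !tnth_map H // mem_tnth.
- by rewrite (IH s s').
- rewrite (IHp s s') ?(IHr s s') // => z Hz; apply: H; by rewrite /= mem_cat Hz ?orbT.
- apply: eq_existsb => a; apply: IH => z Hz; rewrite !updE; case: eqP => // /eqP nz.
  by apply: H; rewrite /= mem_filter nz.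
Qed.

(** * Correctness of the normal form *)

Section Cells.
Variables (sg : signature) (A : structure sg).
Variables (nB nR : nat).
Local Notation S := (cellsize nB nR).

(** In each cell, level [j.+1] consists of the elements adjacent to level [j]; taking unions over
    the cells commutes with this step. The case [n = 1] describes a single cell. *)
Lemma family_ball (n : nat) (W : nat -> nat -> A) (Y : {set A}) :
  (forall k j u, k < n -> j < nR -> stepok nB (W k) j u) ->
  (forall u, u \in Y <-> exists2 k, k < n & exists2 b, b < nB & u = W k b) ->
  forall l u, l <= nR ->
  (u \in ball l Y <-> exists2 k, k < n & exists2 b, b < nB & u = W k (l * nB + b)).
Proof.
move=> H HY; elim=> [|l IH] u Hl; first by rewrite HY.
rewrite ballS; split=> [[v /(IH _ (ltnW Hl))[k Hk [b Hb ->]] Hu]|[k Hk Hu]].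
  by exists k => //; apply/(H k l u Hk Hl); exists b.
move/(H k l u Hk Hl): Hu => [b Hb Hu]; exists (W k (l * nB + b)) => //.
by apply/(IH _ (ltnW Hl)); exists k => //; exists b.
Qed.

Lemma cell_ball (W : nat -> A) a l u :
  (forall j u, j < nR -> stepok nB W j u) -> a = W 0 -> 0 < nB -> l <= nR ->
  u \in ball l [set a] -> exists2 i, i < S & u = W i.
Proof.
move=> H Ha HB Hl Hu.
pose Y := [set v | [exists b : 'I_nB, v == W b]].
have HY v : v \in Y <-> exists2 k, k < 1 & exists2 b, b < nB & v = W b.
  rewrite inE; split=> [/existsP[b /eqP ->]|[_ _ [b Hb ->]]]; first by exists 0 => //; exists b.
  by apply/existsP; exists (Ordinal Hb).
have {}Hu : u \in ball l Y.
  apply: subsetP Hu; apply: ball_sub; rewrite sub1set; apply/HY; exists 0 => //.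
  by exists 0.
have [_ _ [b Hb ->]] := (family_ball (W := fun=> W) (fun _ j u _ => H j u) HY u Hl).1 Hu.
by exists (l * nB + b) => //; rewrite /cellsize; nia.
Qed.

(** Entries at equal positions are related, and the step condition puts both balls into the domain
    and the range. On the right only [V 0] is known to be the center, as nothing is assumed about
    the rest of level 0. *)
Lemma sametype_iso (W V : nat -> A) a c :
  0 < nB -> (forall b, b < nB -> W b = a) -> c = V 0 ->
  (forall j u, j < nR -> stepok nB W j u) -> (forall j u, j < nR -> stepok nB V j u) ->
  sametype nB nR W V -> iso nR [:: (a, c)].
Proof.
move=> HB HW Hc SW SV [T1 T2].
have S0 : 0 < S by rewrite /cellsize; nia.
exists (fun x y => exists2 i, i < S & x = W i /\ y = V i); split.
- split=> [x y x' y' [i Hi [-> ->]] [i' Hi' [-> ->]]|R t t' Ht]; first exact: T1.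
  have {}Ht i : exists j, [/\ j < S, tnth t i = W j & tnth t' i = V j].
    by have [j Hj [? ?]] := Ht i; exists j.
  have [g Hg] := fin_all_exists Ht.
  pose f n := if insub n is Some i then g i else 0.
  have := T2 R f; rewrite (_ : [tuple W (f i) | i < arity R] = t).
    rewrite (_ : [tuple V (f i) | i < arity R] = t').
      by apply=> i Hi; rewrite /f insubT /=; case: (Hg (Sub i Hi)).
    by apply: eq_from_tnth => i; rewrite tnth_mktuple /f valK; case: (Hg i).
  by apply: eq_from_tnth => i; rewrite tnth_mktuple /f valK; case: (Hg i).
- by move=> p; rewrite inE => /eqP -> /=; exists 0; rewrite // HW.
- move=> x; rewrite (_ : lefts _ = [set a]) => [Hx|]; last by apply/setP=> v; rewrite !inE.
  have [||i Hi Ei] := cell_ball SW _ HB _ Hx => //; first by rewrite HW.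
  by exists (V i), i.
- move=> x; rewrite (_ : rights _ = [set c]) => [Hx|]; last by apply/setP=> v; rewrite !inE.
  have [||i Hi Ei] := cell_ball SV _ HB _ Hx => //.
  by exists (W i), i.
Qed.
End Cells.

Lemma center_gt_vb vb np nB nR nT k i : vb < center vb np nB nR nT k + i.
Proof. by rewrite /center /yv /wv /ev /rv /lv /pv; lia. Qed.

Section Soundness.
Variables (sg : signature) (A : structure sg) (d : nat).
Hypothesis bA : bounded d A.
Variables (vb np nB nT nC q nv : nat).
Local Notation nR := (rad q).
Local Notation S := (cellsize nB nR).
Local Notation center := (center vb np nB nR nT).
Hypothesis ar_np : forall R : symbol sg, arity R <= np.
Hypothesis np2 : 2 <= np.
Hypothesis nB0 : 0 < nB.
Hypothesis nBE : nu d (rad q) <= nB.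
Hypothesis nTE : nv * nB <= nT.

Lemma matrix_sound (s : nat -> A) (p : formula sg) z :
  (forall x, x \in vars p -> x < vb) -> q = qrank p -> size (fv p) + qrank p <= nv ->
  (forall z, let s' := upd s vb z in
     [/\ ~~ sat s' (V1 sg vb np nB nR nT nC (fv p)), ~~ sat s' (V2 sg vb np nB nR nT nC) &
         ~~ sat s' (V3 sg vb np nB nR nT nC)]) ->
  sat (upd s vb z) p = sat (upd s vb z) (rel_ vb np nB nR nT nC (lev q) 0 p).
Proof.
move=> Hvars Hq Hnv H.
have sC z' k i : upd s vb z' (center k + i) = s (center k + i).
  by rewrite updE; case: eqP => // E; have := center_gt_vb vb np nB nR nT k i; rewrite E ltnn.
have sC0 z' k : upd s vb z' (center k) = s (center k) by rewrite -[center k]addn0 sC.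
have cellE z' k : (fun i => upd s vb z' (center k + i)) = (fun i => s (center k + i)).
  by apply: functional_extensionality => i; exact: sC.
have stepY k j u : k < nC -> j < nR -> stepok nB (fun i => s (center k + i)) j u.
  move=> Hk Hj; have [_ /(sat_V2 _ _ _ _ _ ar_np np2) /(_ k Hk j Hj)] := H u.
  by rewrite updE eqxx cellE.
pose C := [set a | [exists k : 'I_nC, a == s (center k)]].
(* [Y] collects the entire levels 0 and may exceed [C]: the matrix does not force the [nB] variables
   of level 0 of a guessed cell to be equal. This is harmless, since the guards then describe balls
   around [Y]. *)
pose Y := [set a | [exists k : 'I_nC, exists b : 'I_nB, a == s (center k + b)]].
have HCm a : a \in C <-> exists2 k, k < nC & a = s (center k).
  rewrite inE; split=> [/existsP[k /eqP ->]|[k Hk ->]]; first by exists k.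
  by apply/existsP; exists (Ordinal Hk).
have HYm a : a \in Y <-> exists2 k, k < nC & exists2 b, b < nB & a = s (center k + b).
  rewrite inE; split=> [/existsP[k /existsP[b /eqP ->]]|[k Hk [b Hb ->]]].
    by exists k => //; exists b.
  by apply/existsP; exists (Ordinal Hk); apply/existsP; exists (Ordinal Hb).
have CY : C \subset Y.
  apply/subsetP => a /HCm[k Hk ->]; apply/HYm; exists k => //; exists 0 => //; by rewrite addn0.
have levelE l u : l <= nR -> (u \in ball l Y <->
    exists2 k, k < nC & exists2 b, b < nB & u = s (center k + (l * nB + b))).
  exact: (@family_ball sg A nB nR nC (fun k i => s (center k + i)) Y stepY HYm l u).
have guardE (s1 : nat -> A) x l : x < vb -> (forall y, vb <= y -> s1 y = upd s vb z y) ->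
    l <= nR -> sat s1 (guard sg vb np nB nR nT nC x l) = (s1 x \in ball l Y).
  move=> Hx Hs1 Hl.
  have s1C k i : s1 (center k + i) = s (center k + i).
    by rewrite Hs1 ?sC //; have := center_gt_vb vb np nB nR nT k i; lia.
  apply/idP/idP => [/sat_guard[k Hk [i Hi]]|/(levelE _ _ Hl)[k Hk [b Hb E]]].
    rewrite s1C => E; have Hil : i %/ nB <= l by rewrite -ltnS ltn_divLR // -(addn1 l).
    apply: (subsetP (ball_mono Hil (subxx Y))); apply/levelE; first exact: leq_trans Hl.
    by exists k => //; exists (i %% nB); [rewrite ltn_mod|rewrite -divn_eq].
  apply/sat_guard; exists k => //; exists (l * nB + b); last by rewrite s1C.
  by rewrite mulnDl mul1n ltn_add2l.
have simE z' k : k < nC -> simb vb np nB nR nT (upd s vb z') k -> iso nR [:: (z', s (center k))].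
  move=> Hk [W [L1 L2]]; rewrite cellE; rewrite updE eqxx in L1 => T.
  apply: (sametype_iso nB0 L1 _ L2 _ T); rewrite ?addn0 // => j u; exact: stepY.
have HC (z' : A) (E : {set A}) : z' \notin C -> #|E| <= nT ->
    exists c, [/\ c \in C, c \notin E & iso (rad q) [:: (z', c)]].
  move=> nC' HE; case: (pselect (exists c, [/\ c \in C, c \notin E & iso (rad q) [:: (z', c)]])) => // Hno.
  have [_ _ /negP[]] := H z'; apply/(sat_V3 _ _ _ _ _ ar_np np2).
  exists (nth z' (enum E)) => k Hk; rewrite sC0; split.
    by rewrite updE eqxx => Ez; case/negP: nC'; apply/HCm; exists k.
  move=> /(simE _ _ Hk) Hi; case: (boolP (s (center k) \in E)) => [Ek|nE].
    exists (index (s (center k)) (enum E)); last by rewrite nth_index ?mem_enum.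
    by apply: leq_trans HE; rewrite cardE index_mem mem_enum.
  by case: Hno; exists (s (center k)); split=> //; apply/HCm; exists k.
have Hr := @rel_correct sg A d bA vb np nB nT nC q nv (upd s vb z) C Y nBE nTE CY guardE HC
   p q (upd s vb z) (upd s vb z) (fv p).
rewrite !subnn in Hr; apply: Hr => //; rewrite -?Hq //; first by rewrite Hq.
  move=> x Hx; apply: (subsetP CY); apply/HCm.
  have [/sat_V1 HV1 _ _] := H z; by have [k Hk ->] := HV1 x Hx; exists k; rewrite ?sC0.
have := iso_refl (rad q) [seq upd s vb z x | x <- fv p]; by rewrite -map_comp.
Qed.
End Soundness.

(** * Existence of suitable cells *)

Section Existence.
Variables (sg : signature) (A : structure sg) (d : nat).
Hypothesis bA : bounded d A.
Variables (vb np nB nT nC q : nat).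
Local Notation nR := (rad q).
Local Notation S := (cellsize nB nR).
Local Notation center := (center vb np nB nR nT).
Local Notation yv := (yv vb np nB nR nT).
Hypothesis ar_np : forall R : symbol sg, arity R <= np.
Hypothesis np2 : 2 <= np.
Hypothesis nB0 : 0 < nB.
Hypothesis nBE : nu d (rad q) <= nB.

(** The default of [nth] pads every level with the center, which belongs to all the balls; level 0
    therefore repeats [a]. *)
Definition listing (a : A) (i : nat) : A := nth a (enum (ball (i %/ nB) [set a])) (i %% nB).

Lemma listing_level a j u : j <= nR ->
  (exists2 b, b < nB & u = listing a (j * nB + b)) <-> u \in ball j [set a].
Proof.
move=> Hj; have E b : b < nB -> listing a (j * nB + b) = nth a (enum (ball j [set a])) b.
  by move=> Hb; rewrite /listing divnMDl // divn_small // addn0 modnMDl modn_small.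
have Ha : a \in ball j [set a] by apply: (subsetP (ball_mono (leq0n j) (subxx _))); rewrite inE.
split=> [[b Hb ->]|Hu].
  rewrite E //; case: (ltnP b (size (enum (ball j [set a])))) => Hs; last by rewrite nth_default.
  by rewrite -mem_enum mem_nth.
exists (index u (enum (ball j [set a]))); last by rewrite E ?nth_index ?mem_enum //;
  apply: leq_trans (leq_trans (card_ball1 bA j a) (leq_trans (nu_mono _ Hj) nBE));
  rewrite cardE index_mem mem_enum.
apply: leq_trans (leq_trans (card_ball1 bA j a) (leq_trans (nu_mono _ Hj) nBE)).
by rewrite cardE index_mem mem_enum.
Qed.

Lemma listing_step a j u : j < nR -> stepok nB (listing a) j u.
Proof.
move=> Hj; rewrite /stepok (listing_level a u Hj) ballS.
split=> [[v /(listing_level a v (ltnW Hj))[b Hb ->] Huv]|[b Hb Hu]]; first by exists b.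
exists (listing a (j * nB + b)) => //; apply/(listing_level a _ (ltnW Hj)); by exists b.
Qed.

Lemma listing0 a b : b < nB -> listing a b = a.
Proof.
move=> Hb; rewrite /listing divn_small //= modn_small //.
by rewrite enum_set1; case: b {Hb} => [|b] //=; rewrite nth_nil.
Qed.

Definition position : finType :=
  ('I_S * 'I_S + {R : symbol sg & (arity R).-tuple 'I_S})%type.

(** The set of atomic facts true of the listing. It depends on the order of enumeration and may
    separate isomorphic balls, but equal codes imply [sametype], and the number of codes is bounded
    independently of [A]. *)
Definition codeof (a : A) : {set position} :=
  [set p : position | match p with
    | inl ij => listing a ij.1 == listing a ij.2
    | inr (existT R t) => [tuple listing a (tnth t i) | i < arity R] \in interp A R
    end].

Lemma codeof_sametype a c : codeof a = codeof c -> sametype nB nR (listing a) (listing c).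
Proof.
move=> /setP E; split=> [i j Hi Hj|R f Hf].
  have := E (inl (Ordinal Hi, Ordinal Hj)); rewrite !inE /= => Eij.
  by split=> /eqP H; apply/eqP; [rewrite -Eij|rewrite Eij].
pose t := [tuple Ordinal (Hf i (ltn_ord i)) | i < arity R].
have := E (inr (existT _ R t)); rewrite !inE.
have tE (W : nat -> A) : [tuple W (tnth t i) | i < arity R] = [tuple W (f i) | i < arity R].
  by apply: eq_from_tnth => i; rewrite !tnth_mktuple.
by rewrite !tE.
Qed.

Lemma card_position :
  #|{set position}| = 2 ^ (S * S + sumn [seq S ^ a | a <- arities sg]).
Proof.
have -> : #|{set position}| = 2 ^ #|position|.
  by rewrite -[RHS]/(2 ^ #|position|) -[#|position|]cardsT -card_powerset powersetT cardsT.
rewrite card_sum card_prod card_ord card_tagged; congr (2 ^ (_ + sumn _)).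
under eq_map => R do rewrite card_tuple card_ord.
have -> : enum (fintype_ordinal__canonical__fintype_Finite (size (arities sg))) = symbols sg by [].
rewrite (map_comp (fun a => S ^ a) (@arity sg)); congr map.
rewrite /symbols /arity (map_comp (nth 0 (arities sg)) val) val_enum_ord.
by rewrite map_nth_iota0 // take_size.
Qed.

Lemma witness_exists (s : nat -> A) (xs : seq nat) :
  (forall x, x \in xs -> x < vb) ->
  2 ^ (S * S + sumn [seq S ^ a | a <- arities sg]) * nT.+1 + size xs <= nC ->
  exists W : nat -> A, forall z, let s' := upd (updr s yv (nC * S) W) vb z in
     [/\ ~~ sat s' (V1 sg vb np nB nR nT nC xs), ~~ sat s' (V2 sg vb np nB nR nT nC) &
         ~~ sat s' (V3 sg vb np nB nR nT nC)].
Proof.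
move=> Hxs HnC.
pose cls (e : {set position}) := [set a | codeof a == e].
pose Cs := flatten [seq take nT.+1 (enum (cls e)) | e <- enum {set position}] ++ [seq s x | x <- xs].
have szC : size Cs <= nC.
  apply: leq_trans HnC; rewrite size_cat size_map leq_add2r size_flatten /shape -map_comp.
  rewrite -card_position cardE; elim: (enum _) => //= e es IH; rewrite mulSn leq_add //.
  by rewrite size_take_min geq_minl.
(* Cells beyond the size of [Cs] list the ball of [s 0], so they pass [V2] as well; additional
   centers only make [V3] harder to satisfy. *)
pose c k := nth (s 0) Cs k.
pose W n := listing (c (n %/ S)) (n %% S).
have S0 : 0 < S by rewrite /cellsize; nia.
exists W => z; set s' := upd _ _ _.
have s'C k i : k < nC -> i < S -> s' (center k + i) = listing (c k) i.
  move=> Hk Hi; rewrite /s' updE; case: eqP => [E|_].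
    have := center_gt_vb vb np nB nR nT k i; rewrite E ltnn //.
  rewrite /updr /Layout.center ifT; last by nia.
  have -> : yv + k * S + i - yv = k * S + i by lia.
  by rewrite /W divnMDl // divn_small // addn0 modnMDl modn_small.
have s'C0 k : k < nC -> s' (center k) = c k.
  by move=> Hk; rewrite -[center k]addn0 s'C // listing0.
have s'x x : x < vb -> s' x = s x.
  move=> Hx; rewrite /s' updE; case: eqP => [E|_]; first by rewrite E ltnn in Hx.
  by rewrite /updr ifN // /Layout.yv /wv /ev /rv /lv /pv; lia.
have s'z : s' vb = z by rewrite /s' updE eqxx.
have inC a : a \in Cs -> exists2 k, k < nC & s' (center k) = a.
  move=> Ha; have Hk : index a Cs < nC by apply: leq_trans szC; rewrite index_mem.
  by exists (index a Cs); rewrite // s'C0 // /c nth_index.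
split.
- apply/sat_V1 => x Hx; rewrite s'x ?Hxs //.
  have [|k Hk E] := inC (s x); first by rewrite mem_cat map_f ?orbT.
  by exists k.
- apply/(sat_V2 _ _ _ _ _ ar_np np2) => k Hk j Hj.
  apply/(stepok_ext (s' vb) (fun i => s'C k i Hk) Hj); exact: listing_step.
apply/negP => /(sat_V3 _ _ _ _ _ ar_np np2)[E HE].
have zC : z \notin Cs.
  by apply/negP => /inC[k Hk Ez]; have [] := HE k Hk; rewrite s'z Ez.
pose T := take nT.+1 (enum (cls (codeof z))).
have sub : {subset T <= Cs}.
  move=> a Ha; rewrite mem_cat; apply/orP; left; apply/flatten_mapP; exists (codeof z) => //.
  by rewrite mem_enum.
(* A class of at most [nT] elements would have been taken entirely, and [z] would be a center. *)
have szT : size T = nT.+1.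
  rewrite /T size_takel // leqNgt; apply/negP => Hlt; case/negP: zC; apply: sub.
  by rewrite /T take_oversize ?mem_enum ?inE // ltnW.
have uT : uniq T by apply: take_uniq; exact: enum_uniq.
(* All of [T] are centers of the type of [z], so the [nT] values of [E] would have to cover [nT.+1]
   distinct elements. *)
have : {subset T <= [seq E l | l <- iota 0 nT]}.
  move=> a Ta; have [k Hk Ek] := inC a (sub a Ta); have [_] := HE k Hk.
  have [|l Hl El] := _ : exists2 l, l < nT & s' (center k) = E l; last first.
    move=> _; apply/mapP; exists l; by rewrite ?mem_iota // -El Ek.
  apply: (HE k Hk).2; exists (listing z).
    by rewrite s'z; split=> [b|j u]; [exact: listing0|exact: listing_step].
  have Ea : codeof z = codeof (c k).
    rewrite -s'C0 // Ek; move: Ta => /mem_take; rewrite mem_enum inE => /eqP ->.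
    by [].
  by apply: sametype_ext (codeof_sametype Ea) => // i Hi; rewrite s'C.
by move=> /(uniq_leq_size uT); rewrite szT size_map size_iota ltnn.
Qed.
End Existence.

(** * Locality *)

Section Locality.
Variables (sg : signature) (A : structure sg) (X : {set A}) (hX : 0 < #|X|).
Local Notation B := (induced hX).
Implicit Types (a : B) (s : nat -> B).

Definition lift s : nat -> A := fun x => val (s x).

Lemma in_induced (x : A) : x \in X -> exists b : B, x = val b.
Proof. by move=> Hx; exists (Sub x Hx : B). Qed.

Lemma lift_upd s x (b : B) : upd (lift s) x (val b) = lift (upd s x b).
Proof. by apply: functional_extensionality => y; rewrite /lift !updE; case: eqP. Qed.

Lemma interp_induced (R : symbol sg) (t : (arity R).-tuple B) :
  (t \in interp B R) = (map_tuple val t \in interp A R).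
Proof. by rewrite inE. Qed.

(** All entries of a tuple containing [val b] are adjacent to [val b], hence in [X], so the tuple
    survives in the substructure. *)
Lemma adjb_induced a (b : B) : ball 1 [set val b] \subset X ->
  adjb a b = adjb (val a) (val b).
Proof.
move=> HX; rewrite /adjb (inj_eq val_inj); case: eqP => //= _.
apply/idP/idP => /existsP[R /exists_inP[t Ht /andP[Ha Hb]]].
  rewrite interp_induced in Ht.
  apply/existsP; exists R; apply/exists_inP; exists (map_tuple val t) => //.
  by rewrite !map_f.
have tX i : tnth t i \in X.
  apply: (subsetP HX); apply/(ballS 0); exists (val b); first by rewrite inE.
  apply/orP; right; apply/existsP; exists R; apply/exists_inP; exists t => //.
  by rewrite mem_tnth.
pose t' : (arity R).-tuple B := [tuple (Sub (tnth t i) (tX i) : B) | i < arity R].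
have tE : map_tuple val t' = t by apply: eq_from_tnth => i; rewrite tnth_map tnth_mktuple.
have mem_t' c : val c \in t -> c \in t'.
  move=> /tnthP[i Ei]; apply/tnthP; exists i; apply: val_inj.
  by rewrite tnth_mktuple.
apply/existsP; exists R; apply/exists_inP; exists t'; first by rewrite interp_induced tE.
by rewrite !mem_t'.
Qed.

Variables (vb np nB nR nT nC : nat).
Local Notation S := (cellsize nB nR).
Hypothesis ar_np : forall R : symbol sg, arity R <= np.
Hypothesis np2 : 2 <= np.
Hypothesis nB0 : 0 < nB.

Lemma stepok_induced (W : nat -> B) j a :
  ball 1 [set val a] \subset X ->
  stepok nB W j a <-> stepok nB (fun i => val (W i)) j (val a).
Proof.
move=> Ha; rewrite /stepok.
have E1 i : (a = W i) <-> (val a = val (W i)) by split=> [->|/val_inj].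
have E2 i : adjb a (W i) = adjb (val a) (val (W i)).
  by rewrite adjb_sym adjb_induced // adjb_sym.
split=> -[S1 S2]; split=> -[i Hi Hb].
- by have [|i' Hi'] := S1; [exists i => //; apply/E1|rewrite E2; exists i'].
- by have [|i' Hi' /E1] := S2; [exists i; rewrite // E2|exists i'].
- by have [|i' Hi'] := S1; [exists i => //; apply/E1|rewrite -E2; exists i'].
- by have [|i' Hi' /E1] := S2; [exists i; rewrite // -E2|exists i'].
Qed.

Lemma sametype_induced (W V : nat -> B) :
  sametype nB nR W V <-> sametype nB nR (fun i => val (W i)) (fun i => val (V i)).
Proof.
have E (U : nat -> B) i j : U i = U j <-> val (U i) = val (U j) by split=> [->|/val_inj].
have ER (U : nat -> B) (R : symbol sg) f : ([tuple U (f i) | i < arity R] \in interp B R) =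
    ([tuple val (U (f i)) | i < arity R] \in interp A R).
  rewrite interp_induced (_ : map_tuple _ _ = [tuple val (U (f i)) | i < arity R]) //.
  by apply: eq_from_tnth => i; rewrite tnth_map !tnth_mktuple.
split=> -[T1 T2]; split=> [i j Hi Hj|R f Hf].
- by rewrite -!E; exact: T1.
- by rewrite -!ER; exact: T2.
- by rewrite !E; exact: T1.
- by rewrite !ER; exact: T2.
Qed.

Lemma lists_ball (A' : structure sg) (W : nat -> A') z j (b : nat) :
  lists nB nR W z -> j <= nR -> b < nB -> W (j * nB + b) \in ball j [set z].
Proof.
move=> [L1 L2] Hj Hb; apply/(family_ball (W := fun=> W) (n := 1) (nR := nR) (nB := nB)) => //.
- by move=> k i u _; exact: L2.
- move=> u; rewrite inE; split=> [/eqP ->|[k _ [i Hi ->]]]; last by rewrite L1.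
  by exists 0 => //; exists 0; rewrite ?L1.
- by exists 0 => //; exists b.
Qed.

(** The step condition speaks of all elements [u], but one adjacent to an entry of level [j < nR]
    lies in the ball of radius [nR], hence in [X]. By induction on the level, the entries of level
    [j] stay in the ball of radius [j]. *)
Lemma lists_induced (W : nat -> B) a : ball nR [set val a] \subset X ->
  lists nB nR W a <-> lists nB nR (fun i => val (W i)) (val a).
Proof.
move=> Ha.
have near j (x y : A) : j < nR -> x \in ball j [set val a] -> adjb y x -> y \in X.
  move=> Hj Hx Hy; apply: (subsetP Ha); apply: (subsetP (ball_mono Hj (subxx _))).
  by apply/ballS; exists x.
have near1 j (x : A) : j < nR -> x \in ball j [set val a] -> ball 1 [set x] \subset X.
  move=> Hj Hx; apply/subsetP => y /(ballS 0)[x']; rewrite inE => /eqP ->.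
  exact: near Hj Hx.
split=> L; split.
- by move=> b Hb; rewrite L.1.
- have inb j : j <= nR -> forall b, b < nB -> val (W (j * nB + b)) \in ball j [set val a].
    elim: j => [|j IH] Hj b Hb; first by rewrite mul0n add0n L.1 // inE.
    have [|b' Hb' Hadj] := (L.2 j (W (j.+1 * nB + b)) Hj).1; first by exists b.
    rewrite adjb_induced in Hadj; last exact: near1 Hj (IH (ltnW Hj) b' Hb').
    by apply/ballS; exists (val (W (j * nB + b'))) => //; exact: IH (ltnW Hj) b' Hb'.
  move=> j u Hj; split=> [[b Hb ->]|[b Hb Hu]].
    have [|b' Hb' Hadj] := (L.2 j (W (j.+1 * nB + b)) Hj).1; first by exists b.
    exists b' => //; rewrite -adjb_induced //; exact: near1 Hj (inb j (ltnW Hj) b' Hb').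
  have [c Ec] := in_induced (near j _ _ Hj (inb j (ltnW Hj) b Hb) Hu).
  rewrite Ec in Hu *.
  have [|b' Hb' ->] := (L.2 j c Hj).2; last by exists b'.
  by exists b; rewrite // adjb_induced //; exact: near1 Hj (inb j (ltnW Hj) b Hb).
- by move=> b Hb; apply: val_inj; rewrite L.1.
- move=> j u Hj.
  have E b : b < nB -> adjb u (W (j * nB + b)) = adjb (val u) (val (W (j * nB + b))).
    move=> Hb; rewrite adjb_induced //; apply: (near1 j _ Hj).
    exact: (lists_ball L (ltnW Hj) Hb).
  have [S1 S2] := L.2 j (val u) Hj; split=> -[b Hb Hu].
    by have [|b' Hb'] := S1; [exists b; rewrite // Hu|rewrite -E //; exists b'].
  have [|b' Hb' /val_inj] := S2; last by exists b'.
  by exists b; rewrite // -E.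
Qed.

Lemma simb_induced s k : ball nR [set val (s vb)] \subset X ->
  simb vb np nB nR nT s k <-> simb vb np nB nR nT (lift s) k.
Proof.
move=> Hz; split=> [[W HW T]|[W HW T]].
  exists (fun i => val (W i)); first exact/lists_induced.
  exact: (sametype_induced _ _).1 T.
pose W' i : B := insubd (s vb) (W i).
have W'E i : i < S -> val (W' i) = W i.
  move=> Hi; rewrite /W' insubdK //; apply: (subsetP Hz); rewrite (divn_eq i nB).
  have Hil : i %/ nB <= nR by rewrite -ltnS ltn_divLR // -(addn1 nR).
  apply: (subsetP (ball_mono Hil (subxx _))); apply: (lists_ball HW) => //; by rewrite ltn_mod.
exists W'; last by apply/sametype_induced; apply: sametype_ext T => // i Hi; rewrite W'E.
apply/lists_induced => //; split=> [b Hb|j u Hj].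
  by rewrite W'E ?HW.1 //; apply: leq_trans Hb _; rewrite /cellsize; nia.
by apply/(stepok_ext u W'E Hj); exact: HW.2.
Qed.

(** A guard makes the quantified element equal to the value of a cell variable, and that value is in
    the substructure. *)
Lemma rel_induced (lv : nat -> nat) p D s : (forall x, x \in vars p -> x < vb) ->
  sat (lift s) (rel_ vb np nB nR nT nC lv D p) = sat s (rel_ vb np nB nR nT nC lv D p).
Proof.
elim: p D s => [x y|R v|p IH|p IHp r IHr|x p IH] D s Hv.
- by rewrite /= (inj_eq val_inj).
- rewrite /= inE; suff -> : map_tuple val (map_tuple s v) = map_tuple (lift s) v by [].
  by apply: eq_from_tnth => i; rewrite !tnth_map.
- by rewrite /= IH.
- by rewrite /= IHp ?IHr // => x Hx; apply: Hv; rewrite /= mem_cat Hx ?orbT.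
have xvb : x < vb by apply: Hv; rewrite inE eqxx.
have {}Hv y : y \in vars p -> y < vb by move=> Hy; apply: Hv; rewrite inE Hy orbT.
set g := guard sg vb np nB nR nT nC x (lv D).
have relE (A' : structure sg) (s' : nat -> A') :
    sat s' (Neg (Or (Neg g) (Neg (rel_ vb np nB nR nT nC lv D.+1 p)))) =
    sat s' g && sat s' (rel_ vb np nB nR nT nC lv D.+1 p) by exact: sat_And.
have gE (s' : nat -> B) : sat (lift s') g = sat s' g.
  apply/idP/idP => /sat_guard[k Hk [i Hi]] E; apply/sat_guard; exists k => //; exists i => //.
    exact: val_inj.
  by rewrite /lift E.
rewrite [rel_ _ _ _ _ _ _ _ _ _]/=; apply/idP/idP => /sat_Ex[a]; rewrite relE => /andP[].
  move=> Hg Hs; have [b Eb] : exists b : B, a = val b.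
    case/sat_guard: Hg => k Hk [i Hi]; rewrite updE eqxx updE ifN => [->|]; first by eexists.
    by have := center_gt_vb vb np nB nR nT k i; lia.
  apply/sat_Ex; exists b; rewrite relE -gE -IH // -lift_upd -Eb; exact/andP.
by move=> Hg Hs; apply/sat_Ex; exists (val a); rewrite relE lift_upd gE IH ?Hg.
Qed.

(** [V2] inspects the neighbours of the element at [vb], [V3] its ball of radius [nR]. The radius
    [nR.+1] covers both, also when [nR] is 0. *)
Lemma matrix_induced (lv : nat -> nat) p s : (forall x, x \in vars p -> x < vb) ->
  ball nR.+1 [set val (s vb)] \subset X ->
  sat (lift s) (matrix vb np nB nR nT nC lv p) = sat s (matrix vb np nB nR nT nC lv p).
Proof.
move=> Hv Hz.
have Hz1 : ball 1 [set val (s vb)] \subset X.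
  by apply: subset_trans Hz; exact: (ball_mono (ltn0Sn nR)).
have HzR : ball nR [set val (s vb)] \subset X.
  by apply: subset_trans Hz; exact: (ball_mono (leqnSn nR)).
have E x y : (lift s x = lift s y) <-> (s x = s y) by split=> [/val_inj|H] //; rewrite /lift H.
have iff_negb b1 b2 : (~~ b1 <-> ~~ b2) -> b1 = b2 by case: b1; case: b2; case=> //= H1 H2; [have := H2 isT|have := H1 isT].
have E1 : sat (lift s) (V1 sg vb np nB nR nT nC (fv p)) = sat s (V1 sg vb np nB nR nT nC (fv p)).
  apply: iff_negb; rewrite !sat_V1; split=> H x /H[k Hk Ek]; exists k => //; exact/E.
have E2 : sat (lift s) (V2 sg vb np nB nR nT nC) = sat s (V2 sg vb np nB nR nT nC).
  apply: iff_negb; rewrite !(sat_V2 _ _ _ _ _ ar_np np2).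
  by split=> H k Hk j Hj; apply/(stepok_induced _ _ Hz1); exact: H.
have E3 : sat (lift s) (V3 sg vb np nB nR nT nC) = sat s (V3 sg vb np nB nR nT nC).
  apply/idP/idP => /(sat_V3 _ _ _ _ _ ar_np np2)[F HF]; apply/(sat_V3 _ _ _ _ _ ar_np np2).
    (* A covering element outside [X] may be replaced: it equals no center, because centers have
       values in [X]. *)
    exists (fun l => insubd (s vb) (F l)) => k Hk; have [H1 H2] := HF k Hk.
    split=> [/E|/(simb_induced _ HzR) /H2[l Hl El]] //; exists l => //; apply: val_inj.
    by rewrite -El /lift valKd.
  exists (fun l => val (F l)) => k Hk; have [H1 H2] := HF k Hk.
  by split=> [/E|/(simb_induced _ HzR) /H2[l Hl El]] //; exists l => //; rewrite /lift El.
by rewrite /matrix !sat_Neg !sat_Or !sat_Neg E1 E2 E3 rel_induced.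
Qed.
End Locality.

(** * Equivalence and shape of the normal form *)

Section NormalForm.
Variables (sg : signature) (d : nat) (phi : formula sg).
Variables (vb np nB nT nC : nat).
Local Notation q := (qrank phi).
Local Notation S := (cellsize nB (rad q)).
Hypothesis ar_np : forall R : symbol sg, arity R <= np.
Hypothesis np2 : 2 <= np.
Hypothesis nB0 : 0 < nB.
Hypothesis nBE : nu d (rad q) <= nB.
Hypothesis nTE : (size (fv phi) + q) * nB <= nT.
Hypothesis Hvars : forall x, x \in vars phi -> x < vb.
Hypothesis nCE :
  2 ^ (S * S + sumn [seq S ^ a | a <- arities sg]) * nT.+1 + size (fv phi) <= nC.
Local Notation nf := (normal_form vb np nB (rad q) nT nC (lev q) phi).
Local Notation mx := (matrix vb np nB (rad q) nT nC (lev q) phi).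

Lemma normal_form_equiv : d_equiv d phi nf.
Proof.
move=> A bA s.
have vby x : yv vb np nB (rad q) nT <= x -> vb < x by rewrite /yv /wv /ev /rv /Layout.lv /pv; lia.
have vary W z x : x \in fv phi ->
    upd (updr s (yv vb np nB (rad q) nT) (nC * S) W) vb z x = s x.
  move=> Hx; have Hxv := Hvars (fv_vars Hx); rewrite updE; case: eqP => [E|_].
    by rewrite E ltnn in Hxv.
  by rewrite /updr ifN //; apply/negP => /andP[/vby]; lia.
have nfE : sat s nf <-> exists W : nat -> A, forall z,
    sat (upd (updr s (yv vb np nB (rad q) nT) (nC * S) W) vb z) mx.
  have AllE s' : sat s' (All vb mx) <-> forall z, sat (upd s' vb z) mx.
    rewrite /All sat_Neg; split=> [/negP H z|H].
      by case E : (sat (upd s' vb z) mx) => //; case: H; apply/sat_Ex; exists z; rewrite sat_Neg E.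
    by apply/negP => /sat_Ex[z]; rewrite sat_Neg H.
  by split=> [/sat_exs[W /AllE HW]|[W HW]]; [|apply/sat_exs]; exists W => //; apply/AllE.
have mxE s' : sat s' mx = [&& ~~ sat s' (V1 sg vb np nB (rad q) nT nC (fv phi)),
    ~~ sat s' (V2 sg vb np nB (rad q) nT nC), ~~ sat s' (V3 sg vb np nB (rad q) nT nC) &
    sat s' (rel_ vb np nB (rad q) nT nC (lev q) 0 phi)].
  by rewrite /matrix sat_Neg !sat_Or sat_Neg !negb_or negbK.
have sound W : (forall z, let s' := upd (updr s (yv vb np nB (rad q) nT) (nC * S) W) vb z in
     [/\ ~~ sat s' (V1 sg vb np nB (rad q) nT nC (fv phi)), ~~ sat s' (V2 sg vb np nB (rad q) nT nC) &
         ~~ sat s' (V3 sg vb np nB (rad q) nT nC)]) -> forall z,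
     sat s phi = sat (upd (updr s (yv vb np nB (rad q) nT) (nC * S) W) vb z)
       (rel_ vb np nB (rad q) nT nC (lev q) 0 phi).
  move=> H z; rewrite -(@matrix_sound sg A d bA vb np nB nT nC q _ ar_np np2 nB0 nBE nTE) //.
  by apply: sat_ext => x Hx; rewrite vary.
apply/idP/idP => [Hs|/nfE[W HW]].
  have Hfv x : x \in fv phi -> x < vb by move/fv_vars; exact: Hvars.
  have [W HW] := witness_exists bA ar_np np2 nB0 nBE s Hfv nCE.
  apply/nfE; exists W => z; rewrite mxE; have [-> -> ->] := HW z.
  by rewrite -(sound W HW z).
rewrite (sound W _ (s 0)) => [|z]; first by have := HW (s 0); rewrite mxE => /and4P[].
by have := HW z; rewrite mxE => /and4P[].
Qed.

Lemma local_matrix : local_around (rad q).+1 [:: vb] mx.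
Proof.
move=> A s hX s' Hs'.
(* Even if [phi] is a sentence, the falsity that ends [bigor] contains [vb]; hence [s'] agrees with
   [s] on it. *)
have Hz : vb \in fv mx.
  rewrite /matrix /V1 /= mem_cat; apply/orP; left.
  by elim: (fv phi) => [|x xs IH] /=; rewrite ?inE ?eqxx // mem_cat IH orbT.
rewrite (@sat_ext sg A s (lift s')) => [|x Hx]; last by rewrite /lift Hs'.
apply: matrix_induced => //; rewrite Hs' //.
apply: subset_trans (ball_nbh _ _) _; rewrite /local_part.
by rewrite (_ : [set s vb] = [set a in [seq s i | i <- [:: vb]]]) ?subsetUr //; apply/setP => x; rewrite !inE.
Qed.

Lemma normal_form_BSNF : BSNF nf.
Proof.
exists (iota (yv vb np nB (rad q) nT) (nC * S)), vb, mx, (rad q).+1; split=> //.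
  by rewrite /= iota_uniq mem_iota /yv /wv /ev /rv /Layout.lv /pv andbT; lia.
exact: local_matrix.
Qed.
End NormalForm.

(** * Free variables of the normal form *)

Section FreeVariables.
Variables (sg : signature).
Implicit Types (p : formula sg) (P : pred nat).
Variables (vb np nB nR nT nC : nat).
Local Notation S := (cellsize nB nR).
Local Notation lv := (lv vb np).
Local Notation rv := (rv vb np).

Lemma all_fv_sub P P' p : (forall x, P x -> P' x) -> all P (fv p) -> all P' (fv p).
Proof. by move=> H; apply: sub_all => x; exact: H. Qed.

Lemma all_fv_Or P p r : all P (fv (Or p r)) = all P (fv p) && all P (fv r).
Proof. exact: all_cat. Qed.

Lemma all_fv_Neg P p : all P (fv (Neg p)) = all P (fv p). Proof. by []. Qed.

Lemma all_fv_bigor P (T : eqType) (l : seq T) F :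
  P vb -> (forall i, i \in l -> all P (fv (F i))) -> all P (fv (bigor (sg := sg) vb l F)).
Proof.
move=> Pz; elim: l => [|i l IH] H /=; first by rewrite Pz.
rewrite all_cat H ?mem_head // IH // => j Hj; apply: H; by rewrite inE Hj orbT.
Qed.

Lemma all_fv_bigor_iota P n F :
  P vb -> (forall i, i < n -> all P (fv (F i))) -> all P (fv (bigor (sg := sg) vb (iota 0 n) F)).
Proof. by move=> Pz H; apply: all_fv_bigor => // i; rewrite mem_iota => /H. Qed.

Lemma all_fv_Ex P x p : all (fun y => P y || (y == x)) (fv p) -> all P (fv (Ex x p)).
Proof.
move=> /allP H; apply/allP => y /=; rewrite mem_filter => /andP[ny /H].
by rewrite (negbTE ny) orbF.
Qed.

Lemma all_fv_exs P v n p : all (fun y => P y || (v <= y < v + n)) (fv p) -> all P (fv (exs v n p)).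
Proof.
rewrite /exs; elim: n v P => [|n IH] v P /=.
  by apply: all_fv_sub => x /orP[//|]; lia.
move=> H; apply: all_fv_Ex; apply: IH; apply: all_fv_sub H => x /orP[->//|Hx].
by rewrite -orbA; apply/orP; right; lia.
Qed.

Lemma all_fv_among P u st n : P vb -> P u -> (forall i, i < n -> P (st + i)) ->
  all P (fv (among sg vb u st n)).
Proof. by move=> Pz Pu H; apply: all_fv_bigor_iota => // i Hi /=; rewrite Pu H. Qed.

Lemma all_fv_RelI P R v : (forall i, i < arity R -> P (v + i)) -> all P (fv (RelI (sg := sg) R v)).
Proof.
move=> H; apply/allP => x /=; rewrite mem_iota => Hx.
by rewrite (_ : x = v + (x - v)); [apply: H|]; lia.
Qed.

Lemma all_fv_adjF P u v : P vb -> P u -> P v -> all P (fv (adjF sg vb u v)).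
Proof.
move=> Pz Pu Pv; rewrite /= Pu Pv /=; apply: all_fv_bigor => // R _.
have mid i : i < arity R -> pv vb <= pv vb + i < pv vb + arity R by lia.
apply: all_fv_exs; rewrite [fv _]/= !all_cat; apply/and3P; split.
- by apply: all_fv_RelI => i Hi; rewrite mid // orbT.
- by apply: all_fv_among; rewrite ?Pz ?Pu // => i Hi; rewrite mid // orbT.
- by apply: all_fv_among; rewrite ?Pz ?Pv // => i Hi; rewrite mid // orbT.
Qed.

Lemma all_fv_badcell P u st : P vb -> P u -> (forall i, i < S -> P (st + i)) ->
  all P (fv (badcell sg vb nB nR u st)).
Proof.
move=> Pz Pu H; apply: all_fv_bigor_iota => // j Hj.
have HS b : b < nB + nB -> P (st + j * nB + b).
  by move=> Hb; rewrite -addnA; apply: H; rewrite /cellsize; nia.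
have H1 : all P (fv (among sg vb u (st + j * nB + nB) nB)).
  by apply: all_fv_among => // i Hi; rewrite -addnA; apply: HS; lia.
have H2 : all P (fv (bigor vb (iota 0 nB) (fun b => adjF sg vb u (st + j * nB + b)))).
  by apply: all_fv_bigor_iota => // b Hb; apply: all_fv_adjF => //; apply: HS; lia.
by rewrite [fv _]/= !all_cat H1 H2.
Qed.

Lemma all_fv_diffF P w y n F : P vb ->
  (forall i, i < S -> P (w + i)) -> (forall i, i < S -> P (y + i)) ->
  (forall v (Q : pred nat), (forall i, i < n -> Q (v + i)) -> all Q (fv (F v))) ->
  all P (fv (diffF (sg := sg) vb np nB nR w y n F)).
Proof.
move=> Pz Hw Hy HF; apply: all_fv_exs; apply: all_fv_exs.
set Q := (fun _ => _ || _).
have Ql i : i < n -> Q (lv + i) by move=> Hi; apply/orP; left; apply/orP; right; lia.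
have Qr i : i < n -> Q (rv + i) by move=> Hi; apply/orP; right; lia.
have QP x : P x -> Q x by move=> Px; rewrite /Q Px.
have Hm : all Q (fv (bigor vb (iota 0 n) (fun i => Neg (matchF sg vb nB nR (lv + i) (rv + i) w y)))).
  apply: all_fv_bigor_iota => [|i Hi]; first exact: QP.
  apply: all_fv_bigor_iota => [|a Ha]; first exact: QP.
  by rewrite /= Ql // Qr // !QP ?Hw ?Hy.
by rewrite [fv _]/= !all_cat Hm !HF.
Qed.

Lemma all_fv_simF P y : P vb -> (forall i, i < S -> P (y + i)) ->
  all P (fv (simF sg vb np nB nR nT y)).
Proof.
move=> Pz Hy; apply: all_fv_exs; set Q := (fun _ => _ || _).
have Qw i : i < S -> Q (wv vb np nT + i) by move=> Hi; apply/orP; right; lia.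
have QP x : P x -> Q x by move=> Px; rewrite /Q Px.
have BS b : b < nB -> b < S by rewrite /cellsize; nia.
have H1 : all Q (fv (bigor (sg := sg) vb (iota 0 nB) (fun b => Neg (Eq vb (wv vb np nT + b))))).
  by apply: all_fv_bigor_iota => [|b Hb]; [exact: QP|rewrite /= QP // Qw // BS].
have H2 : all Q (fv (Ex (uv vb) (badcell sg vb nB nR (uv vb) (wv vb np nT)))).
  apply: all_fv_Ex; apply: all_fv_badcell => [||i Hi]; rewrite ?eqxx ?orbT //; first by rewrite QP.
  by apply/orP; left; exact: Qw.
have H3 : all Q (fv (difftype sg vb np nB nR (wv vb np nT) y)).
  have Qy i : i < S -> Q (y + i) by move=> Hi; apply/QP/Hy.
  rewrite all_fv_Or; apply/andP; split.
    apply: all_fv_diffF => // [|v Q' HQ]; first exact: QP.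
    by rewrite /= -{1}[v]addn0 !HQ.
  apply: all_fv_bigor => [|R _]; first exact: QP.
  apply: all_fv_diffF => // [|v Q' HQ]; first exact: QP.
  exact: all_fv_RelI.
by rewrite all_fv_Neg all_fv_Or H1 all_fv_Or H2 H3.
Qed.

Lemma all_fv_rel P (le : nat -> nat) D p : P vb ->
  (forall k i, k < nC -> i < S -> P (center vb np nB nR nT k + i)) -> (forall j, le j <= nR) ->
  all P (fv p) -> all P (fv (rel_ vb np nB nR nT nC le D p)).
Proof.
move=> Pz HC Hle; elim: p D P Pz HC => [x y|R v|p IH|p IHp r IHr|x p IH] D P Pz HC //.
- exact: IH.
- by rewrite /= !all_cat => /andP[Hp Hr]; rewrite (IHp _ P) // (IHr _ P).
move=> /allP Hp; rewrite [rel_ _ _ _ _ _ _ _ _ _]/=; apply: all_fv_Ex; rewrite [fv _]/= all_cat; apply/andP; split.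
  apply: all_fv_bigor_iota => [|k Hk]; first by rewrite Pz.
  apply: all_fv_among; rewrite ?Pz ?eqxx ?orbT // => i Hi; rewrite HC // /cellsize.
  by have := Hle D; nia.
apply: IH; [by rewrite Pz|by move=> k i Hk Hi; rewrite HC|].
apply/allP => y Hy; case: eqP => [|/eqP ny]; rewrite ?orbT // orbF.
by apply: Hp; rewrite mem_filter ny.
Qed.

Hypothesis nB0 : 0 < nB.

Lemma fv_normal_form (le : nat -> nat) p : (forall j, le j <= nR) ->
  {subset fv (normal_form vb np nB nR nT nC le p) <= fv p}.
Proof.
move=> Hle; apply/allP; apply: all_fv_exs; rewrite /All all_fv_Neg; apply: all_fv_Ex.
set P := (fun _ => _ || _).
have Pz : P vb by rewrite /P eqxx !orbT.
have PC k i : k < nC -> i < S -> P (center vb np nB nR nT k + i).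
  by move=> Hk Hi; apply/orP; left; apply/orP; right; rewrite /center; nia.
have S0 : 0 < S by rewrite /cellsize; nia.
have PC0 k : k < nC -> P (center vb np nB nR nT k).
  by move=> Hk; rewrite -[center _ _ _ _ _ _]addn0 PC.
have Pp x : x \in fv p -> P x by move=> Hx; rewrite /P Hx.
have HisC x : P x -> all P (fv (isC sg vb np nB nR nT nC x)).
  by move=> Px; apply: all_fv_bigor_iota => // k Hk; rewrite /= Px PC0.
have H1 : all P (fv (V1 sg vb np nB nR nT nC (fv p))).
  by apply: all_fv_bigor => // x /Pp; exact: HisC.
have H2 : all P (fv (V2 sg vb np nB nR nT nC)).
  by apply: all_fv_bigor_iota => // k Hk; apply: all_fv_badcell => // i; exact: PC.
have H3 : all P (fv (V3 sg vb np nB nR nT nC)).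
  apply: all_fv_exs; set Q := (fun _ => _ || _).
  have QP x : P x -> Q x by move=> Px; rewrite /Q Px.
  apply: all_fv_bigor_iota => [|k Hk]; first exact: QP.
  have H3 : all Q (fv (simF sg vb np nB nR nT (center vb np nB nR nT k))).
    by apply: all_fv_simF => [|i Hi]; apply: QP => //; exact: PC.
  have H4 : all Q (fv (among sg vb (center vb np nB nR nT k) (ev vb np) nT)).
    apply: all_fv_among => [||i Hi]; [exact: QP|exact/QP/PC0|].
    by apply/orP; right; lia.
  by rewrite all_fv_Or all_fv_Neg all_fv_Or 3!all_fv_Neg H3 H4 /= !QP ?PC0.
have H4 : all P (fv (rel_ vb np nB nR nT nC le 0 p)).
  by apply: all_fv_rel => //; apply/allP => x; exact: Pp.
by rewrite all_fv_Neg /matrix all_fv_Neg all_fv_Or H1 all_fv_Or H2 all_fv_Or H3.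
Qed.
End FreeVariables.

(** * Printing the normal form *)

(* Memory cells 0, ..., 63 are scalar variables, those from 19 on being
   temporary; the five arrays are interleaved from cell 64 on. *)
Notation rD := 1.
Notation rZ := 2.
Notation rU := 3.
Notation rP := 4.
Notation rL := 5.
Notation rR := 6.
Notation rE := 7.
Notation rW := 8.
Notation rY := 9.
Notation rK := 10.
Notation rB := 11.
Notation rS := 12.
Notation rN := 13.
Notation rT := 14.
Notation rC := 15.
Notation rQ := 16.
Notation rLen := 17.
Notation rX := 18.

(** Array 0 holds the arities and then the input word, 1 the stack of the scan, 2 its open
    quantifiers, 3 the radii, 4 the widths of the guards. The sum is [64 + j + 5 * i], written
    without a product. *)
Definition arr (j : nat) (i : expr) : expr := EAdd (EC (64 + j)) (EAdd i (EAdd (EAdd i i) (EAdd i i))).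

Fixpoint seqc (c : cmd) (cs : seq cmd) : cmd :=
  if cs is c' :: cs' then Sq c (seqc c' cs') else c.

(** A loop of one round is a local assignment that keeps the command [pure]. *)
Definition letC (x : nat) (e : expr) (c : cmd) := For x e (EC 0) (EC 1) c.
Definition negC (c : cmd) := Sq (Pr (EC 4)) c.
Definition orC (c1 c2 : cmd) := seqc (Pr (EC 6)) [:: c1; Pr (EC 5); c2; Pr (EC 7)].
Definition andC (c1 c2 : cmd) := negC (orC (negC c1) (negC c2)).
Definition iffC (c1 c2 : cmd) := orC (negC (orC c1 c2)) (negC (orC (negC c1) (negC c2))).
Definition eqC (x y : expr) := seqc (Pr x) [:: Pr (EC 2); Pr y].
Definition exC (x : expr) (c : cmd) := seqc (Pr (EC 3)) [:: Pr x; c].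
Definition bigorC (x : nat) (a d n : expr) (c : cmd) :=
  seqc (For x a d n (seqc (Pr (EC 6)) [:: c; Pr (EC 5)]))
    [:: negC (eqC (EV rZ) (EV rZ)); For 19 (EC 0) (EC 0) n (Pr (EC 7))].
Definition exsC (v n : expr) (c : cmd) :=
  Sq (For 20 v (EC 1) n (Sq (Pr (EC 3)) (Pr (EV 20)))) c.
Definition relC (r v n : expr) :=
  seqc (Pr (EAdd (EC 8) r)) [:: Pr (EC 6); Pr v;
    For 20 (EAdd v (EC 1)) (EC 1) (ESub n (EC 1)) (Sq (Pr (EC 1)) (Pr (EV 20)));
    Pr (EC 7)].

Section Printing.
Variables (sg : signature) (X : nat).
Local Notation k := (size (arities sg)).
Local Notation enc := (@enc_formula sg).
Implicit Types (p : formula sg) (m : nat -> nat).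

Definition varcode (x : nat) : nat := 8 + k + x.

Definition prints (c : cmd) (m : nat -> nat) (w : seq nat) := pr c m = w /\ psmall X c m.

Lemma enc_Neg p : enc (Neg p) = 4 :: enc p. Proof. by []. Qed.

Lemma enc_Or p1 p2 : enc (Or p1 p2) = 6 :: enc p1 ++ 5 :: enc p2 ++ [:: 7].
Proof. by rewrite /enc_formula /= map_cat /= map_cat. Qed.

Lemma enc_Eq x y : enc (Eq x y) = [:: varcode x; 2; varcode y].
Proof. by []. Qed.

Lemma enc_Ex x p : enc (Ex x p) = [:: 3, varcode x & enc p].
Proof. by []. Qed.

Lemma enc_bigor z (T : Type) (l : seq T) (F : T -> formula sg) :
  enc (bigor z l F) = flatten [seq 6 :: enc (F i) ++ [:: 5] | i <- l] ++
    [:: 4; varcode z; 2; varcode z] ++ nseq (size l) 7.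
Proof.
elim: l => [|i l IH] //; rewrite [bigor _ _ _]/= -/(bigor z l F) enc_Or IH /=.
have e n : nseq n 7 ++ [:: 7] = 7 :: nseq n 7 by elim: n => //= n ->.
by rewrite /= -!catA /= -?catA e.
Qed.

Lemma enc_exs v n p :
  enc (exs v n p) = flatten [seq [:: 3; varcode (v + i)] | i <- iota 0 n] ++ enc p.
Proof.
rewrite /exs; elim: n v => [|n IH] v //; rewrite [foldr _ _ _]/= enc_Ex IH /= addn0.
rewrite -[1]/(1 + 0) iotaDl -map_comp; congr [:: _, _ & flatten _ ++ _].
by apply: eq_map => i /=; rewrite add1n addSnnS.
Qed.

Lemma enc_RelI (R : symbol sg) v :
  enc (RelI R v) = [:: 8 + R, 6, varcode v &
    flatten [seq [:: 1; varcode (v + 1 + i)] | i <- iota 0 (arity R - 1)] ++ [:: 7]].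
Proof.
rewrite /RelI /enc_formula /= map_cat /=; congr [:: _, _ & _].
have: 0 < arity R by apply: (allP (arities_gt0 sg)); exact: mem_nth.
case: (arity R) => // n _; rewrite subn1 -cat_cons; congr (_ ++ _).
elim: n v => [|n IH] v //; rewrite [LHS]/= -/(iota v.+1 n.+1) {}IH /= addn0 addn1.
congr [:: _, _, _ & flatten _]; first by rewrite addn1.
rewrite (iotaDl 1 0 n) -map_comp; apply: eq_map => i /=.
by rewrite add1n !addn1 addSnnS.
Qed.

Lemma prints_Pr e m v : eval m e = v -> prints (Pr e) m [:: v].
Proof. by move=> <-. Qed.

Lemma prints_Sq c1 c2 m w1 w2 :
  prints c1 m w1 -> prints c2 m w2 -> prints (Sq c1 c2) m (w1 ++ w2).
Proof. by move=> [<- s1] [<- s2]. Qed.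

Lemma prints_let x e c m w : 0 < X -> prints c (upd m x (eval m e)) w -> prints (letC x e c) m w.
Proof.
by move=> X0 [E s]; split=> [|/=]; rewrite /= ?muln0 ?addn0 ?cats0 //; split=> // -[|//]; rewrite addn0.
Qed.

Lemma prints_neg c m p : prints c m (enc p) -> prints (negC c) m (enc (Neg p)).
Proof. by move=> H; apply: (@prints_Sq _ _ _ [:: 4]). Qed.

Lemma prints_or c1 c2 m p1 p2 :
  prints c1 m (enc p1) -> prints c2 m (enc p2) -> prints (orC c1 c2) m (enc (Or p1 p2)).
Proof.
move=> H1 H2; rewrite enc_Or; apply: (@prints_Sq _ _ _ [:: 6]) => //.
apply: prints_Sq => //; apply: (@prints_Sq _ _ _ [:: 5]) => //; exact: prints_Sq.
Qed.

Lemma prints_and c1 c2 m p1 p2 :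
  prints c1 m (enc p1) -> prints c2 m (enc p2) -> prints (andC c1 c2) m (enc (And p1 p2)).
Proof. by move=> H1 H2; apply/prints_neg/prints_or; exact: prints_neg. Qed.

Lemma prints_iff c1 c2 m p1 p2 :
  prints c1 m (enc p1) -> prints c2 m (enc p2) -> prints (iffC c1 c2) m (enc (Iff p1 p2)).
Proof.
by move=> H1 H2; apply: prints_or; apply: prints_neg; apply: prints_or => //; exact: prints_neg.
Qed.

Lemma prints_eq x y m u v : eval m x = varcode u -> eval m y = varcode v ->
  prints (eqC x y) m (enc (Eq u v)).
Proof. by rewrite enc_Eq => <- <-. Qed.

Lemma prints_ex x c m u p : eval m x = varcode u -> prints c m (enc p) ->
  prints (exC x c) m (enc (Ex u p)).
Proof. by rewrite enc_Ex => <- [<- ?]. Qed.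

(** [F'] indexes the disjuncts by numbers, as the loop does, while [l] may be a list of relation
    symbols. *)
Lemma prints_bigor_gen (vb x : nat) (a d n : expr) c m (T : Type) (l : seq T) (F : T -> formula sg) F' :
  m rZ = varcode vb -> eval m n = size l -> eval m n <= X ->
  (forall i, i < size l -> prints c (upd m x (eval m a + i * eval m d)) (enc (F' i))) ->
  [seq F i | i <- l] = [seq F' i | i <- iota 0 (size l)] ->
  prints (bigorC x a d n c) m (enc (bigor vb l F)).
Proof.
move=> HZ Hn HX Hc Hl; split; last first.
  split=> /=; last by split=> //; split.
  by split=> // i; rewrite Hn => /Hc[_ H].
rewrite enc_bigor /= HZ Hn; congr (_ ++ [:: _, _, _, _ & _]); last first.
  have fl i j : flatten [seq [:: 7] | _ <- iota i j] = nseq j 7 by elim: j i => //= j IH i; rewrite IH.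
  exact: fl.
rewrite (map_comp (fun p => 6 :: enc p ++ [:: 5]) F) Hl -map_comp; congr flatten; apply/eq_in_map => i.
by rewrite mem_iota /= => /Hc[-> _].
Qed.

Lemma prints_bigor (vb x : nat) (a d n : expr) c m N (F : nat -> formula sg) :
  m rZ = varcode vb -> eval m n = N -> N <= X ->
  (forall i, i < N -> prints c (upd m x (eval m a + i * eval m d)) (enc (F i))) ->
  prints (bigorC x a d n c) m (enc (bigor vb (iota 0 N) F)).
Proof.
move=> HZ Hn HX Hc; by apply: (prints_bigor_gen (F' := F)); rewrite ?size_iota ?Hn.
Qed.

Lemma prints_bigor_sym (vb x : nat) c m (F : symbol sg -> formula sg) :
  m rZ = varcode vb -> m rK = k -> k <= X ->
  (forall R : symbol sg, prints c (upd m x R) (enc (F R))) ->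
  prints (bigorC x (EC 0) (EC 1) (EV rK) c) m (enc (bigor vb (symbols sg) F)).
Proof.
move=> HZ HK HX Hc.
have sz : size (symbols sg) = k by rewrite /symbols size_enum_ord.
have [k0|k0] := posnP k.
  have -> : symbols sg = [::] by apply: size0nil; rewrite sz.
  by apply: (prints_bigor_gen (F' := fun=> Eq 0 0)); rewrite //= HK k0.
pose R0 : symbol sg := Ordinal k0.
apply: (prints_bigor_gen (F' := fun i => F (nth R0 (symbols sg) i))); rewrite ?sz //= ?HK //.
  by move=> i Hi; have := Hc (nth R0 (symbols sg) i); rewrite add0n muln1 nth_enum_ord.
rewrite (map_comp F (nth R0 (symbols sg))); congr map.
by rewrite -{1}sz; apply/esym; exact: mkseq_nth.
Qed.

Lemma prints_exs v n c m u N p : eval m v = varcode u -> eval m n = N -> N <= X ->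
  prints c m (enc p) -> prints (exsC v n c) m (enc (exs u N p)).
Proof.
move=> Hv Hn HX Hc; rewrite enc_exs; apply: prints_Sq => //; split=> [|/=]; last first.
  by rewrite Hn; split.
rewrite /= Hn Hv; congr flatten; apply: eq_map => i; by rewrite muln1 /varcode addnA.
Qed.

Lemma prints_rel r v n m (R : symbol sg) u : eval m r = R -> eval m v = varcode u ->
  eval m n = arity R -> arity R <= X -> prints (relC r v n) m (enc (RelI R u)).
Proof.
move=> Hr Hv Hn HX; rewrite enc_RelI; split=> [|/=]; last first.
  by rewrite Hn; split=> //; split=> //; split=> //; split=> //; split=> //; lia.
rewrite /= Hr Hv Hn; congr [:: _, _, _ & flatten _ ++ _].
by apply: eq_map => i; rewrite muln1 /varcode !addnA.
Qed.
End Printing.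

(* Each macro only uses as loop variables cells from [L] to 49, where [L]
   grows with the nesting depth; its arguments must not depend on these. *)
Definition amongC (u st n : expr) := bigorC 40 st (EC 1) n (eqC u (EV 40)).
Definition adjC (u v : expr) :=
  orC (eqC u v) (bigorC 36 (EC 0) (EC 1) (EV rK) (letC 37 (ELd (arr 0 (EV 36)))
    (exsC (EV rP) (EV 37) (andC (relC (EV 36) (EV rP) (EV 37))
      (andC (amongC u (EV rP) (EV 37)) (amongC v (EV rP) (EV 37))))))).
Definition stepC (u st : expr) :=
  iffC (amongC u (EAdd st (EV rB)) (EV rB)) (bigorC 34 st (EC 1) (EV rB) (adjC u (EV 34))).
Definition badcellC (u st : expr) :=
  bigorC 31 st (EV rB) (EV rN) (negC (stepC u (EV 31))).
Definition matchC (u v w y : expr) :=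
  bigorC 45 (EC 0) (EC 1) (EV rS) (andC (eqC u (EAdd w (EV 45))) (eqC v (EAdd y (EV 45)))).
Definition diffC (w y n : expr) (F : expr -> cmd) :=
  exsC (EV rL) n (exsC (EV rR) n (negC (orC
    (bigorC 41 (EC 0) (EC 1) n (negC (matchC (EAdd (EV rL) (EV 41)) (EAdd (EV rR) (EV 41)) w y)))
    (iffC (F (EV rL)) (F (EV rR)))))).
Definition difftypeC (w y : expr) :=
  orC (diffC w y (EC 2) (fun v => eqC v (EAdd v (EC 1))))
    (bigorC 25 (EC 0) (EC 1) (EV rK) (letC 26 (ELd (arr 0 (EV 25)))
      (diffC w y (EV 26) (fun v => relC (EV 25) v (EV 26))))).
Definition simC (y : expr) :=
  exsC (EV rW) (EV rS) (negC (orC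
    (bigorC 23 (EV rW) (EC 1) (EV rB) (negC (eqC (EV rZ) (EV 23))))
    (orC (exC (EV rU) (badcellC (EV rU) (EV rW))) (difftypeC (EV rW) y)))).
Definition isCC (x : expr) := bigorC 21 (EV rY) (EV rS) (EV rC) (eqC x (EV 21)).
Definition V2C := bigorC 21 (EV rY) (EV rS) (EV rC) (badcellC (EV rZ) (EV 21)).
Definition V3C := exsC (EV rE) (EV rT) (negC (bigorC 21 (EV rY) (EV rS) (EV rC)
  (orC (eqC (EV rZ) (EV 21))
    (andC (simC (EV 21)) (negC (amongC (EV 21) (EV rE) (EV rT))))))).
Definition guardC (x n : expr) := bigorC 21 (EV rY) (EV rS) (EV rC) (amongC x (EV 21) n).

Section Macros.
Variables (sg : signature) (X vb np nB nR nT nC : nat).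
Local Notation k := (size (arities sg)).
Local Notation V := (varcode sg).
Local Notation S := (cellsize nB nR).
Local Notation enc := (@enc_formula sg).
Local Notation prints := (prints X).

Record env (m : nat -> nat) : Prop := Env {
  env_Z : m rZ = V vb; env_U : m rU = V (uv vb); env_P : m rP = V (pv vb);
  env_L : m rL = V (lv vb np); env_R : m rR = V (rv vb np); env_E : m rE = V (ev vb np);
  env_W : m rW = V (wv vb np nT); env_Y : m rY = V (yv vb np nB nR nT);
  env_K : m rK = k; env_B : m rB = nB; env_S : m rS = S; env_N : m rN = nR;
  env_T : m rT = nT; env_C : m rC = nC;
  env_ar : forall R : symbol sg, m (64 + (R + (R + R + (R + R)))) = arity R }.

Record bounds : Prop := Bounds {
  k_X : k <= X; B_X : nB <= X; S_X : S <= X; N_X : nR <= X; T_X : nT <= X; C_X : nC <= X;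
  two_X : 2 <= X; ar_X : forall R : symbol sg, arity R <= X }.

Hypothesis HX : bounds.

Definition pres (L : nat) (m m' : nat -> nat) := forall x, (x < L) || (50 <= x) -> m' x = m x.
Definition stable (L : nat) (m : nat -> nat) (e : expr) (c : nat) :=
  forall m', pres L m m' -> eval m' e = c.

Lemma pres_refl L m : pres L m m. Proof. by []. Qed.

Lemma pres_upd L m m' x v : L <= x < 50 -> pres L m m' -> pres L m (upd m' x v).
Proof. by move=> Hx H y Hy; rewrite updE; case: eqP => [|_]; [lia|exact: H]. Qed.

Lemma stable_EV L m r c : (r < L) || (50 <= r) -> m r = c -> stable L m (EV r) c.
Proof. by move=> Hr <- m' H /=; rewrite H. Qed.

Lemma stable_eval L m e c : stable L m e c -> eval m e = c.
Proof. by move/(_ m); apply. Qed.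

Lemma stable_pres L L' m m' e c : L <= L' -> pres L m m' -> stable L m e c -> stable L' m' e c.
Proof.
move=> HL H S m1 H1; apply: S => x Hx; rewrite H1 ?H //; lia.
Qed.

Lemma env_pres L m m' : 19 <= L -> pres L m m' -> env m -> env m'.
Proof.
move=> HL H [] *; split; try by rewrite H //; lia.
by move=> R; rewrite H //; lia.
Qed.

Lemma prints_among m u st n uu ust N : stable 40 m u (V uu) -> eval m st = V ust ->
  eval m n = N -> N <= X -> env m -> prints (amongC u st n) m (enc (among sg vb uu ust N)).
Proof.
move=> Hu Hst Hn HN He; apply: prints_bigor => //; first exact: env_Z He.
move=> i Hi; apply: prints_eq; first by apply: Hu; exact: pres_upd.
by rewrite /= updE Hst muln1 /varcode addnA.
Qed.

Lemma prints_adj m u v uu vv : stable 36 m u (V uu) -> stable 36 m v (V vv) -> env m ->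
  prints (adjC u v) m (enc (adjF sg vb uu vv)).
Proof.
move=> Hu Hv He; apply: prints_or.
  by apply: prints_eq; [exact: stable_eval Hu|exact: stable_eval Hv].
apply: prints_bigor_sym; [exact: env_Z He|exact: env_K He|exact: k_X HX|move=> R].
apply: prints_let; first exact: ltnW (two_X HX).
set m1 := upd _ _ _; have P1 : pres 36 m m1 by do 2 apply: pres_upd => //.
have He1 : env m1 by apply: env_pres P1 He.
have A1 : m1 37 = arity R by rewrite /m1 /= !updE /= env_ar.
have R1 : m1 36 = R by rewrite /m1 !updE.
have st1 e c : stable 36 m e c -> stable 40 m1 e c by exact: stable_pres.
have HP : m1 rP = V (pv vb) by exact: env_P He1.
apply: prints_exs => //; first exact: ar_X HX R.
apply: prints_and; first by apply: prints_rel => //; exact: ar_X HX R.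
by apply: prints_and; apply: prints_among => //; try exact: st1; exact: ar_X HX R.
Qed.

Lemma prints_step m u st uu ust : stable 33 m u (V uu) -> eval m st = V ust -> env m ->
  prints (stepC u st) m (enc (stepF sg vb nB uu ust)).
Proof.
move=> Hu Hst He; have HB := env_B He; apply: prints_iff.
  apply: prints_among; [exact: (stable_pres _ _ Hu)|by rewrite /= Hst HB /varcode addnA|exact: HB|exact: B_X HX|exact: He].
apply: prints_bigor; [exact: env_Z He|exact: HB|exact: B_X HX|move=> b Hb].
set m1 := upd _ _ _; have P1 : pres 33 m m1 by apply: pres_upd.
apply: prints_adj; [exact: (stable_pres _ _ Hu)| |exact: (env_pres _ P1 He)].
by apply: stable_EV; rewrite // /m1 updE Hst /= muln1 /varcode addnA.
Qed.

Lemma prints_badcell m u st uu ust : stable 31 m u (V uu) -> eval m st = V ust -> env m ->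
  prints (badcellC u st) m (enc (badcell sg vb nB nR uu ust)).
Proof.
move=> Hu Hst He.
apply: prints_bigor; [exact: env_Z He|exact: env_N He|exact: (N_X HX)|move=> j Hj].
set m1 := upd _ _ _; have P1 : pres 31 m m1 by apply: pres_upd.
apply: prints_neg; apply: prints_step; [exact: (stable_pres _ _ Hu)| |exact: (env_pres _ P1 He)].
by rewrite /= /m1 updE Hst /= (env_B He) /varcode addnA.
Qed.

Lemma prints_match m u v w y uu vv ww yy :
  stable 45 m u (V uu) -> stable 45 m v (V vv) -> stable 45 m w (V ww) -> stable 45 m y (V yy) ->
  env m -> prints (matchC u v w y) m (enc (matchF sg vb nB nR uu vv ww yy)).
Proof.
move=> Hu Hv Hw Hy He.
apply: prints_bigor; [exact: env_Z He|exact: env_S He|exact: S_X HX|move=> j Hj].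
set m1 := upd _ _ _; have P1 : pres 45 m m1 by apply: pres_upd.
have J1 : m1 45 = j by rewrite /m1 updE /= muln1.
by apply: prints_and; apply: prints_eq; rewrite /= ?J1 ?Hu ?Hv ?Hw ?Hy // /varcode addnA.
Qed.

Lemma prints_diff m w y n ww yy N FC F :
  stable 41 m w (V ww) -> stable 41 m y (V yy) -> eval m n = N -> N <= X -> env m ->
  (forall e x, eval m e = V x -> prints (FC e) m (enc (F x))) ->
  prints (diffC w y n FC) m (enc (diffF vb np nB nR ww yy N F)).
Proof.
move=> Hw Hy Hn HN He HF; have HL := env_L He; have HR := env_R He.
apply: prints_exs => //; apply: prints_exs => //; apply: prints_neg; apply: prints_or; last first.
  by apply: prints_iff; exact: HF.
apply: prints_bigor; [exact: env_Z He| exact: Hn | by rewrite // ?Hn |move=> j Hj].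
set m1 := upd _ _ _; have P1 : pres 41 m m1 by apply: pres_upd.
have J1 : m1 41 = j by rewrite /m1 updE /= muln1.
have addst r x : m r = V x -> r < 41 -> stable 45 m1 (EAdd (EV r) (EV 41)) (V (x + j)).
  move=> Hr Hr1 m2 P2 /=; rewrite !P2 ?J1 //; last lia.
  by rewrite P1 ?Hr1 // Hr /varcode addnA.
apply: prints_neg; apply: prints_match; [exact: addst HL _|exact: addst HR _|
  exact: (stable_pres _ P1 Hw)|exact: (stable_pres _ P1 Hy)|exact: (env_pres _ P1 He)].
Qed.

Lemma prints_difftype m w y ww yy : stable 25 m w (V ww) -> stable 25 m y (V yy) -> env m ->
  prints (difftypeC w y) m (enc (difftype sg vb np nB nR ww yy)).
Proof.
move=> Hw Hy He; apply: prints_or.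
  apply: prints_diff; [exact: (stable_pres _ (@pres_refl 25 m) Hw)|
    exact: (stable_pres _ (@pres_refl 25 m) Hy)|by []|exact: two_X HX|exact: He|].
  move=> e x Ex; apply: prints_eq => //=; by rewrite Ex /varcode addnA.
apply: prints_bigor_sym; [exact: env_Z He|exact: env_K He|exact: k_X HX|move=> R].
apply: prints_let; first exact: ltnW (two_X HX).
set m1 := upd _ _ _; have P1 : pres 25 m m1 by do 2 apply: pres_upd => //.
have He1 : env m1 by apply: env_pres P1 He.
have A1 : m1 26 = arity R by rewrite /m1 /= !updE /= env_ar.
have R1 : m1 25 = R by rewrite /m1 !updE.
apply: prints_diff; [exact: (stable_pres _ P1 Hw)|exact: (stable_pres _ P1 Hy)|
  exact: A1|exact: ar_X HX R|exact: He1|].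
by move=> e x Ex; apply: prints_rel => //; exact: ar_X HX R.
Qed.

Lemma prints_sim m y yy : stable 23 m y (V yy) -> env m ->
  prints (simC y) m (enc (simF sg vb np nB nR nT yy)).
Proof.
move=> Hy He; have HW := env_W He.
apply: prints_exs; [exact: HW|exact: env_S He|exact: S_X HX|].
apply: prints_neg; apply: prints_or; last apply: prints_or.
- apply: prints_bigor; [exact: env_Z He|exact: env_B He|exact: (B_X HX)|move=> b Hb].
  apply: prints_neg; apply: prints_eq; rewrite /= updE //; first exact: env_Z He.
  by rewrite /= HW muln1 /varcode addnA.
- apply: prints_ex; first exact: env_U He.
  by apply: prints_badcell => //; apply: stable_EV => //; exact: env_U He.
- by apply: prints_difftype => //; [exact: stable_EV|exact: (stable_pres _ _ Hy)].
Qed.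

Lemma prints_cells m c F : env m ->
  (forall j, j < nC -> let m1 := upd m 21 (V (center vb np nB nR nT j)) in
     prints c m1 (enc (F j))) ->
  prints (bigorC 21 (EV rY) (EV rS) (EV rC) c) m (enc (bigor vb (iota 0 nC) F)).
Proof.
move=> He H.
apply: prints_bigor; [exact: env_Z He|exact: env_C He|exact: (C_X HX)|move=> j Hj].
have := H j Hj; rewrite /= (env_Y He) (env_S He) /center /varcode !addnA; exact.
Qed.

Lemma prints_isC m x xx : stable 21 m x (V xx) -> env m ->
  prints (isCC x) m (enc (isC sg vb np nB nR nT nC xx)).
Proof.
move=> Hx He; apply: prints_cells => // j Hj.
by apply: prints_eq; rewrite /= ?updE //; apply: Hx; exact: pres_upd.
Qed.

Lemma prints_V2 m : env m -> prints V2C m (enc (V2 sg vb np nB nR nT nC)).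
Proof.
move=> He; apply: prints_cells => // j Hj.
have He1 : env (upd m 21 (V (center vb np nB nR nT j))) by apply: (env_pres (L := 21)) He => //; exact: pres_upd.
by apply: prints_badcell => //; apply: stable_EV => //; exact: env_Z He1.
Qed.

Lemma prints_V3 m : env m -> prints V3C m (enc (V3 sg vb np nB nR nT nC)).
Proof.
move=> He; apply: prints_exs; [exact: env_E He|exact: env_T He|exact: T_X HX|].
apply: prints_neg; apply: prints_cells => // j Hj; set m1 := upd _ _ _.
have He1 : env m1 by apply: (env_pres (L := 21)) He => //; exact: pres_upd.
apply: prints_or; first by apply: prints_eq => //; exact: env_Z He1.
apply: prints_and; first by apply: prints_sim => //; exact: stable_EV.
apply: prints_neg; apply: prints_among => //; [exact: stable_EV|exact: env_E He1| |exact: T_X HX].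
exact: env_T He1.
Qed.

Lemma prints_guard m x n xx l : stable 21 m x (V xx) -> stable 21 m n ((l + 1) * nB) ->
  (l + 1) * nB <= X -> env m ->
  prints (guardC x n) m (enc (guard sg vb np nB nR nT nC xx l)).
Proof.
move=> Hx Hn HN He; apply: prints_cells => // j Hj; set m1 := upd _ _ _.
have P1 : pres 21 m m1 by apply: pres_upd.
apply: prints_among => //; [exact: (stable_pres _ _ Hx)|exact: Hn|exact: (env_pres _ P1 He)].
Qed.
End Macros.

(** * Scanning the input formula *)

(* State of a left-to-right scan of a formula: the previous letter, the codes of
   the variables whose quantifiers are open, the values of this list at the
   open parentheses, and the maximal number of open quantifiers so far. *)
Record scan := Scan { sprev : nat; sbound : seq nat; sstack : seq (seq nat); smax : nat }.

Definition scan_bound (st : scan) (a : nat) : seq nat :=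
  if sprev st == 3 then a :: sbound st
  else if (a == 5) || (a == 7) then head [::] (sstack st) else sbound st.

Definition scan_stack (st : scan) (a : nat) : seq (seq nat) :=
  if sprev st == 3 then sstack st
  else if a == 6 then sbound st :: sstack st
  else if a == 7 then behead (sstack st) else sstack st.

Definition scan_step (st : scan) (a : nat) : scan :=
  Scan a (scan_bound st a) (scan_stack st a) (maxn (smax st) (size (scan_bound st a))).

Definition scan_run : scan -> seq nat -> scan := foldl scan_step.

Fixpoint emit (g : scan -> nat -> seq nat) (st : scan) (w : seq nat) : seq nat :=
  if w is a :: w' then g st a ++ emit g (scan_step st a) w' else [::].

Lemma scan_run_cat st w1 w2 : scan_run st (w1 ++ w2) = scan_run (scan_run st w1) w2.
Proof. exact: foldl_cat. Qed.

Lemma emit_cat g st w1 w2 : emit g st (w1 ++ w2) = emit g st w1 ++ emit g (scan_run st w1) w2.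
Proof. by elim: w1 st => //= a w1 IH st; rewrite IH catA. Qed.

Lemma emit_cons g st a w : emit g st (a :: w) = g st a ++ emit g (scan_step st a) w.
Proof. by []. Qed.

Lemma scan_run_cons st a w : scan_run st (a :: w) = scan_run (scan_step st a) w.
Proof. by []. Qed.

Section ScanFormula.
Variables (sg : signature) (vb np nB nR nT nC : nat) (le : nat -> nat).
Local Notation k := (size (arities sg)).
Local Notation V := (varcode sg).
Local Notation enc := (@enc_formula sg).
Local Notation guard := (guard sg vb np nB nR nT nC).
Local Notation rel := (rel_ vb np nB nR nT nC le).

Definition isfree (st : scan) (a : nat) : bool :=
  [&& sprev st != 3, 8 + k <= a & a \notin sbound st].

Definition emit_free (f : nat -> seq nat) (st : scan) (a : nat) : seq nat :=
  if isfree st a then f a else [::].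

(** A quantified variable is followed by the text [Neg (Or (Neg guard) (Neg] of the relativization.
    Its parenthesis is due where the scope ends, at the next [OrL] or unmatched [RparL]: one for
    each quantifier opened since the enclosing parenthesis. *)
Definition emit_rel (st : scan) (a : nat) : seq nat :=
  if sprev st == 3
  then [:: a; 4; 6; 4] ++ enc (guard (a - (8 + k)) (le (size (sbound st)))) ++ [:: 5; 4]
  else if (a == 5) || (a == 7)
  then rcons (nseq (size (sbound st) - size (head [::] (sstack st))) 7) a
  else [:: a].

Definition free_occ (b : seq nat) (xs : seq nat) := [seq x <- xs | V x \notin b].

Lemma V_ge x : 8 + k <= V x. Proof. exact: leq_addr. Qed.

Lemma V_K x : V x - (8 + k) = x. Proof. by rewrite /varcode addKn. Qed.

Lemma V_inj : injective V. Proof. by move=> x y; rewrite /varcode; lia. Qed.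

Lemma quiet_letter pv b K mx a : pv != 3 -> size b <= mx -> a \notin [:: 5; 6; 7] ->
  scan_step (Scan pv b K mx) a = Scan a b K mx /\ emit_rel (Scan pv b K mx) a = [:: a].
Proof.
move=> Hpv Hmx; rewrite !inE !negb_or => /and3P[/negbTE a5 /negbTE a6 /negbTE a7].
rewrite /scan_step /emit_rel /scan_bound /scan_stack /= (negbTE Hpv) a5 a6 a7 /=.
by rewrite (maxn_idPl Hmx).
Qed.

Lemma emit_free_small f pv b K mx a : a < 8 + k -> emit_free f (Scan pv b K mx) a = [::].
Proof. by move=> Ha; rewrite /emit_free /isfree /= leqNgt Ha /= andbF. Qed.

Lemma emit_free_V f pv b K mx x : pv != 3 ->
  emit_free f (Scan pv b K mx) (V x) = flatten [seq f (V y) | y <- free_occ b [:: x]].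
Proof.
by move=> Hpv; rewrite /emit_free /isfree /= Hpv V_ge /=; case: ifP => //= _; rewrite cats0.
Qed.

Lemma V_quiet x : V x \notin [:: 5; 6; 7].
Proof. by rewrite !inE /varcode -!addnA. Qed.

Lemma V_neq3 x : V x != 3.
Proof. by rewrite /varcode -!addnA. Qed.

Lemma free_occ_cons b x s : free_occ b (x :: s) = free_occ b [:: x] ++ free_occ b s.
Proof. by rewrite /free_occ /=; case: ifP. Qed.

Lemma scan_commas (s : seq nat) pv b K mx : pv != 3 -> size b <= mx ->
  let st := Scan pv b K mx in let w := map (code k) (comma_sep s) in
  [/\ exists pv', pv' != 3 /\ scan_run st w = Scan pv' b K mx,
    emit emit_rel st w = w &
    forall f, emit (emit_free f) st w = flatten [seq f (V x) | x <- free_occ b s]].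
Proof.
move=> Hpv Hmx; elim: s pv Hpv => [|x [|y s] IH] pv Hpv.
- by split=> //; exists pv.
- have [E1 E2] := quiet_letter K Hpv Hmx (V_quiet x).
  split=> [||f]; rewrite /= -?/(V x) ?E2 ?emit_free_V ?cats0 //.
  by exists (V x); split; [exact: V_neq3|exact: E1].
have [E1 E2] := quiet_letter K Hpv Hmx (V_quiet x).
have [E3 E4] := @quiet_letter (V x) b K mx 1 (V_neq3 x) Hmx isT.
have {IH} [[pv' [Hpv' E5]] E6 E7] := IH 1 isT.
have -> : map (code k) (comma_sep (x :: y :: s)) = [:: V x, 1 & map (code k) (comma_sep (y :: s))] by [].
split=> [||f].
- by exists pv'; rewrite !scan_run_cons E1 E3.
- by rewrite !emit_cons E2 E1 E4 E3 E6.
- rewrite !emit_cons E1 E3 emit_free_V // (@emit_free_small _ _ _ _ _ 1) // E7.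
  by rewrite [in RHS]free_occ_cons map_cat flatten_cat.
Qed.

(** [ext] lists the quantifiers whose scope reaches the end of [p]. The scan cannot yet know that
    they are over, so their closing parentheses are still owed, which is the [nseq (size ext) 7]. *)
Lemma scan_formula p pv b K mx : pv != 3 -> size b <= mx ->
  let st := Scan pv b K mx in
  exists ext pv', [/\ pv' != 3,
    scan_run st (enc p) = Scan pv' (ext ++ b) K (maxn mx (size b + qrank p)),
    emit emit_rel st (enc p) ++ nseq (size ext) 7 = enc (rel (size b) p) &
    forall f, emit (emit_free f) st (enc p) = flatten [seq f (V x) | x <- free_occ b (fv p)]].
Proof.
elim: p pv b K mx => [x y|R v|p IH|p IHp r IHr|x p IH] pv b K mx Hpv Hmx st.
- have [E1 E2] := quiet_letter K Hpv Hmx (V_quiet x).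
  have [E3 E4] := @quiet_letter (V x) b K mx 2 (V_neq3 x) Hmx isT.
  have [E5 E6] := @quiet_letter 2 b K mx (V y) isT Hmx (V_quiet y).
  exists [::], (V y); rewrite enc_Eq; split=> [||//|f]; first exact: V_neq3.
  + by rewrite !scan_run_cons E1 E3 E5 addn0 (maxn_idPl Hmx).
  + by rewrite !emit_cons E2 E1 E4 E3 E6.
  + rewrite !emit_cons E1 E3 emit_free_V // (@emit_free_small _ _ _ _ _ 2) // emit_free_V // cats0.
    by rewrite [fv _]/= [in RHS]free_occ_cons map_cat flatten_cat.
- have R8 : 8 + R \notin [:: 5; 6; 7] by rewrite !inE.
  have [E1 E2] := quiet_letter K Hpv Hmx R8.
  have E3 : scan_step (Scan (8 + R) b K mx) 6 = Scan 6 b (b :: K) mx.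
    by rewrite /scan_step /scan_bound /scan_stack /= (maxn_idPl Hmx).
  have E4 : emit_rel (Scan (8 + R) b K mx) 6 = [:: 6] by [].
  have [[pv' [Hpv' E5]] E6 E7] := @scan_commas v 6 b (b :: K) mx isT Hmx.
  have E8 : scan_step (Scan pv' b (b :: K) mx) 7 = Scan 7 b K mx.
    by rewrite /scan_step /scan_bound /scan_stack /= (negbTE Hpv') /= (maxn_idPl Hmx).
  have E9 : emit_rel (Scan pv' b (b :: K) mx) 7 = [:: 7].
    by rewrite /emit_rel /= (negbTE Hpv') /= subnn.
  have ER : enc (Rel R v) = [:: 8 + R, 6 & map (code k) (comma_sep v) ++ [:: 7]].
    by rewrite /enc_formula /= map_cat.
  exists [::], 7; split=> [//|||f]; rewrite ?ER.
  + by rewrite 2!scan_run_cons E1 E3 scan_run_cat E5 scan_run_cons E8 addn0 (maxn_idPl Hmx).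
  + by rewrite cats0 2!emit_cons E2 E1 E4 E3 emit_cat E5 E6 emit_cons E9.
  + rewrite 2!emit_cons E1 E3 emit_cat E5 E7 emit_cons !emit_free_small ?cats0 //.
    by rewrite ltn_add2l; exact: ltn_ord.
- have [E1 E2] := @quiet_letter pv b K mx 4 Hpv Hmx isT.
  have [ext [pv' [H1 H2 H3 H4]]] := IH 4 b K mx isT Hmx.
  exists ext, pv'; rewrite enc_Neg; split=> // [||f].
  + by rewrite scan_run_cons E1 H2.
  + by rewrite emit_cons E2 E1 -catA H3.
  + by rewrite emit_cons emit_free_small // E1 H4.
- have E1 : scan_step st 6 = Scan 6 b (b :: K) mx.
    by rewrite /scan_step /scan_bound /scan_stack /= (negbTE Hpv) /= (maxn_idPl Hmx).
  have E2 : emit_rel st 6 = [:: 6] by rewrite /emit_rel /= (negbTE Hpv).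
  have [e1 [pv1 [A1 A2 A3 A4]]] := IHp 6 b (b :: K) mx isT Hmx.
  set mx1 := maxn _ _ in A2; have Hmx1 : size b <= mx1 by rewrite leq_max Hmx.
  have E3 : scan_step (Scan pv1 (e1 ++ b) (b :: K) mx1) 5 = Scan 5 b (b :: K) mx1.
    by rewrite /scan_step /scan_bound /scan_stack /= (negbTE A1) /= (maxn_idPl Hmx1).
  have E4 : emit_rel (Scan pv1 (e1 ++ b) (b :: K) mx1) 5 = rcons (nseq (size e1) 7) 5.
    by rewrite /emit_rel /= (negbTE A1) /= size_cat addnK.
  have [e2 [pv2 [B1 B2 B3 B4]]] := IHr 5 b (b :: K) mx1 isT Hmx1.
  set mx2 := maxn _ _ in B2; have Hmx2 : size b <= mx2 by rewrite leq_max Hmx1.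
  have E5 : scan_step (Scan pv2 (e2 ++ b) (b :: K) mx2) 7 = Scan 7 b K mx2.
    by rewrite /scan_step /scan_bound /scan_stack /= (negbTE B1) /= (maxn_idPl Hmx2).
  have E6 : emit_rel (Scan pv2 (e2 ++ b) (b :: K) mx2) 7 = rcons (nseq (size e2) 7) 7.
    by rewrite /emit_rel /= (negbTE B1) /= size_cat addnK.
  exists [::], 7; rewrite enc_Or; split=> // [||f].
  + rewrite scan_run_cons E1 scan_run_cat A2 scan_run_cons E3 scan_run_cat B2 scan_run_cons E5.
    by congr Scan; rewrite /mx2 /mx1 -maxnA addn_maxr.
  + rewrite cats0 emit_cons E2 E1 emit_cat A2 emit_cons E4 E3 emit_cat B2 emit_cons E6 E5 cats0.
    by rewrite enc_Or -A3 -B3 /= cat_rcons -cats1 !catA.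
  + rewrite emit_cons emit_free_small // E1 emit_cat A2 A4 emit_cons emit_free_small // E3.
    rewrite emit_cat B2 B4 emit_cons emit_free_small // cats0.
    by rewrite /free_occ filter_cat map_cat flatten_cat.
- have [E1 E2] := @quiet_letter pv b K mx 3 Hpv Hmx isT.
  have E3 : scan_step (Scan 3 b K mx) (V x) = Scan (V x) (V x :: b) K (maxn mx (size b).+1) by [].
  have Hmx1 : size (V x :: b) <= maxn mx (size b).+1 by rewrite leq_max leqnn orbT.
  have [ext [pv' [H1 H2 H3 H4]]] := IH (V x) (V x :: b) K _ (V_neq3 x) Hmx1.
  exists (rcons ext (V x)), pv'; rewrite enc_Ex; split=> // [||f].
  + rewrite 2!scan_run_cons E1 E3 H2 cat_rcons; congr Scan.
    by rewrite /= -maxnA addSnnS; congr maxn; apply/maxn_idPr; lia.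
  + rewrite 2!emit_cons E2 E1 E3 size_rcons [rel _ _]/= enc_Ex enc_Neg enc_Or !enc_Neg -H3.
    rewrite {1}/emit_rel /= V_K -!catA /=; congr [:: _, _, _, _, _ & _ ++ [:: _, _ & _]].
    by congr (_ ++ _); elim: (size ext) => //= n ->.
  + rewrite 2!emit_cons emit_free_small // E1 {1}/emit_free /isfree /= E3 H4; congr (flatten (map _ _)).
    rewrite /free_occ [fv _]/= -filter_predI; apply: eq_filter => y /=.
    by rewrite inE negb_or (inj_eq V_inj) andbC.
Qed.
End ScanFormula.

Definition eqE (a b : expr) := ESub (EC 1) (EAdd (ESub a b) (ESub b a)).
Definition neqE (a b : expr) := ESub (EC 1) (eqE a b).

Lemma eval_eqE m a b : eval m (eqE a b) = (eval m a == eval m b) :> nat.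
Proof. by rewrite /=; case: eqP; lia. Qed.

Lemma eval_neqE m a b : eval m (neqE a b) = (eval m a != eval m b) :> nat.
Proof. by rewrite -[LHS]/(1 - eval m (eqE a b)) eval_eqE; case: eqP. Qed.

Lemma eval_arr m j i : eval m (arr j i) = 64 + j + 5 * eval m i.
Proof. by rewrite /=; lia. Qed.

Lemma eval_ELd m e : eval m (ELd e) = m (eval m e). Proof. by []. Qed.

Lemma sem_For x a d n c m o : sem (For x a d n c) (m, o) =
  let s' := foldl (fun s i => sem c (upd s.1 x (eval m a + i * eval m d), s.2))
    (m, o) (iota 0 (eval m n)) in (upd s'.1 x (m x), s'.2).
Proof. by []. Qed.

Lemma sem_If e c s : sem (If e c) s = if 0 < eval s.1 e then sem c s else s.
Proof. by []. Qed.

Lemma sem_If_eq a b c m o :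
  sem (If (eqE a b) c) (m, o) = if eval m a == eval m b then sem c (m, o) else (m, o).
Proof. by rewrite sem_If eval_eqE; case: eqP. Qed.

Lemma sem_If_neq a b c m o :
  sem (If (neqE a b) c) (m, o) = if eval m a == eval m b then (m, o) else sem c (m, o).
Proof. by rewrite sem_If eval_neqE; case: eqP. Qed.

Lemma sem_Sq c1 c2 s : sem (Sq c1 c2) s = sem c2 (sem c1 s).
Proof. by []. Qed.

Lemma sem_St a e m o : sem (St a e) (m, o) = (upd m (eval m a) (eval m e), o).
Proof. by []. Qed.

Notation sI := 50.
Notation sD := 51.
Notation sSP := 52.
Notation sL := 53.
Notation sPrev := 54.
Notation sFree := 56.
Notation sJ := 57.
Notation sMax := 59.

Definition scan_update : cmd := seqc
  (If (eqE (EV sPrev) (EC 3))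
     (Sq (St (arr 2 (EV sD)) (EV sL)) (St (EC sD) (EAdd (EV sD) (EC 1)))))
  [:: If (neqE (EV sPrev) (EC 3)) (seqc
       (If (eqE (EV sL) (EC 6))
          (Sq (St (EC sSP) (EAdd (EV sSP) (EC 1))) (St (arr 1 (EV sSP)) (EV sD))))
       [:: If (eqE (EV sL) (EC 5)) (St (EC sD) (ELd (arr 1 (EV sSP))));
           If (eqE (EV sL) (EC 7)) (Sq (St (EC sD) (ELd (arr 1 (EV sSP))))
             (St (EC sSP) (ESub (EV sSP) (EC 1))))]);
     St (EC sMax) (EAdd (EV sMax) (ESub (EV sD) (EV sMax)));
     St (EC sPrev) (EV sL)].

Definition scan_body (em : cmd) : cmd := seqc
  (St (EC sL) (ELd (arr 0 (EAdd (EV rK) (EV sI)))))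
  [:: St (EC sFree) (EC 1);
      For sJ (EC 0) (EC 1) (EV sD)
        (If (eqE (ELd (arr 2 (EV sJ))) (EV sL)) (St (EC sFree) (EC 0)));
      em; scan_update].

(** A scan writes only the scalars 19 to 63 and the arrays 1 and 2, so parameters, input and tables
    survive each pass. *)
Definition frame (m0 m : nat -> nat) : Prop :=
  forall x, (x < 19) || (64 <= x) && ((x - 64) %% 5 \notin [:: 1; 2]) -> m x = m0 x.

(** The open quantifiers are stored with the head of the list at the highest index. Saved lists are
    suffixes of the current one, so the stack keeps only lengths, and restoring a list means
    resetting a length. Cell 65, below the stack, holds 0 and thus encodes the head [[::]] of an
    empty stack. *)
Record represents_scan (m : nat -> nat) (st : scan) : Prop := RepresentsScan {
  rs_D : m sD = size (sbound st);
  rs_SP : m sSP = size (sstack st);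
  rs_prev : m sPrev = sprev st;
  rs_max : m sMax = smax st;
  rs_bound : forall i, i < size (sbound st) ->
    m (66 + 5 * (size (sbound st) - 1 - i)) = nth 0 (sbound st) i;
  rs_stack : forall i, i <= size (sstack st) ->
    m (65 + 5 * (size (sstack st) - i)) = size (nth [::] (sstack st) i);
  rs_suffix : path (fun x y => suffix y x) (sbound st) (sstack st) }.

Lemma frame_refl m : frame m m. Proof. by []. Qed.

Lemma frame_upd m0 m x v : (19 <= x < 64) || (64 <= x) && ((x - 64) %% 5 \in [:: 1; 2]) ->
  frame m0 m -> frame m0 (upd m x v).
Proof.
move=> Hx H y Hy; rewrite updE; case: eqP => [E|_]; last exact: H.
by exfalso; subst y; move: Hx Hy; rewrite !inE; lia.
Qed.

Lemma frame_arr1 i : (64 <= 65 + 5 * i) && ((65 + 5 * i - 64) %% 5 \in [:: 1; 2]).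
Proof. by rewrite (_ : _ - 64 = i * 5 + 1) ?modnMDl ?inE //; lia. Qed.

Lemma frame_arr2 i : (64 <= 66 + 5 * i) && ((66 + 5 * i - 64) %% 5 \in [:: 1; 2]).
Proof. by rewrite (_ : _ - 64 = i * 5 + 2) ?modnMDl ?inE //; lia. Qed.

Lemma foldl_iota1 (T : Type) (f : T -> nat -> T) z i : foldl f z (iota i 1) = f z i.
Proof. by []. Qed.

Lemma free_flag (m : nat -> nat) o st a : represents_scan m st -> m sL = a ->
  sem (For sJ (EC 0) (EC 1) (EV sD)
        (If (eqE (ELd (arr 2 (EV sJ))) (EV sL)) (St (EC sFree) (EC 0)))) (upd m sFree 1, o) =
  (upd m sFree (a \notin sbound st), o).
Proof.
move=> Hr Ha; set body := If _ _.
have bE m1 o1 : sem body (m1, o1) =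
    (if m1 (66 + 5 * m1 sJ) == m1 sL then upd m1 sFree 0 else m1, o1).
  by rewrite /body sem_If eval_eqE eval_ELd eval_arr /=; case: eqP.
rewrite [sem _ _]/= -/body updE /= (rs_D Hr); set n := size _.
have H i : i <= n -> exists v,
    foldl (fun s' j => sem body (upd s'.1 sJ (0 + j * 1), s'.2)) (upd m sFree 1, o) (iota 0 i) =
    (upd (upd m sFree (~~ has (fun j => nth 0 (sbound st) (n - 1 - j) == a) (iota 0 i))) sJ v, o).
  elim: i => [|i IH] Hi.
    by exists (upd m sFree 1 sJ); rewrite /= upd_id.
  have [v {}IH] := IH (ltnW Hi); rewrite -(addn1 i) iotaD foldl_cat IH has_cat.
  exists i; rewrite foldl_iota1 bE !add0n muln1 upd_upd; congr pair.
  rewrite !updE /= orbF Ha -(rs_bound Hr); last by rewrite -/n; lia.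
  rewrite -/n (_ : n - 1 - (n - 1 - i) = i); last lia.
  case: eqP => _; rewrite ?orbF ?orbT //=.
  by apply: functional_extensionality => x; rewrite !updE; do 2 case: eqP => //; lia.
have [v ->] := H n (leqnn n); rewrite /= upd_upd; congr pair.
have -> : has (fun j => nth 0 (sbound st) (n - 1 - j) == a) (iota 0 n) = (a \in sbound st).
  apply/hasP/idP => [[j]|Ha'].
    by rewrite mem_iota => Hj /eqP <-; apply: mem_nth; rewrite -/n; lia.
  exists (n - 1 - index a (sbound st)); first by rewrite mem_iota; move: Ha'; rewrite -index_mem -/n; lia.
  have : index a (sbound st) < n by rewrite index_mem.
  move=> Hi; rewrite (_ : n - 1 - _ = index a (sbound st)); last lia.
  by rewrite nth_index.
apply: functional_extensionality => x; rewrite !updE; case: eqP => // ->.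
by [].
Qed.

Lemma suffix_head (b : seq nat) (K : seq (seq nat)) : path (fun x y => suffix y x) b K -> suffix (head [::] K) b.
Proof. by case: K => [|c K] /=; [rewrite suffix0s|case/andP]. Qed.

Lemma nth_suffix (c b : seq nat) (i : nat) : suffix c b -> i < size c ->
  nth 0 c i = nth 0 b (i + (size b - size c)).
Proof.
move=> /suffixP[p ->] Hi; rewrite size_cat addnK nth_cat.
by rewrite ltnNge leq_addl /= addnK.
Qed.

Lemma update_correct m0 m o st a :
  frame m0 m -> represents_scan m st -> m sL = a ->
  exists m', [/\ sem scan_update (m, o) = (m', o), frame m0 m' &
    represents_scan m' (scan_step st a)].
Proof.
move=> Hf Hr Ha; have [rD rSP rP rM rB rK rS] := Hr.
set c1 := If (eqE (EV sPrev) (EC 3)) (Sq (St (arr 2 (EV sD)) (EV sL))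
  (St (EC sD) (EAdd (EV sD) (EC 1)))).
set c2 := If (neqE (EV sPrev) (EC 3)) (seqc
       (If (eqE (EV sL) (EC 6))
          (Sq (St (EC sSP) (EAdd (EV sSP) (EC 1))) (St (arr 1 (EV sSP)) (EV sD))))
       [:: If (eqE (EV sL) (EC 5)) (St (EC sD) (ELd (arr 1 (EV sSP))));
           If (eqE (EV sL) (EC 7)) (Sq (St (EC sD) (ELd (arr 1 (EV sSP))))
             (St (EC sSP) (ESub (EV sSP) (EC 1))))]).
suff [m2 [E2 F2 [A1 A2 A3] [A4 A5] [A6 A7 A8]]] : exists m2, [/\ sem c2 (sem c1 (m, o)) = (m2, o), frame m0 m2,
    [/\ m2 sPrev = sprev st, m2 sMax = smax st & m2 sL = a],
    m2 sD = size (scan_bound st a) /\ m2 sSP = size (scan_stack st a) &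
    [/\ forall i, i < size (scan_bound st a) ->
      m2 (66 + 5 * (size (scan_bound st a) - 1 - i)) = nth 0 (scan_bound st a) i,
     forall i, i <= size (scan_stack st a) ->
      m2 (65 + 5 * (size (scan_stack st a) - i)) = size (nth [::] (scan_stack st a) i) &
     path (fun x y => suffix y x) (scan_bound st a) (scan_stack st a)]].
  rewrite /scan_update /seqc sem_Sq -/c1 sem_Sq -/(seqc _ _) -/c2 E2 sem_Sq !sem_St.
  eexists; split; first reflexivity.
    by rewrite /= ; do 2 apply: frame_upd => //.
  split=> //=.
  by rewrite !updE /= A2 A4; lia.
rewrite /scan_bound /scan_stack; case: (eqVneq (sprev st) 3) => Hp.
  have E1 : sem c1 (m, o) = (upd (upd m (66 + 5 * size (sbound st)) a) sD (size (sbound st)).+1, o).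
    rewrite sem_If_eq ifT; last by rewrite /= rP Hp.
    rewrite sem_Sq 2!sem_St eval_arr /= Ha rD updE.
    by case: eqP => [|_]; [lia|]; rewrite rD addn1.
  exists (upd (upd m (66 + 5 * size (sbound st)) a) sD (size (sbound st)).+1).
  have E54 : (upd (upd m (66 + 5 * size (sbound st)) a) sD (size (sbound st)).+1) sPrev = 3.
    by rewrite updE /= updE rP.
  rewrite E1 sem_If_neq ifT; last by rewrite /= E54.
  split=> //.
  - by apply: frame_upd => //; apply: frame_upd => //; rewrite frame_arr2 orbT.
  split.
  - move=> [|i] Hi; rewrite !updE; (case: eqP => [|_]; first lia).
      by rewrite /= subn0 subn1 eqxx.
    case: eqP => [/= E|_]; first by move: Hi E; rewrite /=; lia.
    by rewrite /= -rB //; congr m; lia.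
  - by move=> i Hi; rewrite !updE; do 2 (case: eqP => [|_]; first lia); rewrite rK.
  - case: (sstack st) rS => //= c K /andP[/suffixP[p Ep] ->]; rewrite andbT Ep -cat_cons; exact: suffix_suffix.
have E1 : sem c1 (m, o) = (m, o).
  by rewrite sem_If_eq /= rP (negbTE Hp).
rewrite E1 sem_If_neq ifF; last by rewrite /= rP (negbTE Hp).
rewrite /seqc 2!sem_Sq.
have sK := suffix_head rS.
case: (eqVneq a 6) => a6.
  exists (upd (upd m sSP (size (sstack st)).+1) (65 + 5 * (size (sstack st)).+1) (size (sbound st))).
  have -> : sem (If (eqE (EV sL) (EC 6)) (Sq (St (EC sSP) (EAdd (EV sSP) (EC 1)))
     (St (arr 1 (EV sSP)) (EV sD)))) (m, o) =
     (upd (upd m sSP (size (sstack st)).+1) (65 + 5 * (size (sstack st)).+1) (size (sbound st)), o).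
    rewrite sem_If_eq ifT; last by rewrite /= Ha a6.
    rewrite sem_Sq 2!sem_St eval_arr /= rSP addn1 !updE /= rD.
    by congr (upd _ _ _, _); lia.
  set m2 := upd _ _ _.
  have L2 : m2 sL = a by rewrite /m2 !updE; case: eqP => [|_] //; lia.
  rewrite sem_If_eq ifF; last by rewrite /= L2 a6.
  rewrite sem_If_eq ifF; last by rewrite /= L2 a6.
  rewrite a6 /=; split=> //.
  - by apply: frame_upd; rewrite ?frame_arr1 ?orbT //; exact: frame_upd.
  - by rewrite /m2 /upd /= rP rM Ha a6.
  split; last by rewrite suffix_refl.
  - by move=> i Hi; rewrite /m2 !updE; do 2 (case: eqP => [|_]; first lia); rewrite rB.
  - move=> [|i] Hi; rewrite /m2 !updE; first by rewrite subn0 eqxx.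
    do 2 (case: eqP => [|_]; first lia); rewrite /= -rK; last lia.
    by congr m; lia.
have -> : sem (If (eqE (EV sL) (EC 6)) (Sq (St (EC sSP) (EAdd (EV sSP) (EC 1)))
     (St (arr 1 (EV sSP)) (EV sD)))) (m, o) = (m, o).
  by rewrite sem_If_eq /= Ha (negbTE a6).
have top : m (65 + 5 * size (sstack st)) = size (head [::] (sstack st)).
  by rewrite -[size (sstack st)]subn0 rK // -nth0.
(* Passing to a suffix leaves the remaining entries where they are, since indices count from the end
   of the list. *)
have bound_head m2 : (forall x, 64 <= x -> m2 x = m x) -> forall i, i < size (head [::] (sstack st)) ->
    m2 (66 + 5 * (size (head [::] (sstack st)) - 1 - i)) = nth 0 (head [::] (sstack st)) i.
  move=> H i Hi; have Hs : size (head [::] (sstack st)) <= size (sbound st) := size_suffix sK.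
  rewrite (nth_suffix sK Hi) H // -rB; last lia.
  by congr m; lia.
case: (eqVneq a 5) => a5.
  exists (upd m sD (size (head [::] (sstack st)))).
  have -> : sem (If (eqE (EV sL) (EC 5)) (St (EC sD) (ELd (arr 1 (EV sSP))))) (m, o) =
      (upd m sD (size (head [::] (sstack st))), o).
    rewrite sem_If_eq ifT; last by rewrite /= Ha a5.
    by rewrite sem_St eval_ELd eval_arr /= rSP -top.
  have -> : sem (If (eqE (EV sL) (EC 7)) (Sq (St (EC sD) (ELd (arr 1 (EV sSP))))
             (St (EC sSP) (ESub (EV sSP) (EC 1))))) (upd m sD (size (head [::] (sstack st))), o) =
      (upd m sD (size (head [::] (sstack st))), o).
    by rewrite sem_If_eq /= updE /= Ha a5.
  rewrite a5 /=; split=> //.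
  - exact: frame_upd.
  - by rewrite /upd /= rP rM Ha a5.
  split.
  - by apply: bound_head => x Hx; rewrite updE; case: eqP => //; lia.
  - by move=> i Hi; rewrite updE; case: eqP => [|_]; [lia|]; rewrite rK.
  - by case: (sstack st) rS => //= c K /andP[_ ->]; rewrite suffix_refl.
have -> : sem (If (eqE (EV sL) (EC 5)) (St (EC sD) (ELd (arr 1 (EV sSP))))) (m, o) = (m, o).
  by rewrite sem_If_eq /= Ha (negbTE a5).
case: (eqVneq a 7) => a7; last first.
  exists m; rewrite sem_If_eq ifF; last by rewrite /= Ha (negbTE a7).
  by rewrite /=; split.
exists (upd (upd m sD (size (head [::] (sstack st)))) sSP (size (sstack st) - 1)).
rewrite sem_If_eq ifT; last by rewrite /= Ha a7.
rewrite sem_Sq 2!sem_St eval_ELd eval_arr [eval _ (EC sD)]/= [eval _ (EC sSP)]/=.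
rewrite [eval m (EV sSP)]/= rSP top [eval _ (ESub _ _)]/= updE /= rSP a7 /=.
split=> //.
- by do 2 apply: frame_upd => //.
- by rewrite /upd /= rP rM Ha a7.
- by rewrite /upd /= size_behead subn1.
split.
- by apply: bound_head => x Hx; rewrite !updE; do 2 (case: eqP => [|_]; first lia).
- move=> i; rewrite size_behead => Hi; rewrite !updE; do 2 (case: eqP => [|_]; first lia).
  case: (posnP (size (sstack st))) => [/eqP/nilP E|K0].
    by have := rK 0; rewrite E /= nth_nil !muln0 => ->.
  rewrite nth_behead -rK; last lia.
  by congr m; lia.
- by case: (sstack st) rS => //= c [|c' K] //= /and3P[_ -> ->].
Qed.

Definition scan_init : scan := Scan 0 [::] [::] 0.

Definition scan_pass (em : cmd) : cmd := seqc (St (EC sD) (EC 0))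
  [:: St (EC sSP) (EC 0); St (EC sPrev) (EC 0); St (EC sMax) (EC 0);
      For sI (EC 0) (EC 1) (EV rLen) (scan_body em)].

Lemma represents_upd m st x v : x \in [:: sI; sL; sFree; sJ] ->
  represents_scan m st -> represents_scan (upd m x v) st.
Proof.
rewrite !inE => Hx [rD rSP rP rM rB rK rS].
by split=> // [||||i Hi|i Hi]; rewrite updE; (case: eqP => [E|_]; first lia); rewrite ?rB ?rK.
Qed.

Section Pass.
Variables (X : nat) (m0 : nat -> nat) (em : cmd) (g : scan -> nat -> seq nat).
Variable (P : scan -> nat -> Prop).
Hypothesis em_pure : pure em.
Hypothesis em_prints : forall m st a, frame m0 m -> represents_scan m st -> m sL = a ->
  m sFree = (a \notin sbound st) -> P st a -> prints X em m (g st a).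

Lemma body_correct m o st a i : frame m0 m -> represents_scan m st -> m sI = i ->
  m0 (64 + 5 * (m0 rK + i)) = a -> P st a -> size (sbound st) <= X ->
  exists m', [/\ sem (scan_body em) (m, o) = (m', o ++ g st a), frame m0 m',
    represents_scan m' (scan_step st a) & small X (scan_body em) (m, o)].
Proof.
move=> Hf Hr Hi Ha HP HX.
pose m1 := upd m sL a; pose m2 := upd m1 sFree 1; pose m3 := upd m1 sFree (a \notin sbound st).
have E1 : sem (St (EC sL) (ELd (arr 0 (EAdd (EV rK) (EV sI))))) (m, o) = (m1, o).
  rewrite sem_St eval_ELd eval_arr addn0 [eval m (EAdd _ _)]/= Hi (Hf rK) // Hf ?Ha //.
  by rewrite (_ : _ - 64 = (m0 rK + i) * 5) ?modnMl ?inE ?andbT //; lia.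
have r1 : represents_scan m1 st by apply: represents_upd.
have r3 : represents_scan m3 st by apply: represents_upd.
have f3 : frame m0 m3 by do 2 apply: frame_upd => //.
have L1 : m1 sL = a by rewrite /m1 updE.
have [pem sem_] : prints X em m3 (g st a) by apply: em_prints.
have [m' [E4 f4 r4]] := @update_correct m0 m3 (o ++ g st a) st a f3 r3 L1.
exists m'; split=> //.
  by rewrite /scan_body /seqc 4!sem_Sq E1 sem_St (free_flag o r1 L1) sem_pure // pem E4.
rewrite /scan_body /seqc; split=> //; rewrite E1; split=> //; rewrite sem_St; split.
  split; first by rewrite [eval _ _]/= updE /= (rs_D r1).
  by move=> j _ /=.
rewrite (free_flag o r1 L1); split; first exact: small_pure.
rewrite sem_pure //; by do !split.
Qed.

Variables (w : seq nat).
Hypothesis m0_len : m0 rLen = size w.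
Hypothesis m0_word : forall i, i < size w -> m0 (64 + 5 * (m0 rK + i)) = nth 0 w i.
Hypothesis w_X : size w <= X.
Hypothesis run_P : forall i, i < size w -> P (scan_run scan_init (take i w)) (nth 0 w i).
Hypothesis run_X : forall i, i < size w -> size (sbound (scan_run scan_init (take i w))) <= X.

Lemma pass_correct m o : frame m0 m -> m 65 = 0 ->
  exists m', [/\ sem (scan_pass em) (m, o) = (m', o ++ emit g scan_init w), frame m0 m',
    represents_scan m' (scan_run scan_init w) & small X (scan_pass em) (m, o)].
Proof.
move=> Hf H65; pose m1 := upd (upd (upd (upd m sD 0) sSP 0) sPrev 0) sMax 0.
have f1 : frame m0 m1 by do 4 apply: frame_upd => //.
have r1 : represents_scan m1 scan_init by split=> // -[].
pose F := fun (s : state) j => sem (scan_body em) (upd s.1 sI (eval m1 (EC 0) + j * eval m1 (EC 1)), s.2).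
have H i : i <= size w -> exists m', [/\ foldl F (m1, o) (iota 0 i) =
    (m', o ++ emit g scan_init (take i w)), frame m0 m' &
    represents_scan m' (scan_run scan_init (take i w))].
  elim: i => [|i IH] Hi; first by exists m1; rewrite take0 cats0.
  have [m2 [E2 f2 r2]] := IH (ltnW Hi).
  have f3 : frame m0 (upd m2 sI i) by exact: frame_upd.
  have [|||||m3 [E3 f3' r3 _]] := @body_correct (upd m2 sI i) (o ++ emit g scan_init (take i w))
      (scan_run scan_init (take i w)) (nth 0 w i) i f3 => //.
  - exact: represents_upd.
  - exact: m0_word.
  - exact: run_P.
  - exact: run_X.
  exists m3; rewrite -(addn1 i) iotaD foldl_cat E2 addn1 (take_nth 0 Hi) -cats1.
  rewrite emit_cat scan_run_cat; split=> //.
  by rewrite foldl_iota1 {1}/F [eval _ (EC 0)]/= [eval _ (EC 1)]/= !add0n muln1 E3 /= cats0 catA.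
have [m2 [E2 f2 r2]] := H _ (leqnn _); rewrite take_size in E2 r2.
have E1 : sem (For sI (EC 0) (EC 1) (EV rLen) (scan_body em)) (m1, o) =
    (upd m2 sI (m1 sI), o ++ emit g scan_init w).
  by rewrite sem_For -/F [eval _ (EV rLen)]/= f1 // m0_len E2.
exists (upd m2 sI (m1 sI)); split.
- by rewrite /scan_pass /seqc 4!sem_Sq !sem_St E1.
- exact: frame_upd.
- exact: represents_upd.
rewrite /scan_pass /seqc; do 4 (split; first by []; rewrite sem_St).
split; first by rewrite [eval _ _]/= -/m1 f1 // m0_len.
rewrite [eval _ (EV rLen)]/= -/m1 f1 // m0_len => i Hi.
have [m3 [E3 f3 r3]] := H i (ltnW Hi).
change (small X (scan_body em) (upd (foldl F (m1, o) (iota 0 i)).1 sI (eval m1 (EC 0) + i * eval m1 (EC 1)),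
  (foldl F (m1, o) (iota 0 i)).2)).
rewrite E3 [eval _ (EC 0)]/= [eval _ (EC 1)]/= add0n muln1.
have f4 : frame m0 (upd m3 sI i) by exact: frame_upd.
have [|||||m4 [_ _ _ Hs]] := @body_correct (upd m3 sI i) (o ++ emit g scan_init (take i w))
      (scan_run scan_init (take i w)) (nth 0 w i) i f4; last exact: Hs.
- exact: represents_upd.
- by rewrite updE.
- exact: m0_word.
- exact: run_P.
- exact: run_X.
Qed.
End Pass.

(** * Computing the parameters *)

Section Silent.
Variable X : nat.

Definition silent (c : cmd) (m m' : nat -> nat) : Prop :=
  forall o, sem c (m, o) = (m', o) /\ small X c (m, o).

Lemma silent_St a e m : silent (St a e) m (upd m (eval m a) (eval m e)).
Proof. by []. Qed.

Lemma silent_Sq c1 c2 m m1 m2 : silent c1 m m1 -> silent c2 m1 m2 -> silent (Sq c1 c2) m m2.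
Proof.
move=> H1 H2 o; have [E1 s1] := H1 o; have [E2 s2] := H2 o.
by rewrite sem_Sq E1 E2; split=> //; split; rewrite // E1.
Qed.

Lemma silent_For x n c m N (I : nat -> (nat -> nat) -> Prop) :
  eval m n = N -> N <= X -> I 0 m ->
  (forall i m1, i < N -> I i m1 -> exists2 m2, silent c (upd m1 x i) m2 & I i.+1 m2) ->
  exists2 m', silent (For x (EC 0) (EC 1) n c) m (upd m' x (m x)) & I N m'.
Proof.
move=> Hn HX I0 Istep.
pose F (o : seq nat) := fun (s : state) i => sem c (upd s.1 x (eval m (EC 0) + i * eval m (EC 1)), s.2).
have H i : i <= N -> exists2 m', (forall o, foldl (F o) (m, o) (iota 0 i) = (m', o)) & I i m'.
  elim: i => [|i IH] Hi; first by exists m.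
  have [m1 E1 I1] := IH (ltnW Hi); have [m2 S2 I2] := Istep i m1 Hi I1; exists m2 => // o.
  rewrite -(addn1 i) iotaD foldl_cat E1 foldl_iota1 /F [eval _ (EC 0)]/= [eval _ (EC 1)]/=.
  by rewrite !add0n muln1; case: (S2 o).
have [m' E' IN] := H N (leqnn N); exists m' => // o; split.
  by rewrite sem_For -/(F o) Hn E'.
split; first by rewrite /= Hn.
rewrite [eval _ n]/= Hn => i Hi.
have [m1 E1 I1] := H i (ltnW Hi); have [m2 S2 I2] := Istep i m1 Hi I1.
change (small X c (upd (foldl (F o) (m, o) (iota 0 i)).1 x (eval m (EC 0) + i * eval m (EC 1)),
  (foldl (F o) (m, o) (iota 0 i)).2)).
rewrite E1 [eval _ (EC 0)]/= [eval _ (EC 1)]/= add0n muln1.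
by case: (S2 o).
Qed.

Definition accC (x : nat) (n e : expr) := For 49 (EC 0) (EC 1) n (St (EC x) e).

Lemma silent_acc x n e m N : x != 49 -> eval m n = N -> N <= X ->
  silent (accC x n e) m
    (upd m x (foldl (fun v i => eval (upd (upd m x v) 49 i) e) (m x) (iota 0 N))).
Proof.
move=> Hx Hn HX; set f := (fun v i => _).
pose I i m1 := exists v, m1 = upd (upd m x (foldl f (m x) (iota 0 i))) 49 v.
have [||m' S' [v E]] := @silent_For 49 n (St (EC x) e) m N I Hn HX.
- by exists (m 49); rewrite /= !upd_id.
- move=> i m1 Hi [v ->]; exists (upd (upd m x (foldl f (m x) (iota 0 i.+1))) 49 i); last by exists i.
  rewrite upd_upd => o; split=> //; rewrite sem_St [eval _ (EC x)]/=.
  rewrite -(addn1 i) iotaD foldl_cat foldl_iota1 add0n; congr pair.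
  rewrite /upd /f; apply: functional_extensionality => y; case: eqP => // ->.
  by rewrite (negbTE Hx).
have -> : upd m x (foldl f (m x) (iota 0 N)) = upd m' 49 (m 49); last exact: S'.
rewrite E upd_upd; apply: functional_extensionality => y; rewrite /upd.
by case: (eqVneq y 49) => [->|] //; rewrite eq_sym (negbTE Hx).
Qed.

(** The loop count is the value of [b], so only this factor has to be at most [X]. *)
Definition mulC (x a b : nat) := Sq (St (EC x) (EC 0)) (accC x (EV b) (EAdd (EV x) (EV a))).

Lemma silent_mul x a b m : x != 49 -> a != 49 -> a != x -> b != x -> m b <= X ->
  silent (mulC x a b) m (upd m x (m a * m b)).
Proof.
move=> Hx Ha Hax Hbx HX; apply: silent_Sq; first exact: silent_St.
set m1 := upd _ _ _; have Hb : m1 b = m b by rewrite /m1 updE (negbTE Hbx).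
have := @silent_acc x (EV b) (EAdd (EV x) (EV a)) m1 (m b) Hx Hb HX.
rewrite /m1 upd_upd; set f := (fun v i => _).
have -> : foldl f (upd m x 0 x) (iota 0 (m b)) = m a * m b; last exact.
elim: (m b) => [|n IH]; first by rewrite muln0 /= updE eqxx.
rewrite -(addn1 n) iotaD foldl_cat IH foldl_iota1 /f /= /upd (negbTE Hx) eqxx.
by rewrite (negbTE Ha) (negbTE Hax) mulnDr muln1.
Qed.

(* Cells 20 to 49 are temporary. *)
Definition keeps (A : pred nat) (m m' : nat -> nat) :=
  forall x, ~~ A x -> ~~ (20 <= x < 50) -> m' x = m x.

Lemma keeps_trans A m1 m2 m3 : keeps A m1 m2 -> keeps A m2 m3 -> keeps A m1 m3.
Proof. by move=> H1 H2 x Ax Hx; rewrite H2 ?H1. Qed.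

Lemma keeps_upd (A : pred nat) m m' x v : A x || (20 <= x < 50) -> keeps A m m' -> keeps A m (upd m' x v).
Proof.
move=> Hx H y Ay Hy; rewrite updE; case: eqP => [E|_]; last exact: H.
by move: Hx; rewrite -E (negbTE Ay) (negbTE Hy).
Qed.

Definition sumC (x : nat) (init n : expr) (a : expr) :=
  Sq (St (EC x) init) (accC x n (EAdd (EV x) (ELd (arr 0 (EAdd a (EV 49)))))).

Lemma silent_sum x init n a m N A : x < 49 -> x < 64 -> (forall v i, eval (upd (upd m x v) 49 i) a = A) ->
  (forall v, eval (upd m x v) n = N) -> N <= X ->
  silent (sumC x init n a) m
    (upd m x (eval m init + \sum_(0 <= i < N) m (64 + 5 * (A + i)))).
Proof.
move=> Hx Hx' HA Hn HX; apply: silent_Sq; first exact: silent_St.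
rewrite [eval m (EC x)]/=; set m1 := upd _ _ _.
have Hx49 : x != 49 by rewrite neq_ltn Hx.
have := @silent_acc x n (EAdd (EV x) (ELd (arr 0 (EAdd a (EV 49))))) m1 N Hx49 (Hn _) HX.
rewrite /m1 upd_upd; set f := (fun v i => _).
have -> : foldl f (upd m x (eval m init) x) (iota 0 N) =
   eval m init + \sum_(0 <= i < N) m (64 + 5 * (A + i)); last exact.
elim: N {Hn HX} => [|n' IH]; first by rewrite big_nil addn0 /= updE eqxx.
rewrite -(addn1 n') iotaD foldl_cat IH foldl_iota1 addn1 big_nat_recr //= addnA.
rewrite /f upd_upd; set v := _ + \sum_(_ <= _ < _) _; set M := upd (upd m x v) 49 _.
have Mx : M x = v by rewrite /M updE (negbTE Hx49) updE eqxx.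
have Mm y : 64 <= y -> M y = m y.
  by move=> Hy; rewrite /M !updE; do 2 (case: eqP => [|_]; first lia).
rewrite -[LHS]/(M x + M (eval M (arr 0 (EAdd a (EV 49))))) eval_arr.
by rewrite -[eval M (EAdd _ _)]/(eval M a + M 49) /M HA -/M Mx Mm ?addn0 //.
Qed.
End Silent.

Definition npC := Sq (sumC 23 (EC 0) (EV rK) (EC 0)) (St (EC rX) (EAdd (EV 23) (EC 2))).
(** The sum of all letter codes exceeds every variable and is simpler to compute than a maximum;
    starting from [8 + k] turns it into the code of [vb]. *)
Definition baseC := sumC rZ (EAdd (EC 8) (EV rK)) (EV rLen) (EV rK).
Definition radC := seqc (St (arr 3 (EC 0)) (EC 0))
  [:: For 48 (EC 0) (EC 1) (EV rQ) (St (arr 3 (EAdd (EV 48) (EC 1)))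
        (EAdd (ELd (arr 3 (EV 48))) (EAdd (ELd (arr 3 (EV 48)))
          (EAdd (ELd (arr 3 (EV 48))) (EC 1)))));
      St (EC rN) (ELd (arr 3 (EV rQ)))].
Definition nuC := seqc (St (EC rB) (EC 1)) [:: St (EC 21) (EV rD); St (EC 24) (ESub (EV rD) (EC 1));
  For 48 (EC 0) (EC 1) (EV rN) (seqc (St (EC rB) (EAdd (EV rB) (EV 21)))
    [:: mulC 22 21 24; St (EC 21) (EV 22)])].
Definition cellC := Sq (St (EC 20) (EAdd (EV rN) (EC 1))) (mulC rS 20 rB).
Definition guardtableC := For 48 (EC 0) (EC 1) (EV rQ) (seqc
  (St (EC 20) (EAdd (ESub (EV rN) (ELd (arr 3 (ESub (EV rQ) (EAdd (EV 48) (EC 1)))))) (EC 1)))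
  [:: mulC 21 20 rB; St (arr 4 (EV 48)) (EV 21)]).
(** [np] multiplications by [S + 1] give the exponent, and that many doublings the power of 2; no
    loop here runs through the cells themselves. *)
Definition cellsC := seqc (St (EC 20) (EAdd (EV rS) (EC 1)))
  [:: St (EC 21) (EC 1); For 48 (EC 0) (EC 1) (EV rX) (Sq (mulC 22 21 20) (St (EC 21) (EV 22)));
      St (EC rC) (EC 1); accC rC (EV 21) (EAdd (EV rC) (EV rC));
      St (EC 20) (EAdd (EV rT) (EC 1)); mulC 22 rC 20; St (EC rC) (EAdd (EV 22) (EV rLen))].
Definition layoutC := seqc (St (EC rU) (EAdd (EV rZ) (EC 1)))
  [:: St (EC rP) (EAdd (EV rZ) (EC 2)); St (EC rL) (EAdd (EV rP) (EV rX));
      St (EC rR) (EAdd (EV rL) (EV rX)); St (EC rE) (EAdd (EV rR) (EV rX));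
      St (EC rW) (EAdd (EV rE) (EV rT)); St (EC rY) (EAdd (EV rW) (EV rS))].

Lemma upd_neq (T : Type) (m : nat -> T) x v y : y != x -> upd m x v y = m y.
Proof. by rewrite /upd => /negbTE ->. Qed.

Section Chunks.
Variable X : nat.
Local Notation silent := (silent X).

Definition in_arr (j : nat) : pred nat := fun x => (64 <= x) && ((x - 64) %% 5 == j).

Lemma in_arrE j i : j < 5 -> in_arr j (64 + j + 5 * i).
Proof.
move=> Hj; rewrite /in_arr (_ : 64 + j + 5 * i - 64 = i * 5 + j); last lia.
by rewrite modnMDl modn_small // eqxx andbT; lia.
Qed.

Lemma npC_correct m N : m rK = N -> N <= X ->
  exists m', [/\ silent npC m m', keeps (pred1 rX) m m' &
    m' rX = \sum_(0 <= i < N) m (64 + 5 * i) + 2].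
Proof.
move=> HN HX; eexists; split.
- apply: silent_Sq; last exact: silent_St.
  by apply: (@silent_sum X _ _ _ _ _ _ 0) => [||v|v|]; [by []|by []|by []|exact: HN|exact: HX].
- by apply: keeps_upd => //; apply: keeps_upd.
- by [].
Qed.

Lemma baseC_correct m N : m rLen = N -> N <= X ->
  exists m', [/\ silent baseC m m', keeps (pred1 rZ) m m' &
    m' rZ = 8 + m rK + \sum_(0 <= i < N) m (64 + 5 * (m rK + i))].
Proof.
move=> HN HX; eexists; split.
- by apply: (@silent_sum X _ _ _ _ _ _ (m rK)) => [||v|v|]; [by []|by []|by []|exact: HN|exact: HX].
- by apply: keeps_upd.
- by [].
Qed.

Lemma radC_correct m q : m rQ = q -> q <= X ->
  exists m', [/\ silent radC m m', keeps (fun x => (x == rN) || in_arr 3 x) m m',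
    m' rN = rad q & forall i, i <= q -> m' (67 + 5 * i) = rad i].
Proof.
move=> Hq HX; set A := (fun x => (x == rN) || in_arr 3 x).
have Aarr i : A (67 + 5 * i) by apply/orP; right; exact: in_arrE.
pose m1 := upd m 67 0.
have S1 : silent (St (arr 3 (EC 0)) (EC 0)) m m1 by [].
pose I i m2 := keeps A m m2 /\ forall j, j <= i -> m2 (67 + 5 * j) = rad j.
have [|||m2 S2 [K2 H2]] := @silent_For X 48 (EV rQ) (St (arr 3 (EAdd (EV 48) (EC 1)))
        (EAdd (ELd (arr 3 (EV 48))) (EAdd (ELd (arr 3 (EV 48)))
          (EAdd (ELd (arr 3 (EV 48))) (EC 1))))) m1 q I _ HX.
- by rewrite /m1 /= updE.
- split; first by apply: keeps_upd => //; exact: (Aarr 0).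
  by case=> // _; rewrite /m1 updE.
- move=> i m2 Hi [K2 H2]; eexists; first exact: silent_St.
  rewrite eval_arr; set e := eval _ (EAdd (ELd _) _).
  have Ee : e = rad i.+1.
    rewrite /e -[eval _ _]/(eval (upd m2 48 i) (ELd (arr 3 (EV 48))) + (eval (upd m2 48 i) (ELd (arr 3 (EV 48))) +
      (eval (upd m2 48 i) (ELd (arr 3 (EV 48))) + 1))).
    have -> : eval (upd m2 48 i) (ELd (arr 3 (EV 48))) = rad i.
      set M := upd m2 48 i; have M48 : M 48 = i by rewrite /M updE eqxx.
      by rewrite eval_ELd eval_arr -[eval M (EV 48)]/(M 48) M48 /M upd_neq ?H2 //; lia.
    by rewrite radS; lia.
  split.
    apply: keeps_upd; last by apply: keeps_upd; rewrite ?orbT.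
    by rewrite -addnA (Aarr (_ : nat)).
  move=> j Hj; rewrite updE [eval _ (EAdd _ _)]/= updE /= addn1.
  case: eqP => [E|nE]; first by have -> : j = i.+1 by lia.
  by rewrite upd_neq ?H2 //; lia.
exists (upd (upd m2 48 (m1 48)) rN (rad q)); split.
- apply: silent_Sq; first exact: S1.
  apply: silent_Sq; first exact: S2.
  have -> : rad q = eval (upd m2 48 (m1 48)) (ELd (arr 3 (EV rQ))); last exact: silent_St.
  have Q2 : m2 rQ = q by rewrite K2.
  by rewrite eval_ELd eval_arr -[eval _ (EV rQ)]/(m2 rQ) Q2 upd_neq ?H2.
- by do 2 apply: keeps_upd => //.
- by [].
- by move=> i Hi; rewrite !updE; do 2 (case: eqP => [|_]; first lia); rewrite H2.
Qed.

Lemma nuC_correct m d r : m rD = d -> m rN = r -> r <= X -> d <= X ->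
  exists m', [/\ silent nuC m m', keeps (pred1 rB) m m' & m' rB = nu d r].
Proof.
move=> Hd Hr HX HdX.
pose m1 := upd (upd (upd m rB 1) 21 d) 24 (d - 1).
pose I i m2 := [/\ keeps (pred1 rB) m m2, m2 rB = nu d i, m2 21 = d * (d - 1) ^ i & m2 24 = d - 1].
have [|||m2 S2 [K2 H2 _ _]] := @silent_For X 48 (EV rN) (seqc (St (EC rB) (EAdd (EV rB) (EV 21)))
    [:: mulC 22 21 24; St (EC 21) (EV 22)]) m1 r I _ HX.
- exact: Hr.
- split; [by do 3 apply: keeps_upd => //|by rewrite /nu big_nil muln0|by rewrite muln1|by []].
- move=> i m2 Hi [K2 B2 D2 E2]; eexists.
    apply: silent_Sq; first exact: silent_St.
    apply: silent_Sq; first by apply: silent_mul => //; rewrite /upd /= E2; lia.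
    exact: silent_St.
  split.
  + by do 4 apply: keeps_upd => //.
  + by rewrite /upd /= B2 D2 /nu big_nat_recr //= mulnDr addnA.
  + by rewrite /upd /= D2 E2 expnSr mulnA.
  + by rewrite /upd /= E2.
exists (upd m2 48 (m1 48)); split.
- apply: silent_Sq; first exact: silent_St.
  apply: silent_Sq; first exact: silent_St.
  apply: silent_Sq; first exact: silent_St.
  have -> : upd (upd (upd m (eval m (EC rB)) (eval m (EC 1))) 21 (eval (upd m (eval m (EC rB)) (eval m (EC 1))) (EV rD)))
     24 (eval (upd (upd m (eval m (EC rB)) (eval m (EC 1))) 21 (eval (upd m (eval m (EC rB)) (eval m (EC 1))) (EV rD))) (ESub (EV rD) (EC 1))) = m1.
    by rewrite /m1 -Hd.
  exact: S2.
- exact: keeps_upd.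
- by rewrite updE.
Qed.

Lemma cellC_correct m : m rB <= X ->
  exists m', [/\ silent cellC m m', keeps (pred1 rS) m m' & m' rS = (m rN + 1) * m rB].
Proof.
move=> HX; eexists; split.
- apply: silent_Sq; first exact: silent_St.
  exact: silent_mul.
- by do 2 apply: keeps_upd => //.
- by rewrite /upd.
Qed.

Lemma guardtableC_correct m q r : m rQ = q -> m rN = r -> q <= X -> m rB <= X ->
  (forall i, i <= q -> m (67 + 5 * i) = rad i) ->
  exists m', [/\ silent guardtableC m m', keeps (in_arr 4) m m' &
    forall i, i < q -> m' (68 + 5 * i) = (r - rad (q - i.+1) + 1) * m rB].
Proof.
move=> Hq Hr HX HB Hrad.
pose I i m2 := keeps (in_arr 4) m m2 /\
  forall j, j < i -> m2 (68 + 5 * j) = (r - rad (q - j.+1) + 1) * m rB.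
have [||m2 S2 [K2 H2]] := @silent_For X 48 (EV rQ) (seqc
  (St (EC 20) (EAdd (ESub (EV rN) (ELd (arr 3 (ESub (EV rQ) (EAdd (EV 48) (EC 1)))))) (EC 1)))
  [:: mulC 21 20 rB; St (arr 4 (EV 48)) (EV 21)]) m q I Hq HX.
- by split.
- move=> i m2 Hi [K2 H2].
  pose m3 := upd m2 48 i; pose v := r - rad (q - i.+1) + 1.
  have Ev : eval m3 (EAdd (ESub (EV rN) (ELd (arr 3 (ESub (EV rQ) (EAdd (EV 48) (EC 1)))))) (EC 1)) = v.
    rewrite -[eval _ _]/(m3 rN - eval m3 (ELd (arr 3 (ESub (EV rQ) (EAdd (EV 48) (EC 1))))) + 1).
    rewrite eval_ELd eval_arr -[eval m3 (ESub _ _)]/(m3 rQ - (m3 48 + 1)).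
    have -> : m3 rQ = q by rewrite /m3 /upd /= K2.
    have -> : m3 48 = i by rewrite /m3 /upd.
    have -> : m3 rN = r by rewrite /m3 /upd /= K2.
    rewrite /m3 upd_neq; last lia.
    rewrite K2 ?Hrad ?addn1 //; try lia.
    by rewrite /in_arr negb_and; apply/orP; right; rewrite (_ : _ - 64 = (q - i.+1) * 5 + 3) ?modnMDl //; lia.
  exists (upd (upd (upd m3 20 v) 21 (v * m rB)) (68 + 5 * i) (v * m rB)).
    apply: (silent_Sq (m1 := upd m3 20 v)); first by rewrite -Ev; exact: silent_St.
    have HB3 : (upd m3 20 v) rB = m rB by rewrite /m3 /upd /= K2.
    apply: (silent_Sq (m1 := upd (upd m3 20 v) 21 (v * m rB))).
      have := @silent_mul X 21 20 rB (upd m3 20 v); rewrite HB3 [upd m3 20 v 20]updE eqxx; exact.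
    move=> o; split=> //; rewrite sem_St eval_arr; congr (upd _ _ _, _).
  split.
  + apply: keeps_upd; first by rewrite (@in_arrE 4).
    by do 3 apply: keeps_upd => //.
  + move=> j Hj; rewrite updE; case: eqP => [E|nE]; first by have -> : j = i by lia.
    by rewrite /m3 !upd_neq ?H2 //; lia.
exists (upd m2 48 (m 48)); split=> //; exact: keeps_upd.
Qed.

Lemma cellsC_correct m np : m rX = np -> np <= X -> m rS < X -> (m rS + 1) ^ np <= X -> m rT < X ->
  exists m', [/\ silent cellsC m m', keeps (pred1 rC) m m' &
    m' rC = 2 ^ ((m rS + 1) ^ np) * (m rT).+1 + m rLen].
Proof.
move=> Hnp HX HS HpX HT.
pose m1 := upd (upd m 20 (m rS + 1)) 21 1.
pose I i m2 := [/\ keeps (pred1 rC) m m2, m2 21 = (m rS + 1) ^ i & m2 20 = m rS + 1].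
have [|||m2 S2 [K2 H2 _]] := @silent_For X 48 (EV rX) (Sq (mulC 22 21 20) (St (EC 21) (EV 22))) m1 np I _ HX.
- exact: Hnp.
- by split; do 2 ?apply: keeps_upd.
- move=> i m2 Hi [K2 A2 B2]; eexists.
    apply: silent_Sq; last exact: silent_St.
    by apply: silent_mul => //; rewrite /upd /= B2; lia.
  split.
  + by do 3 apply: keeps_upd => //.
  + by rewrite /upd /= A2 B2 expnSr.
  + by rewrite /upd /= B2.
set e := (m rS + 1) ^ np in H2 HpX.
pose m3 := upd (upd m2 48 (m1 48)) rC 1.
have M3 : m3 21 = e by rewrite /m3 /upd.
have := @silent_acc X rC (EV 21) (EAdd (EV rC) (EV rC)) m3 e isT M3 HpX.
set f := (fun v i => _).
have -> : foldl f (m3 rC) (iota 0 e) = 2 ^ e.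
  elim: (e) => [|n IH]; first by [].
  by rewrite -(addn1 n) iotaD foldl_cat IH foldl_iota1 /f /= /upd /= addnn -muln2 addn1 expnSr.
move=> S3; pose m4 := upd (upd m3 rC (2 ^ e)) 20 (m rT).+1.
have K4 : keeps (pred1 rC) m m4 by do 4 apply: keeps_upd => //.
exists (upd (upd m4 22 (2 ^ e * (m rT).+1)) rC (2 ^ e * (m rT).+1 + m rLen)); split.
- apply: silent_Sq; first exact: silent_St.
  apply: silent_Sq; first exact: silent_St.
  apply: silent_Sq; first exact: S2.
  apply: silent_Sq; first exact: silent_St.
  apply: silent_Sq; first exact: S3.
  apply: (silent_Sq (m1 := m4)).
    have -> : m4 = upd (upd m3 rC (2 ^ e)) 20 (eval (upd m3 rC (2 ^ e)) (EAdd (EV rT) (EC 1))).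
      by rewrite /m4 /= /m3 /upd /= K2 // addn1.
    exact: silent_St.
  apply: (silent_Sq (m1 := upd m4 22 (2 ^ e * (m rT).+1))).
    by have := @silent_mul X 22 rC 20 m4; rewrite /m4 /upd /=; apply.
  have -> : 2 ^ e * (m rT).+1 + m rLen = eval (upd m4 22 (2 ^ e * (m rT).+1)) (EAdd (EV 22) (EV rLen)).
    by rewrite /= {2}/upd /= K4 // /upd.
  exact: silent_St.
- by do 2 apply: keeps_upd => //.
- by [].
Qed.
End Chunks.

(** * The printing program and its correctness *)

Definition numC := seqc npC [:: baseC; radC; nuC; cellC; guardtableC; mulC rT rLen rB; cellsC;
  layoutC; mulC rX rC rS].

(** The second test is positive exactly if the code is at least [8 + k], that is, for variables; the
    first excludes the variable of a quantifier. *)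
Definition freeC (c : cmd) := If (neqE (EV sPrev) (EC 3))
  (If (ESub (EAdd (EV sL) (EC 1)) (EAdd (EC 8) (EV rK))) (If (EV sFree) c)).

Definition noneC := If (EC 0) (Pr (EC 0)).
Definition openC := freeC (seqc (Pr (EC 6)) [:: negC (isCC (EV sL)); Pr (EC 5)]).
(** [V1] has one disjunct for each free occurrence, so another pass prints the matching number of
    parentheses. *)
Definition closeC := freeC (Pr (EC 7)).
Definition relativizeC := Sq
  (If (eqE (EV sPrev) (EC 3)) (seqc (Pr (EV sL))
    [:: Pr (EC 4); Pr (EC 6); Pr (EC 4); guardC (EV sL) (ELd (arr 4 (EV sD))); Pr (EC 5); Pr (EC 4)]))
  (If (neqE (EV sPrev) (EC 3)) (Sq
    (If (EAdd (eqE (EV sL) (EC 5)) (eqE (EV sL) (EC 7)))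
      (For 21 (EC 0) (EC 0) (ESub (EV sD) (ELd (arr 1 (EV sSP)))) (Pr (EC 7))))
    (Pr (EV sL)))).

(* The first pass prints nothing: it only computes the quantifier rank. *)
Definition mainC := seqc (scan_pass noneC)
  [:: St (EC rQ) (EV sMax); numC;
      For 20 (EV rY) (EC 1) (EV rX) (Sq (Pr (EC 3)) (Pr (EV 20)));
      seqc (Pr (EC 4)) [:: Pr (EC 3); Pr (EV rZ); Pr (EC 4); Pr (EC 4); Pr (EC 6)];
      scan_pass openC;
      negC (eqC (EV rZ) (EV rZ));
      scan_pass closeC;
      seqc (Pr (EC 5)) [:: Pr (EC 6); V2C; Pr (EC 5); Pr (EC 6); V3C; Pr (EC 5); Pr (EC 4)];
      scan_pass relativizeC;
      For 21 (EC 0) (EC 0) (EV sD) (Pr (EC 7));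
      seqc (Pr (EC 7)) [:: Pr (EC 7); Pr (EC 7)]].

Section Numbers.
Variables (X : nat) (sg : signature) (d len q : nat) (ws : seq nat).
Local Notation k := (size (arities sg)).
Definition npV := sig_size sg + 2.
Definition nBV := nu d (rad q).
Definition nTV := len * nBV.
(* The first factor bounds the number of types of cells. *)
Definition nCV := 2 ^ ((cellsize nBV (rad q) + 1) ^ npV) * nTV.+1 + len.
Local Notation S := (cellsize nBV (rad q)).

Record number_bounds : Prop := NumberBounds {
  nb_k : k <= X; nb_len : len <= X; nb_q : q <= X; nb_rad : rad q <= X; nb_d : d <= X;
  nb_B : nBV <= X; nb_S : S < X; nb_np : npV <= X; nb_e : (S + 1) ^ npV <= X; nb_T : nTV < X;
  nb_C : nCV * S <= X }.

Hypothesis HX : number_bounds.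

Definition num_targets : pred nat := fun x =>
  [|| 2 <= x <= 9, 11 <= x <= 15, x == 18, in_arr 3 x | in_arr 4 x].

Lemma keeps_sub (A A' : pred nat) m m' : (forall x, A x -> A' x) -> keeps A m m' -> keeps A' m m'.
Proof. by move=> H K x Hx; apply: K; apply: contra Hx; exact: H. Qed.

Lemma numC_correct m :
  m rD = d -> m rK = k -> m rLen = len -> m rQ = q ->
  (forall i, i < k -> m (64 + 5 * i) = nth 0 (arities sg) i) ->
  (forall i, i < len -> m (64 + 5 * (k + i)) = nth 0 ws i) -> size ws = len ->
  exists m', [/\ silent X numC m m', keeps num_targets m m',
    env sg (sumn ws) npV nBV (rad q) nTV nCV m', m' rX = nCV * S &
    forall i, i < q -> m' (68 + 5 * i) = (lev q i + 1) * nBV].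
Proof.
move=> Hd Hk Hlen Hq Har Hws Hsz.
have sumE (s : seq nat) (f : nat -> nat) : (forall i, i < size s -> f i = nth 0 s i) ->
    \sum_(0 <= i < size s) f i = sumn s.
  move=> H; rewrite sumnE [RHS](big_nth 0); apply: eq_big_nat => i /andP[_]; exact: H.
have arr_neq i : ~~ in_arr 3 (64 + 5 * i) /\ ~~ in_arr 4 (64 + 5 * i).
  by rewrite /in_arr (_ : 64 + 5 * i - 64 = i * 5) ?modnMl ?andbF //; lia.
have [m1 [S1 K1 X1]] := npC_correct Hk (nb_k HX).
rewrite (sumE _ (fun i => m (64 + 5 * i)) Har) -/(sig_size sg) -/npV in X1.
have L1 : m1 rLen = len by rewrite K1.
have [m2 [S2 K2 Z2]] := baseC_correct L1 (nb_len HX).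
have Q2 : m2 rQ = q by rewrite K2 ?K1.
have [m3 [S3 K3 N3 T3]] := radC_correct Q2 (nb_q HX).
have D3 : m3 rD = d by rewrite K3 ?K2 ?K1.
have [m4 [S4 K4 B4]] := nuC_correct D3 N3 (nb_rad HX) (nb_d HX).
rewrite -/nBV in B4.
have B4X : m4 rB <= X by rewrite B4 (nb_B HX).
have [m5 [S5 K5 S5E]] := cellC_correct B4X.
have N4 : m4 rN = rad q by rewrite K4.
rewrite N4 B4 -/S in S5E.
have Q5 : m5 rQ = q by rewrite K5 ?K4 ?K3.
have N5 : m5 rN = rad q by rewrite K5.
have B5 : m5 rB = nBV by rewrite K5.
have B5X : m5 rB <= X by rewrite B5 (nb_B HX).
have T5 i : i <= q -> m5 (67 + 5 * i) = rad i by move=> Hi; rewrite K5 ?K4 ?T3 //=; lia.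
have [m6 [S6 K6 G6]] := guardtableC_correct Q5 N5 (nb_q HX) B5X T5.
pose m7 := upd m6 rT nTV.
have S7 : silent X (mulC rT rLen rB) m6 m7.
  have L6 : m6 rLen = len by rewrite K6 ?K5 ?K4 ?K3 ?K2.
  have B6 : m6 rB = nBV by rewrite K6.
  by have := @silent_mul X rT rLen rB m6 isT isT isT isT; rewrite L6 B6; apply; exact: nb_B HX.
have X7 : m7 rX = npV by rewrite /m7 /upd /= K6 ?K5 ?K4 ?K3 ?K2.
have E7 : m7 rS = S by rewrite /m7 /upd /= K6.
have T7 : m7 rT = nTV by [].
have [|||m8 [S8 K8 C8]] := @cellsC_correct X m7 npV X7 (nb_np HX).
- by rewrite E7 (nb_S HX).
- by rewrite E7 (nb_e HX).
- by rewrite T7 (nb_T HX).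
have L7 : m7 rLen = len by rewrite /m7 /upd /= K6 ?K5 ?K4 ?K3 ?K2.
rewrite E7 T7 L7 -/nCV in C8.
have X8 : m8 rX = npV by rewrite K8.
have E8 : m8 rS = S by rewrite K8.
have T8 : m8 rT = nTV by rewrite K8.
have Z8 : m8 rZ = 8 + k + sumn ws.
  rewrite K8 // /m7 /upd /= K6 // K5 // K4 // K3 // Z2 K1 // Hk; congr (_ + _).
  rewrite -(sumE ws (fun i => m1 (64 + 5 * (k + i)))) ?Hsz // => i Hi.
  by rewrite K1 ?Hws //=; lia.
have [m9 [S9 K9 [U9 P9 L9 R9] [E9 W9 Y9]]] : exists m9, [/\ silent X layoutC m8 m9,
    keeps (fun x => 3 <= x <= 9) m8 m9,
    [/\ m9 rU = m8 rZ + 1, m9 rP = m8 rZ + 2, m9 rL = m8 rZ + 2 + m8 rX &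
        m9 rR = m8 rZ + 2 + m8 rX + m8 rX] &
    [/\ m9 rE = m8 rZ + 2 + m8 rX + m8 rX + m8 rX,
        m9 rW = m8 rZ + 2 + m8 rX + m8 rX + m8 rX + m8 rT &
        m9 rY = m8 rZ + 2 + m8 rX + m8 rX + m8 rX + m8 rT + m8 rS]].
  eexists; split.
  - by do 6 (apply: silent_Sq; first exact: silent_St); exact: silent_St.
  - by do 7 (apply: keeps_upd; first by []).
  - by split.
  - by split.
(* [rX] held [npV] for the layout; it is reused for the total number of cell variables. *)
pose m10 := upd m9 rX (nCV * S).
have S10 : silent X (mulC rX rC rS) m9 m10.
  have C9 : m9 rC = nCV by rewrite K9.
  have S9' : m9 rS = S by rewrite K9.
  have := @silent_mul X rX rC rS m9 isT isT isT isT; rewrite C9 S9'; apply.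
  exact: ltnW (nb_S HX).
exists m10; split.
- rewrite /numC /seqc; apply: silent_Sq S1 _; apply: silent_Sq S2 _; apply: silent_Sq S3 _.
  apply: silent_Sq S4 _; apply: silent_Sq S5 _; apply: silent_Sq S6 _; apply: silent_Sq S7 _.
  by apply: silent_Sq S8 _; apply: silent_Sq S9 _.
- have tsub (A : pred nat) m1' m2' : (forall x, A x -> num_targets x) -> keeps A m1' m2' ->
     keeps num_targets m1' m2' by exact: keeps_sub.
  have one y (m1' m2' : nat -> nat) : num_targets y -> keeps (pred1 y) m1' m2' -> keeps num_targets m1' m2'.
    by move=> Hy; apply: tsub => x /eqP ->.
  apply: (keeps_trans (one rX _ _ isT K1)); apply: (keeps_trans (one rZ _ _ isT K2)).
  apply: (keeps_trans (tsub _ _ _ _ K3)).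
    by move=> x /orP[/eqP ->|] //; rewrite /num_targets => ->; rewrite !orbT.
  apply: (keeps_trans (one rB _ _ isT K4)); apply: (keeps_trans (one rS _ _ isT K5)).
  apply: (keeps_trans (tsub _ _ _ _ K6)); first by move=> x; rewrite /num_targets => ->; rewrite !orbT.
  have K7 : keeps num_targets m6 m7 by apply: keeps_upd.
  apply: (keeps_trans K7).
  apply: (keeps_trans (one rC _ _ isT K8)).
  apply: keeps_upd => //; apply: tsub K9 => x Hx; rewrite /num_targets; lia.
- have m10E x : x != rX -> m10 x = m9 x by move=> Hx; rewrite /m10 upd_neq.
  rewrite X8 T8 E8 Z8 in U9 P9 L9 R9 E9 W9 Y9.
  split; rewrite ?m10E //.
  + by rewrite K9.
  + by rewrite U9 /varcode /uv addnA.
  + by rewrite P9 /varcode /pv addnA.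
  + by rewrite L9 /varcode /lv /pv !addnA.
  + by rewrite R9 /varcode /rv /lv /pv !addnA.
  + by rewrite E9 /varcode /ev /rv /lv /pv !addnA.
  + by rewrite W9 /varcode /wv /ev /rv /lv /pv !addnA.
  + by rewrite Y9 /varcode /yv /wv /ev /rv /lv /pv !addnA.
  + by rewrite K9 ?K8 // /m7 /upd /= K6 ?K5 ?K4 ?K3 ?K2 ?K1.
  + by rewrite K9 ?K8 // /m7 /upd /= K6.
  + by rewrite K9.
  + by rewrite K9 ?K8 // /m7 /upd /= K6.
  + by rewrite K9.
  + by rewrite K9.
  + move=> R; have [a3 a4] := arr_neq R.
    rewrite (_ : 64 + (R + (R + R + (R + R))) = 64 + 5 * R); last lia.
    rewrite m10E; last lia.
    rewrite K9 ?K8 /= ?/m7 ?upd_neq; try lia.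
    rewrite K6 // ?K5 ?K4 ?K3 ?K2 ?K1 ?Har //=; try lia.
- by [].
- move=> i Hi; have a4 : 68 + 5 * i != rX by lia.
  rewrite /m10 upd_neq // K9 ?K8 /= ?/m7 ?upd_neq; try lia.
  by rewrite G6 // B5.
Qed.
End Numbers.

Definition outputs (X : nat) (c : cmd) (m : nat -> nat) (w : seq nat)
    (Q : (nat -> nat) -> Prop) : Prop :=
  forall o, exists m', [/\ sem c (m, o) = (m', o ++ w), Q m' & small X c (m, o)].

Lemma outputs_Sq X c1 c2 m w1 w2 Q1 Q2 :
  outputs X c1 m w1 Q1 -> (forall m1, Q1 m1 -> outputs X c2 m1 w2 Q2) ->
  outputs X (Sq c1 c2) m (w1 ++ w2) Q2.
Proof.
move=> H1 H2 o; have [m1 [E1 q1 s1]] := H1 o; have [m2 [E2 q2 s2]] := H2 m1 q1 (o ++ w1).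
by exists m2; rewrite sem_Sq E1 E2 catA; split=> //; split; rewrite // E1.
Qed.

Lemma outputs_silent X c m m' : silent X c m m' -> outputs X c m [::] (eq m').
Proof. by move=> H o; exists m'; rewrite cats0; have [E s] := H o. Qed.

Lemma outputs_pure X c m w : pure c -> prints X c m w -> outputs X c m w (eq m).
Proof. by move=> Hc [E s] o; exists m; rewrite sem_pure // E; split=> //; exact: small_pure. Qed.

Lemma prints_If X e c m w :
  (0 < eval m e -> prints X c m w) -> (eval m e = 0 -> w = [::]) -> prints X (If e c) m w.
Proof.
move=> H1 H2; split=> /=; last by move=> /H1[].
by case: posnP => [/H2 ->|/H1[]].
Qed.

Section Emission.
Variables (sg : signature) (X vb np nB nR nT nC q : nat) (le : nat -> nat) (m0 : nat -> nat).
Local Notation k := (size (arities sg)).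
Local Notation V := (varcode sg).
Local Notation enc := (@enc_formula sg).
Hypothesis HX : bounds sg X nB nR nT nC.
Hypothesis He0 : env sg vb np nB nR nT nC m0.
Hypothesis Hg : forall i, i < q -> m0 (68 + 5 * i) = (le i + 1) * nB.
Hypothesis HleX : forall i, i < q -> (le i + 1) * nB <= X.

Lemma env_frame m : frame m0 m -> env sg vb np nB nR nT nC m.
Proof.
move=> Hf; case: He0 => *; split; try by rewrite Hf.
move=> R; rewrite Hf //; apply/orP; right.
by rewrite (_ : 64 + _ - 64 = R * 5) ?modnMl //; lia.
Qed.

Lemma prints_free (f : nat -> seq nat) c m st a : frame m0 m -> represents_scan m st -> m sL = a ->
  m sFree = (a \notin sbound st) -> (isfree sg st a -> prints X c m (f a)) ->
  prints X (freeC c) m (emit_free sg f st a).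
Proof.
move=> Hf Hr Ha Hfree; rewrite /emit_free /isfree => Hc.
have e1 : eval m (neqE (EV sPrev) (EC 3)) = (sprev st != 3).
  by rewrite eval_neqE /= (rs_prev Hr).
have e2 : (0 < eval m (ESub (EAdd (EV sL) (EC 1)) (EAdd (EC 8) (EV rK)))) = (8 + k <= a).
  by rewrite /= Ha (env_K (env_frame Hf)) subn_gt0 addn1 ltnS.
move: Hc; case E3 : (sprev st != 3) => /= Hc; last by apply: prints_If; rewrite e1 E3.
apply: prints_If; rewrite e1 E3 // => _.
move: Hc; case E8 : (8 + k <= a) => /= Hc; last by apply: prints_If; rewrite ?e2 ?E8.
apply: prints_If => [_|E]; last by move: e2; rewrite E E8.
move: Hc; case En : (a \notin sbound st) => /= Hc; apply: prints_If; rewrite /= Hfree En //= => _.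
Qed.

Definition open_piece (a : nat) : seq nat :=
  6 :: enc (Neg (isC sg vb np nB nR nT nC (a - (8 + k)))) ++ [:: 5].

Lemma prints_open m st a : frame m0 m -> represents_scan m st -> m sL = a ->
  m sFree = (a \notin sbound st) -> prints X openC m (emit_free sg open_piece st a).
Proof.
move=> Hf Hr Ha Hfree; apply: prints_free => // /and3P[_ Ha8 _].
have aV : V (a - (8 + k)) = a by rewrite /varcode subnKC.
apply: (@prints_Sq _ _ _ _ [:: 6]) => //; apply: prints_Sq => //.
apply: prints_neg; apply: prints_isC => //; last exact: env_frame.
by apply: stable_EV; rewrite // aV.
Qed.

Lemma prints_close m st a : frame m0 m -> represents_scan m st -> m sL = a ->
  m sFree = (a \notin sbound st) -> prints X closeC m (emit_free sg (fun=> [:: 7]) st a).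
Proof. by move=> Hf Hr Ha Hfree; apply: (@prints_free (fun=> [:: 7])). Qed.

Lemma prints_relativize m st a : frame m0 m -> represents_scan m st -> m sL = a ->
  (sprev st = 3 -> 8 + k <= a /\ size (sbound st) < q) -> size (sbound st) <= X ->
  prints X relativizeC m (emit_rel sg vb np nB nR nT nC le st a).
Proof.
move=> Hf Hr Ha HP HX'; have He := env_frame Hf.
rewrite /emit_rel; case: (eqVneq (sprev st) 3) => Hp.
  have [Ha8 Hq] := HP Hp.
  have aV : V (a - (8 + k)) = a by rewrite /varcode subnKC.
  rewrite -[_ ++ _]cats0; apply: prints_Sq; last first.
    by apply: prints_If => //; rewrite eval_neqE /= (rs_prev Hr) Hp.
  apply: prints_If; last by rewrite eval_eqE /= (rs_prev Hr) Hp.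
  move=> _; rewrite -[[:: a; 4; 6; 4]]/([:: a] ++ [:: 4] ++ [:: 6] ++ [:: 4]) -!catA.
  apply: prints_Sq; first exact: prints_Pr.
  do 3 (apply: prints_Sq; first exact: prints_Pr).
  apply: prints_Sq; last by apply: (@prints_Sq _ _ _ _ [:: 5]).
  apply: prints_guard => //; first by apply: stable_EV; rewrite // aV.
  - move=> m' P'; rewrite eval_ELd eval_arr -[eval m' (EV sD)]/(m' sD) (P' sD) // (rs_D Hr) P'; last lia.
    rewrite Hf ?Hg //; apply/orP; right.
    by rewrite (_ : _ - 64 = size (sbound st) * 5 + 4) ?modnMDl //; lia.
  - exact: HleX.
rewrite -[X in prints _ _ _ X]cat0s; apply: prints_Sq.
  by apply: prints_If => //; rewrite eval_eqE /= (rs_prev Hr) (negbTE Hp).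
apply: prints_If; last by rewrite eval_neqE /= (rs_prev Hr) Hp.
move=> _; have -> : (if (a == 5) || (a == 7) then rcons (nseq (size (sbound st) - size (head [::] (sstack st))) 7) a
    else [:: a]) = (if (a == 5) || (a == 7) then nseq (size (sbound st) - size (head [::] (sstack st))) 7 else [::]) ++ [:: a].
  by case: ifP; rewrite // cats1.
apply: prints_Sq; last exact: prints_Pr.
have evalE : eval m (EAdd (eqE (EV sL) (EC 5)) (eqE (EV sL) (EC 7))) = (a == 5) + (a == 7).
  by rewrite -[LHS]/(eval m (eqE (EV sL) (EC 5)) + eval m (eqE (EV sL) (EC 7))) !eval_eqE /= Ha.
apply: prints_If; rewrite evalE; last by case: (a == 5); case: (a == 7).
have topE : eval m (ESub (EV sD) (ELd (arr 1 (EV sSP)))) =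
    size (sbound st) - size (head [::] (sstack st)).
  rewrite -[LHS]/(m sD - m (eval m (arr 1 (EV sSP)))) eval_arr -[eval m (EV sSP)]/(m sSP) (rs_SP Hr) (rs_D Hr).
  by have := rs_stack Hr (leq0n _); rewrite subn0 nth0 => ->.
have fl i j : flatten [seq [:: 7] | _ <- iota i j] = nseq j 7 by elim: j i => //= j IH i; rewrite IH.
move=> H57; rewrite ifT; last by move: H57; case: (a == 5); case: (a == 7).
split; first by rewrite -topE -(fl 0).
by split=> //; rewrite topE; lia.
Qed.
End Emission.

Lemma sprev_run st w : sprev (scan_run st w) = last (sprev st) w.
Proof. by elim: w st => //= a w IH st; rewrite IH. Qed.

Lemma smax_run st w : smax st <= smax (scan_run st w).
Proof. by elim: w st => //= a w IH st; apply: leq_trans (IH _); exact: leq_maxl. Qed.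

Lemma sbound_run st w : size (sbound st) <= smax st ->
  size (sbound (scan_run st w)) <= smax (scan_run st w).
Proof. by elim: w st => //= a w IH st _; apply: IH; exact: leq_maxr. Qed.

Lemma outputs_weaken X c m w (Q Q' : (nat -> nat) -> Prop) :
  (forall m', Q m' -> Q' m') -> outputs X c m w Q -> outputs X c m w Q'.
Proof. by move=> H Hc o; have [m' [E q s]] := Hc o; exists m'; split=> //; exact: H. Qed.

Lemma emit_none st w : emit (fun _ _ => [::]) st w = [::].
Proof. by elim: w st => //= a w IH st; rewrite IH. Qed.

Lemma arity_npV (sg : signature) (R : symbol sg) : arity R <= npV sg.
Proof.
apply: leq_trans (leq_addr 2 _).
rewrite /sig_size sumnE (big_nth 0) big_mkord (bigD1 R) //=; exact: leq_addr.
Qed.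

Section Main.
Variables (sg : signature).
Local Notation k := (size (arities sg)).
Local Notation enc := (@enc_formula sg).
Local Notation V := (varcode sg).

Definition letter_ok (x y : nat) : bool := (x == 3) ==> (8 + k <= y).

Lemma path_letters x w : x != 3 -> all (predC1 3) w -> path letter_ok x w /\ last x w != 3.
Proof.
elim: w x => [|a w IH] x Hx //= /andP[Ha Hw]; rewrite {1}/letter_ok (negbTE Hx) /=.
exact: IH.
Qed.

(** That the last letter is never [ExL] carries the claim across concatenations. After a quantifier,
    [8 + k] can then be subtracted safely. *)
Lemma path_enc x (p : formula sg) : x != 3 -> path letter_ok x (enc p) /\ last x (enc p) != 3.
Proof.
have V3 y : 8 + k + y != 3 by exact: V_neq3.
elim: p x => [y z|R v|p IH|p IHp r IHr|y p IH] x Hx.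
- by apply: path_letters => //; rewrite enc_Eq /= /varcode !V3.
- apply: path_letters => //.
  have -> : enc (Rel R v) = [:: 8 + R, 6 & map (code k) (comma_sep v) ++ [:: 7]].
    by rewrite /enc_formula /= map_cat.
  rewrite [all _ _]/= all_cat /= andbT; elim: (tval v) => // y [|z s] IH //.
- by rewrite enc_Neg /= {1}/letter_ok (negbTE Hx) /=; exact: IH.
- rewrite enc_Or /= {1}/letter_ok (negbTE Hx) cat_path /= last_cat /= cat_path /= last_cat /=.
  have [-> l1] := IHp 6 isT; have [-> l2] := IHr 5 isT.
  by rewrite /letter_ok (negbTE l1) (negbTE l2).
- rewrite enc_Ex /= {1}/letter_ok (negbTE Hx) /letter_ok /= leq_addr /=.
  exact: IH (V_neq3 sg y).
Qed.

Variables (X d : nat) (phi : formula sg).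
Local Notation w := (enc phi).
Local Notation len := (size w).
Local Notation q := (qrank phi).
Local Notation nB := (nBV d q).
Local Notation np := (npV sg).
Local Notation nT := (nTV d len q).
Local Notation nC := (nCV sg d len q).
Local Notation vb := (sumn w).
Local Notation S := (cellsize nB (rad q)).
Hypothesis HN : number_bounds X sg d len q.
Hypothesis X2 : 1 < X.

Lemma scan_whole : exists ext pv, [/\ pv != 3,
    scan_run scan_init w = Scan pv ext [::] q,
    emit (emit_rel sg vb np nB (rad q) nT nC (lev q)) scan_init w ++ nseq (size ext) 7 =
      enc (rel_ vb np nB (rad q) nT nC (lev q) 0 phi) &
    forall f, emit (emit_free sg f) scan_init w = flatten [seq f (V x) | x <- fv phi]].
Proof.
have [ext [pv [H1 H2 H3 H4]]] := @scan_formula sg vb np nB (rad q) nT nC (lev q) phi 0 [::] [::] 0 isT isT.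
exists ext, pv; split=> //; first by rewrite H2 cats0 max0n.
by move=> f; rewrite H4 /free_occ filter_predT.
Qed.

Lemma run_smax i : i <= len -> smax (scan_run scan_init (take i w)) <= q.
Proof.
move=> Hi; have [ext [pv [_ E _ _]]] := scan_whole.
have := smax_run (scan_run scan_init (take i w)) (drop i w).
by rewrite -scan_run_cat cat_take_drop E.
Qed.

Lemma run_sbound i : size (sbound (scan_run scan_init (take i w))) <= q.
Proof.
case: (leqP i len) => Hi; last rewrite take_oversize ?(ltnW Hi) // -(take_size w);
  by apply: leq_trans (sbound_run _ _) (run_smax _).
Qed.

Lemma run_ok i : i < len ->
  sprev (scan_run scan_init (take i w)) = 3 ->
  8 + k <= nth 0 w i /\ size (sbound (scan_run scan_init (take i w))) < q.
Proof.
move=> Hi Hp; split.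
  have [Hpath _] := @path_enc 0 phi isT.
  rewrite -(cat_take_drop i w) cat_path (drop_nth 0 Hi) /= in Hpath.
  case/and3P: Hpath => _; rewrite /letter_ok.
  by rewrite sprev_run in Hp; rewrite Hp eqxx.
(* This letter opens one more quantifier, and the depth never exceeds [q]; so the table of guards
   has an entry for the current depth. *)
have := run_smax Hi; rewrite (take_nth 0 Hi) -cats1 scan_run_cat /= /scan_bound Hp eqxx /=.
by rewrite geq_max => /andP[].
Qed.

Lemma S_gt0 : 0 < S.
Proof. by rewrite /cellsize /nBV /nu; nia. Qed.

Lemma macro_bounds : bounds sg X nB (rad q) nT nC.
Proof.
split; [exact: nb_k HN|exact: nb_B HN|exact: ltnW (nb_S HN)|exact: nb_rad HN|
  exact: ltnW (nb_T HN)| |exact: X2|].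
- by apply: leq_trans (nb_C HN); rewrite leq_pmulr // S_gt0.
- by move=> R; exact: leq_trans (arity_npV R) (nb_np HN).
Qed.

Lemma mainC_correct m : m rD = d -> m rK = k -> m rLen = len -> m 65 = 0 ->
  (forall i, i < k -> m (64 + 5 * i) = nth 0 (arities sg) i) ->
  (forall i, i < len -> m (64 + 5 * (k + i)) = nth 0 w i) ->
  outputs X mainC m (enc (normal_form vb np nB (rad q) nT nC (lev q) phi)) (fun=> True).
Proof.
move=> Hd Hk Hlen H65 Har Hw; have HB := macro_bounds.
have [ext [pvl [Hpv Erun Erel Efree]]] := scan_whole.
have lenX : len <= X by exact: nb_len HN.
have qX : q <= X by exact: nb_q HN.
pose P st a := (sprev st = 3 -> 8 + k <= a /\ size (sbound st) < q) /\ size (sbound st) <= X.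
have runP i : i < len -> P (scan_run scan_init (take i w)) (nth 0 w i).
  by move=> Hi; split; [exact: run_ok|exact: leq_trans (run_sbound i) qX].
have runX i : i < len -> size (sbound (scan_run scan_init (take i w))) <= X.
  by move=> _; exact: leq_trans (run_sbound i) qX.
have rep65 m1 : represents_scan m1 (scan_run scan_init w) -> m1 65 = 0.
  by move=> Hr; have := rs_stack Hr (leq0n _); rewrite Erun.
have none_pass : outputs X (scan_pass noneC) m [::]
    (fun m1 => frame m m1 /\ represents_scan m1 (scan_run scan_init w)).
  move=> o; have [||m1 [E f r s]] := @pass_correct X m noneC (fun _ _ => [::]) P isT _ w Hlen _ lenX runP runX m o (frame_refl m) H65.
  - by [].
  - by move=> i Hi; rewrite Hk Hw.
  by exists m1; split=> //; rewrite E emit_none.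
(* The word is cut as [mainC] prints it. Its first three commands print nothing, the [size ext]
   parentheses belong to quantifiers still open at the end, and the last three close the
   disjunctions of [matrix]. *)
have -> : enc (normal_form vb np nB (rad q) nT nC (lev q) phi) =
  [::] ++ [::] ++ [::] ++ flatten [seq [:: 3; V (yv vb np nB (rad q) nT + i)] | i <- iota 0 (nC * S)] ++
  [:: 4; 3; V vb; 4; 4; 6] ++
  emit (emit_free sg (open_piece sg vb np nB (rad q) nT nC)) scan_init w ++
  enc (Neg (Eq vb vb)) ++
  emit (emit_free sg (fun=> [:: 7])) scan_init w ++
  ([:: 5] ++ [:: 6] ++ enc (V2 sg vb np nB (rad q) nT nC) ++ [:: 5] ++ [:: 6] ++
    enc (V3 sg vb np nB (rad q) nT nC) ++ [:: 5] ++ [:: 4]) ++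
  emit (emit_rel sg vb np nB (rad q) nT nC (lev q)) scan_init w ++
  nseq (size ext) 7 ++ [:: 7; 7; 7].
  rewrite !cat0s /normal_form enc_exs; congr (_ ++ _).
  rewrite /All enc_Neg enc_Ex enc_Neg /matrix enc_Neg enc_Or.
  rewrite [emit (emit_rel _ _ _ _ _ _ _ _) _ _ ++ _]catA Erel !Efree /V1 enc_bigor enc_Or enc_Or enc_Neg.
  have -> : flatten [seq [:: 7] | _ <- fv phi] = nseq (size (fv phi)) 7 by elim: (fv phi) => //= _ l ->.
  have -> : [seq open_piece sg vb np nB (rad q) nT nC (V x) | x <- fv phi] =
     [seq 6 :: enc (Neg (isC sg vb np nB (rad q) nT nC x)) ++ [:: 5] | x <- fv phi].
    by apply: eq_map => x; rewrite /open_piece /varcode addKn.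
  by rewrite enc_Neg enc_Eq /= -!catA /= -!catA /= -!catA.
rewrite /mainC [seqc (scan_pass noneC) _]/=.
apply: (outputs_Sq none_pass) => m1 [f1 r1].
apply: (outputs_Sq (outputs_silent (silent_St X (EC rQ) (EV sMax) m1))) => m2 <-.
set m2' := upd m1 16 q.
have -> : upd m1 (eval m1 (EC rQ)) (eval m1 (EV sMax)) = m2' by rewrite /= (rs_max r1) Erun.
have keep x : (x < 19) && (x != 16) || (64 <= x) && ((x - 64) %% 5 \notin [:: 1; 2]) -> m2' x = m x.
  move=> Hx; rewrite /m2' updE ifF; first by apply: f1; case/orP: Hx => [/andP[-> _]|->]; rewrite ?orbT.
  by apply/eqP => Ex; move: Hx; rewrite Ex.
have arr0 i : m2' (64 + 5 * i) = m (64 + 5 * i).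
  by apply: keep; apply/orP; right; rewrite (_ : _ - 64 = i * 5) ?modnMl //; lia.
have [|||||||m3 [S3 K3 E3 X3 G3]] := @numC_correct X sg d len q w HN m2'.
- by rewrite keep.
- by rewrite keep.
- by rewrite keep.
- by rewrite /m2' updE.
- by move=> i Hi; rewrite arr0 Har.
- by move=> i Hi; rewrite arr0 Hw.
- by [].
apply: (outputs_Sq (outputs_silent S3)) => m4 <-.
have H65' : m3 65 = 0 by rewrite K3 // /m2' updE /= (rep65 _ r1).
have L3 : m3 rLen = len by rewrite K3 // keep.
have nt i : ~~ num_targets (64 + 5 * i) /\ ~~ (20 <= 64 + 5 * i < 50).
  by split; last lia; rewrite /num_targets /in_arr (_ : _ - 64 = i * 5) ?modnMl; lia.
have W3 i : i < len -> m3 (64 + 5 * (m3 rK + i)) = nth 0 w i.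
  by move=> Hi; have [n1 n2] := nt (k + i); rewrite (env_K E3) K3 // arr0 Hw.
have levX i : i < q -> (lev q i + 1) * nB <= X.
  move=> _; apply: leq_trans (ltnW (nb_S HN)); rewrite /cellsize leq_mul2r leq_add2r.
  by rewrite leq_subr orbT.
pose Inv m' := frame m3 m' /\ represents_scan m' (scan_run scan_init w).
have pass em g m' : pure em -> (forall m'' st a, frame m3 m'' -> represents_scan m'' st -> m'' sL = a ->
    m'' sFree = (a \notin sbound st) -> P st a -> prints X em m'' (g st a)) ->
    frame m3 m' -> m' 65 = 0 -> outputs X (scan_pass em) m' (emit g scan_init w) Inv.
  move=> pem Hem f' z' o.
  have [m'' [E f r s]] := @pass_correct X m3 em g P pem Hem w L3 W3 lenX runP runX m' o f' z'.
  by exists m''.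
have pureI c m' u : pure c -> Inv m' -> prints X c m' u -> outputs X c m' u Inv.
  move=> pc I p o; have [m'' [E e s]] := outputs_pure pc p o.
  by exists m''; split=> //; rewrite -e.
have HCX : nC * S <= X := nb_C HN.
apply: (@outputs_Sq _ _ _ _ _ _ (eq m3)) => [|_ <-].
  apply: outputs_pure => //; split=> [|/=]; last by rewrite X3.
  by rewrite /= X3 (env_Y E3); congr flatten; apply: eq_map => i; rewrite muln1 /varcode addnA.
apply: (@outputs_Sq _ _ _ _ _ _ (eq m3)) => [|_ <-].
  by apply: outputs_pure => //; split; rewrite /= ?(env_Z E3).
apply: outputs_Sq.
  apply: pass => // m'' st a f r l fr _; exact: (prints_open HB E3 f r l fr).
move=> m5 I5; apply: outputs_Sq.
  apply: (pureI _ _ _ _ I5) => //; apply: prints_neg; have Z5 := env_Z (env_frame E3 I5.1).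
  exact: prints_eq.
move=> m6 [f6 r6]; apply: outputs_Sq.
  apply: pass (rep65 _ r6) => // m'' st a f r l fr _; exact: (prints_close X E3 f r l fr).
move=> m7 I7; have E7 := env_frame E3 I7.1; apply: outputs_Sq.
  apply: (pureI _ _ _ _ I7) => //.
  apply: (@prints_Sq _ _ _ _ [:: 5]) => //; apply: (@prints_Sq _ _ _ _ [:: 6]) => //.
  apply: prints_Sq; first exact: prints_V2.
  apply: (@prints_Sq _ _ _ _ [:: 5]) => //; apply: (@prints_Sq _ _ _ _ [:: 6]) => //.
  by apply: prints_Sq; first exact: prints_V3.
move=> m8 [f8 r8]; apply: outputs_Sq.
  apply: pass (rep65 _ r8) => // m'' st a f r l fr [Pa Pb].
  exact: (prints_relativize HB E3 G3 levX).
move=> m9 I9; apply: outputs_Sq.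
  apply: (pureI _ _ _ _ I9) => //; split=> /=; rewrite (rs_D I9.2) Erun /=.
    have fl i j : flatten [seq [:: 7] | _ <- iota i j] = nseq j 7 by elim: j i => //= j IH i; rewrite IH.
    exact: fl.
  split=> //; apply: leq_trans qX; have := run_sbound len.
  by rewrite take_size Erun.
move=> m10 _; apply: (outputs_weaken (Q := eq m10)) => //.
by apply: outputs_pure.
Qed.
End Main.

(** * Running time *)

Lemma rad_le4 q : rad q < 4 ^ q.
Proof. by elim: q => // q IH; rewrite radS expnS; lia. Qed.

(** With [2 <= d] all powers of [d - 1] are at least 1. So [nu] also exceeds the radius, and the
    single number [N] dominates both. *)
Lemma nu_ge d r : 2 <= d -> 1 + d * r <= nu d r.
Proof.
move=> Hd; rewrite /nu leq_add2l leq_mul2l; apply/orP; right.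
rewrite -[X in X <= _](_ : \sum_(0 <= i < r) 1 = r); last by rewrite sum_nat_const_nat; lia.
by apply: leq_sum => i _; rewrite expn_gt0; apply/orP; left; lia.
Qed.

Lemma size_comma_sep s : size s <= size (comma_sep s).
Proof. by elim: s => // x [|y s] //= IH; lia. Qed.

Lemma size_enc (sg : signature) (p : formula sg) : size (enc_formula p) = formula_size p.
Proof. by rewrite size_map. Qed.

(** The left side counts the pairs of the game, free variables and one per round; hence [len * nB]
    is a valid choice of [nT]. *)
Lemma fv_qrank_size (sg : signature) (p : formula sg) :
  size (fv p) + qrank p <= formula_size p.
Proof.
rewrite /formula_size; elim: p => [x y|R v|p IH|p IHp r IHr|x p IH] //=.
- by rewrite size_cat size_tuple /=; have := size_comma_sep v; rewrite size_tuple; lia.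
- lia.
- by rewrite size_cat !size_cat /= size_cat /=; lia.
- apply: (@leq_trans (size (fv p) + (qrank p).+1)); last lia.
  by rewrite leq_add2r size_filter count_size.
Qed.

Lemma vars_enc (sg : signature) (p : formula sg) x : x \in vars p -> x < sumn (enc_formula p).
Proof.
have comma n (v : seq nat) : x \in v -> x < sumn (map (code n) (comma_sep v)).
  elim: v => // y [|z s] IH; first by rewrite inE => /eqP ->; rewrite /=; lia.
  rewrite inE -[comma_sep _]/[:: VarL y, CommaL & comma_sep (z :: s)] !map_cons.
  by move: (comma_sep (z :: s)) IH => l IH /orP[/eqP ->|/IH] /=; lia.
elim: p => [y z|R v|p IH|p IHp r IHr|y p IH] /=.
- by rewrite !inE /= => /orP[]/eqP ->; lia.
- by move=> /(comma (size (arities sg))); rewrite /enc_formula /= map_cat sumn_cat; lia.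
- by move=> /IH; rewrite /enc_formula; lia.
- by rewrite mem_cat map_cat sumn_cat /= map_cat sumn_cat => /orP[/IHp|/IHr]; rewrite /enc_formula; lia.
- by rewrite inE => /orP[/eqP ->|/IH]; rewrite /enc_formula; lia.
Qed.

(** Compares the number of atomic facts in a cell with the power that the program computes; the [2]
    accounts for equality, which is binary. *)
Lemma sum_pow_le b (ar : seq nat) : 0 < b -> all (leq 1) ar ->
  b * b + sumn [seq b ^ a | a <- ar] <= b.+1 ^ (sumn ar + 2).
Proof.
move=> b0; elim: ar => [|a ar IH] /=; first by rewrite add0n !expnS expn0; nia.
case/andP=> Ha /IH {}IH; rewrite -addnA expnD.
have H1 : b ^ a <= b.+1 ^ a by rewrite leq_exp2r.
have b1 : 1 < b.+1 by [].
have H2 : 2 <= b.+1 ^ a by exact: leq_trans (ltn_expl a b1).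
have H3 : 2 <= b.+1 ^ (sumn ar + 2) by apply: leq_trans (ltn_expl _ b1); lia.
by nia.
Qed.

Section Bounds.
Variables (sg : signature) (d len q n N : nat).
Local Notation R := ((n + 1) * (2 * 4 ^ q + 1)).
Local Notation sz := (sig_size sg).
Hypothesis d2 : 2 <= d.
Hypothesis len_gt0 : 0 < len.
Hypothesis q_len : q <= len.
Hypothesis NE : N = len * nu d R.
Local Notation X := (2 ^ (N ^ (3 * sz + 7))).
Local Notation S := (cellsize (nBV d q) (rad q)).

Lemma arities_sum : size (arities sg) <= sz.
Proof.
rewrite /sig_size; have := arities_gt0 sg; elim: (arities sg) => //= a s IH /andP[a1 /IH]; lia.
Qed.

Lemma N_ge : [/\ 2 <= N, d <= N, rad q < N, len <= N & len * nBV d q <= N].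
Proof.
have Hr := rad_le4 q; have rR : rad q < R by nia.
have Hnu := nu_ge R d2; have HB : nBV d q <= nu d R by exact: nu_mono (ltnW rR).
have r0 : 0 < R by lia.
by split; nia.
Qed.

Lemma le_X j x : x <= N ^ j -> j <= 3 * sz + 7 -> x < X.
Proof.
have [N2 _ _ _ _] := N_ge => Hx Hj; apply: leq_ltn_trans (Hx) _.
apply: leq_ltn_trans (ltn_expl _ (ltnSn 1)).
by rewrite leq_exp2l.
Qed.

(** From [S <= N ^ 2] follows [S + 1 <= N ^ 3], so the power to [npV], which is [sz + 2], is at most
    [N ^ (3 * sz + 6)]. One more factor [N] makes room for [nCV * S], the count of the longest
    loop. *)
Lemma number_bounds_X : number_bounds X sg d len q.
Proof.
have [N2 Nd Nr Nl NB] := N_ge.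
have B_N : nBV d q <= N by nia.
have S_N : S <= N ^ 2 by rewrite /cellsize expnS expn1; nia.
have S1_N : S + 1 <= N ^ 3 by rewrite !expnS expn0 in S_N *; nia.
have le1 x : x <= N -> x < X by move=> Hx; apply: (@le_X 1); rewrite ?expn1 //; lia.
have e_N : (S + 1) ^ npV sg <= N ^ (3 * sz + 6).
  have -> : 3 * sz + 6 = 3 * npV sg by rewrite /npV; lia.
  by rewrite expnM leq_exp2r // /npV; lia.
have sz_X : sz + 2 <= X.
  have H : sz < N ^ sz by apply: ltn_expl.
  by apply: ltnW; apply: (@le_X (sz + 1)); last lia; rewrite addn1 expnS; nia.
split.
- by apply: leq_trans sz_X; have := arities_sum; lia.
- exact/ltnW/le1.
- by apply/ltnW/le1; lia.
- by apply/ltnW/le1; lia.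
- exact/ltnW/le1.
- exact/ltnW/le1.
- by apply: (le_X S_N); lia.
- exact: sz_X.
- by apply/ltnW/(le_X e_N); lia.
- exact: le1.
rewrite /nCV; set M := N ^ (3 * sz + 6).
have H1 : 2 ^ ((S + 1) ^ npV sg) <= 2 ^ M by rewrite leq_exp2l.
have -> : N ^ (3 * sz + 7) = N * M by rewrite /M -expnS; congr (_ ^ _); lia.
have HT : nTV d len q <= N by [].
have M_ge : N ^ 5 <= M by rewrite leq_exp2l //; lia.
have H2 : (2 * N + 1) * N ^ 2 <= N ^ 5.
  by rewrite (_ : 5 = 3 + 2) // expnD leq_mul2r; apply/orP; right; rewrite !expnS expn0; nia.
have H3 : N ^ 5 < 2 ^ M by apply: leq_ltn_trans M_ge _; exact: ltn_expl.
have p0 : 0 < 2 ^ M by rewrite expn_gt0.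
apply: (@leq_trans (2 ^ M * (2 * N + 1) * N ^ 2)).
  apply: leq_mul => //; nia.
apply: (@leq_trans (2 ^ M * 2 ^ M)); first by rewrite -mulnA leq_mul2l; apply/orP; right; lia.
by rewrite -expnD leq_exp2l //; nia.
Qed.

(** Since [X + 10 <= X ^ 4], a fixed power only multiplies the exponent [N ^ (3 * sz + 7)] by a
    constant [K], and [K < N ^ K] moves it into the upper exponent. The [3] added to [c] pays for
    reading the input. *)
Lemma total_time (c : nat) : 12 + 5 * (size (arities sg) + len) + (X + 10) ^ c <=
  2 ^ (N ^ (3 * sz + 7 + 4 * (c + 3))).
Proof.
have [N2 _ _ _ _] := N_ge; have [k_X l_X _ _ _ _ _ _ _ _ _] := number_bounds_X.
have X2 : 2 <= X by apply: (@le_X 0); rewrite ?expn0; lia.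
have XE : X + 10 <= X ^ 4.
  move: X2; move: (X) => x x2; have -> : x ^ 4 = (x * x) * (x * x) by rewrite !mulnn -expnM.
  have H : 2 * x <= x * x by rewrite leq_mul2r x2 orbT.
  by apply: leq_trans (leq_mul H H); nia.
apply: (@leq_trans ((X + 10) ^ (c + 3))).
  move: k_X l_X; move: (X) => x kx lx; have p0 : 0 < (x + 10) ^ c by rewrite expn_gt0 addn_gt0 orbT.
  rewrite expnD; move: p0; move: ((x + 10) ^ c) => P p0; rewrite !expnS expn0.
  have H : 12 + 5 * (size (arities sg) + len) <= (x + 10) * (x + 10) by nia.
  by move: H; move: (12 + _) => a H; nia.
apply: (@leq_trans (X ^ (4 * (c + 3)))); first by rewrite expnM leq_exp2r //; lia.
rewrite -expnM leq_exp2l // (expnD N (3 * sz + 7)) leq_mul2l; apply/orP; right.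
exact/ltnW/ltn_expl.
Qed.
End Bounds.

(** * Reading the input, and the complete machine *)

Definition offset := csize mainC + 10.

(** Addresses 5 to 9 are the reading loop: register 3 points to the next entry of array 0 and
    register 5 counts. Arities and letter codes are positive, so 0 marks the end. It is counted too,
    hence the subtraction of 1; removing the number of arities leaves the length of the word. *)
Definition readP : program :=
  [:: Const 1 1; Read (offset + rD); Read (offset + rK); Const 3 (offset + 64); Const 4 5;
      Read 2; StoreAt 3 2; Add 3 3 4; Add 5 5 1; Jump 2 5;
      Defs.Sub 5 5 1; Defs.Sub (offset + rLen) 5 (offset + rK)].

(** The reader has 12 instructions. [offset] lies above its registers and above the temporaries of
    the compiled code, which start at 2. *)
Definition compiler : program := readP ++ cc offset 12 2 mainC.

Definition input_mem (d k : nat) (l : seq nat) : nat -> nat := fun x =>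
  if x == rD then d else if x == rK then k else
  if (64 <= x) && ((x - 64) %% 5 == 0) then nth 0 l ((x - 64) %/ 5) else 0.

Lemma input_mem_arr d k l i : input_mem d k l (64 + 5 * i) = nth 0 l i.
Proof.
rewrite /input_mem; do 2 (case: eqP => [|_]; first lia).
by rewrite (_ : 64 + 5 * i - 64 = i * 5) ?modnMl ?mulnK //; lia.
Qed.

Lemma input_mem_rcons d k l a :
  upd (input_mem d k l) (64 + 5 * size l) a = input_mem d k (rcons l a).
Proof.
apply: functional_extensionality => x; rewrite updE; case: eqP => [->|Hx].
  by rewrite input_mem_arr nth_rcons ltnn eqxx.
rewrite /input_mem; do 2 case: ifP => // _.
case: ifP => // /andP[Hx1 Hx2]; rewrite nth_rcons.
have Hn : (x - 64) %/ 5 != size l by lia.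
by rewrite (negbTE Hn); case: ltnP => // Hs; rewrite nth_default.
Qed.

(** The reader also stores the final 0, which is what an untouched cell contains anyway. *)
Lemma input_mem_rcons0 d k l : input_mem d k (rcons l 0) = input_mem d k l.
Proof.
apply: functional_extensionality => x; rewrite /input_mem nth_rcons.
case: (ltnP _ (size l)) => // Hs; rewrite (nth_default _ Hs).
by rewrite if_same.
Qed.

Record reading (d k : nat) (l : seq nat) (m : nat -> nat) : Prop := Reading {
  rd_0 : m 0 = 0; rd_1 : m 1 = 1; rd_3 : m 3 = offset + 64 + 5 * size l; rd_4 : m 4 = 5;
  rd_5 : m 5 = size l; rd_mem : forall x, m (offset + x) = input_mem d k l x }.

Section Run.
Variable P : program.
Hypothesis HP : code_at P 0 readP.

Lemma readE i ins : onth readP i = Some ins -> onth P i = Some ins.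
Proof.
move=> E; have Hi : i < size readP by case: (ltnP i (size readP)) E => // Hi; rewrite onth_default.
by move: (HP Hi); rewrite add0n E.
Qed.

Lemma read_letter d k l u m o : reading d k l m -> let a := head 0 u in
  exists m', iter 5 (step P) (Config 5 m u o) = Config (if 0 < a then 5 else 10) m' (behead u) o
    /\ reading d k (rcons l a) m'.
Proof.
move=> + a.
case=> m0 m1 m3 m4 m5 mm.
have H5 := @readE 5 (Read 2) erefl; have H6 := @readE 6 (StoreAt 3 2) erefl.
have H7 := @readE 7 (Add 3 3 4) erefl; have H8 := @readE 8 (Add 5 5 1) erefl.
have H9 := @readE 9 (Jump 2 5) erefl.
pose m' := upd (upd (upd (upd m 2 a) (m 3) a) 3 (m 3 + 5)) 5 (size l).+1.
have off5 : 9 < offset by rewrite /offset addnC.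
exists m'; split.
  rewrite !iterS [iter 0 _ _]/= (stepE _ _ _ H5) /= -/a (stepE _ _ _ H6) /=.
  rewrite (stepE _ _ _ H7) /= (stepE _ _ _ H8) /= (stepE _ _ _ H9) /=.
  have n1 x : x <= 9 -> (x == offset + 64 + 5 * size l) = false by lia.
  have E : upd (upd m 2 a) (upd m 2 a 3) (upd m 2 a 2) = upd (upd m 2 a) (m 3) a by [].
  rewrite E !updE /= m1 m3 m4 m5 !n1 //=; congr Config.
  by rewrite addn1 /m' m3.
have n1 x : x <= 9 -> (x == m 3) = false by rewrite m3; lia.
split; rewrite /m' ?updE /= ?n1 ?size_rcons //; first by rewrite m3; lia.
move=> x; rewrite -input_mem_rcons !updE -mm m3 -(eqn_add2l offset) addnA.
by do 3 (case: (altP (_ =P _)) => // ?; try lia).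
Qed.

Lemma read_letters d k u l m o : all (leq 1) u -> reading d k l m ->
  exists m', iter (5 * (size u).+1) (step P) (Config 5 m u o) = Config 10 m' [::] o
    /\ reading d k (rcons (l ++ u) 0) m'.
Proof.
elim: u l m => [|a u IH] l m => [_|/andP[Ha Hu]] Hl; rewrite [size _]/=.
  by rewrite cats0; have [m' [E H]] := read_letter [::] o Hl; exists m'.
have [m' [E H]] := read_letter (a :: u) o Hl; rewrite [head _ _]/= Ha [behead _]/= in E H.
have [m'' [E' H']] := IH _ _ Hu H; exists m''.
by rewrite (_ : 5 * (size u).+2 = 5 * (size u).+1 + 5) ?iterD ?E ?E' -?cat_rcons //; lia.
Qed.

Lemma read_input d k u : all (leq 1) u ->
  exists m', iter (5 * size u + 12) (step P) (init (d :: k :: u)) = Config 12 m' [::] [::] /\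
    represents offset m' (upd (input_mem d k u) rLen (size u - k)).
Proof.
move=> Hu; have offE : 9 < offset by rewrite /offset addnC.
have H0 := @readE 0 (Const 1 1) erefl; have H1 := @readE 1 (Read (offset + rD)) erefl.
have H2 := @readE 2 (Read (offset + rK)) erefl; have H3 := @readE 3 (Const 3 (offset + 64)) erefl.
have H4 := @readE 4 (Const 4 5) erefl; have H10 := @readE 10 (Defs.Sub 5 5 1) erefl.
have H11 := @readE 11 (Defs.Sub (offset + rLen) 5 (offset + rK)) erefl.
pose m1 := upd (upd (upd (upd (upd (fun=> 0) 1 1) (offset + rD) d) (offset + rK) k) 3 (offset + 64)) 4 5.
have E1 : iter 5 (step P) (init (d :: k :: u)) = Config 5 m1 u [::].
  rewrite !iterS [iter 0 _ _]/= (stepE _ _ _ H0) /= (stepE _ _ _ H1) /=.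
  by rewrite (stepE _ _ _ H2) /= (stepE _ _ _ H3) /= (stepE _ _ _ H4).
have n1 x y : x <= 9 -> (x == offset + y) = false by lia.
have n2 x y : x <= 9 -> (offset + y == x) = false by lia.
have R1 : reading d k [::] m1.
  split; rewrite /m1 ?updE /= ?n1 ?addn0 // => x.
  rewrite !updE (n2 4) // (n2 3) // (n2 1) // !eqn_add2l /input_mem.
  case: (x =P rK) => [->|_] //; case: ifP => // _; by rewrite nth_nil if_same.
have [m2 [E2 [z0 z1 z3 z4 z5 zm]]] := read_letters [::] Hu R1.
exists (upd (upd m2 5 (size u)) (offset + rLen) (size u - k)); split.
  rewrite (_ : 5 * size u + 12 = 2 + (5 * (size u).+1 + 5)); last lia.
  rewrite !iterD E1 E2 !iterS [iter 0 _ _]/= (stepE _ _ _ H10) /= (stepE _ _ _ H11) /=.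
  rewrite z1 z5 size_rcons /= subn1 /= !updE eqxx /=.
  by rewrite (zm 10).
rewrite input_mem_rcons0 /= in zm.
split; rewrite ?updE ?n1 //= => x; by rewrite !updE eqn_add2l (n2 5) // zm.
Qed.
End Run.

Lemma compiler_correct (d : nat) (sg : signature) (phi : formula sg) (X : nat) (v : seq nat) :
  let w := enc_formula phi in
  let m := upd (input_mem d (size (arities sg)) (arities sg ++ w)) rLen (size w) in
  outputs X mainC m v (fun=> True) ->
  computes_within compiler (enc_input d phi) v
    (12 + 5 * (size (arities sg) + size w) + (X + 10) ^ csize mainC).
Proof.
move=> w m Hout.
have [HP1 HP2] : code_at compiler 0 readP /\ code_at compiler 12 (cc offset 12 2 mainC).
  by apply/(code_at_cat compiler 0); move=> i Hi.
have Hu : all (leq 1) (arities sg ++ w).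
  rewrite all_cat arities_gt0 /=; apply/allP => _ /(nthP 0)[i Hi <-].
  by rewrite size_map in Hi; rewrite (nth_map CommaL) //; case: (nth _ _ _).
have [m1 [E1 R1]] := read_input HP1 d (size (arities sg)) Hu.
rewrite size_cat addKn -/m in R1.
have [m2 [E2 _ s2]] := Hout [::].
have [|m3 [E3 _ _]] := @cc_correct _ _ _ _ _ _ [::] [::] _ HP2 isT _ R1.
  by rewrite /offset; lia.
exists (time mainC (m, [::]) + (5 * size (arities sg ++ w) + 12)).
  have := time_small s2; rewrite size_cat; lia.
by rewrite iterD /enc_input E1 E3 E2; split=> //.
Qed.

Theorem theorem3 :
  exists (P : program) (f : nat -> nat),
    bigO f id /\
    forall (d : nat) (sg : signature) (phi : formula sg),
      2 <= d ->
      exists phiB : formula sg,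
        [/\ BSNF phiB,
            {subset fv phiB <= fv phi},
            d_equiv d phi phiB &
            computes_within P (enc_input d phi) (enc_formula phiB)
              (2 ^ ((formula_size phi
                      * nu d ((nb_fv phi + 1) * (2 * 4 ^ qrank phi + 1)))
                    ^ f (sig_size sg)))].
Proof.
(* [3 * s + 7] comes from the bound on loop lengths, the rest from raising it to a power; [mainC]
   does not depend on the input, so the rest is constant. *)
exists compiler, (fun s => 3 * s + 7 + 4 * (csize mainC + 3)); split.
  by exists (3 + 7 + 4 * (csize mainC + 3)), 1 => s; move: (csize mainC) => c; nia.
move=> d sg phi d2.
set q := qrank phi; set len := size (enc_formula phi).
have lenE : formula_size phi = len by rewrite /len size_enc.
have Hfq : size (fv phi) + q <= len by rewrite -lenE; exact: fv_qrank_size.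
have len0 : 0 < len by rewrite -lenE; case: phi {q len lenE Hfq}.
have q_len : q <= len by lia.
rewrite lenE; set N := len * _.
have nb := @number_bounds_X sg d len q (nb_fv phi) N d2 len0 q_len erefl.
set X := 2 ^ (N ^ (3 * sig_size sg + 7)) in nb.
have X2 : 1 < X by apply: leq_ltn_trans (nb_S nb); exact: S_gt0.
have HB := @macro_bounds sg X d phi nb X2.
have np2 : 2 <= npV sg by rewrite /npV leq_addl.
have nB0 : 0 < nBV d q by [].
have nTE : (size (fv phi) + q) * nBV d q <= nTV d len q by rewrite leq_mul2r Hfq orbT.
have S0 : 0 < cellsize (nBV d q) (rad q) by exact: S_gt0.
have nCE : 2 ^ (cellsize (nBV d q) (rad q) * cellsize (nBV d q) (rad q) +
    sumn [seq cellsize (nBV d q) (rad q) ^ a | a <- arities sg]) * (nTV d len q).+1 +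
    size (fv phi) <= nCV sg d len q.
  rewrite /nCV; apply: leq_add; last lia.
  rewrite leq_mul2r leq_exp2l // addn1; apply/orP; right.
  exact: sum_pow_le (arities_gt0 sg).
have Hv := @vars_enc sg phi.
exists (normal_form (sumn (enc_formula phi)) (npV sg) (nBV d q) (rad q) (nTV d len q)
   (nCV sg d len q) (lev q) phi); split.
- exact: (normal_form_BSNF (d := d) (@arity_npV sg)).
- by apply: fv_normal_form => // j; exact: leq_subr.
- exact: normal_form_equiv (@arity_npV sg) np2 nB0 (leqnn _) nTE Hv nCE.
pose m := upd (input_mem d (size (arities sg)) (arities sg ++ enc_formula phi)) rLen len.
have [||t Ht H] := compiler_correct (@mainC_correct sg X d phi nb X2 m erefl erefl erefl erefl _ _).
- move=> i Hi; rewrite /m updE; case: eqP => [|_]; first lia.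
  by rewrite input_mem_arr nth_cat Hi.
- move=> i Hi; rewrite /m updE; case: eqP => [|_]; first lia.
  by rewrite input_mem_arr nth_cat ltnNge leq_addr addKn.
exists t => //; apply: leq_trans Ht _; exact: (@total_time sg d len q (nb_fv phi) N d2 len0 q_len erefl).
Qed.
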